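(* Let $\nu>0$, $s>3/2$ and $\Omega\in\mathbb{R}$. Assume that $u_0\in H^s(\mathbb{R}^3)$ satisfies $\operatorname{div}u_0=0$ and $\|u_0\|_{\chi^{-1}}<(2\pi)^3\nu$. Let $u\in C([0,\infty);H^s)$ be the unique global solution to the Navier-Stokes equations with the Coriolis force $$\partial_t u-\nu\Delta u+\Omega e_3\times u+(u,\nabla)u+\nabla p=0,\qquad \operatorname{div}u=0\quad\text{in }(0,\infty)\times\mathbb{R}^3,\qquad u|_{t=0}=u_0,$$ satisfying $$u\in AC([0,\infty);H^{s-1})\cap L^1_{\mathrm{loc}}(0,\infty;H^{s+1})$$ and $$\sup_{t>0}\Bigl\{\|u(t)\|_{\chi^{-1}}+\bigl(\nu-(2\pi)^{-3}\|u_0\|_{\chi^{-1}}\bigr)\int_0^t\|u(\tau)\|_{\chi^1}\,d\tau\Bigr\}\le\|u_0\|_{\chi^{-1}}.$$ Then $$\lim_{t\to\infty}\|u(t)\|_{\chi^{-1}}=0.$$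
   Context: The Fourier transform is $\widehat f(\xi)=\mathcal F[f](\xi)=\int_{\mathbb{R}^3}e^{-ix\cdot\xi}f(x)\,dx$. For $m\in\mathbb{R}$, $$\chi^m(\mathbb{R}^3)=\Bigl\{f\in\mathcal S'\;\Big|\;\widehat f\in L^1_{\mathrm{loc}},\ \|f\|_{\chi^m}:=\int_{\mathbb{R}^3}|\xi|^m|\widehat f(\xi)|\,d\xi<\infty\Bigr\};$$ for vector fields, $|\widehat f(\xi)|$ is the Euclidean norm in $\mathbb{C}^3$. For $s>1/2$ one has $H^s(\mathbb{R}^3)\hookrightarrow\chi^{-1}(\mathbb{R}^3)$. The unknowns are the velocity field $u=u(t,x)=(u_1,u_2,u_3)$ ($\mathbb{R}^3$-valued) and the scalar pressure $p=p(t,x)$; $u_0$ is the initial velocity field, $\nu$ is the viscosity, $e_3=(0,0,1)$, $\Omega$ is the Coriolis parameter, and $(u,\nabla)u=\sum_{k=1}^3u_k\partial_k u$. In this class of functions, being a solution means that $\operatorname{div}u=0$, $u(0)=u_0$ and $$\partial_t u=\nu\Delta u-\Omega\,\mathbb{P}(e_3\times u)-\mathbb{P}\bigl[(u,\nabla)u\bigr]\quad\text{in }H^{s-1}\text{ for a.e. }t>0,$$ where $\mathbb{P}=(\delta_{ij}+R_iR_j)_{i,j}$ is the Helmholtz projection onto divergence-free fields ($R_j$ the Riesz transforms; $\mathbb{P}$ has Fourier symbol $\delta_{ij}-\xi_i\xi_j/|\xi|^2$). It is known that, under the stated hypotheses on $u_0$, a global solution with the listed properties exists and is unique. $AC(I;X)$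 denotes the space of absolutely continuous functions on the interval $I$ with values in the Banach space $X$; for $I=[0,\infty)$ this means absolute continuity on each compact interval $[0,T]$. $L^1_{\mathrm{loc}}(0,\infty;X)$ means membership in $L^1(0,T;X)$ for every finite $T>0$. *)

(* Defs.v *)
From HB Require Import structures.
From mathcomp Require Import all_boot all_order all_algebra.
From mathcomp Require Import all_classical all_reals all_analysis.
From mathcomp Require Import complex.

Set Implicit Arguments.
Unset Strict Implicit.
Unset Printing Implicit Defensive.

Import Order.TTheory GRing.Theory Num.Theory.
Import numFieldNormedType.Exports.

Local Open Scope classical_set_scope.
Local Open Scope ring_scope.

(* The norms of R * R * R and 'rV[R]_3 are sup norms; they only provide the
   topology used by 'D_v, and Euclidean lengths are written out below. *)
Notation R3 R := (R * R * R)%type.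

Notation field3 R := (R3 R -> 'rV[R]_3).

Notation leb3 R :=
  ((@lebesgue_measure R \x @lebesgue_measure R) \x @lebesgue_measure R)%E.

Section Space.
Context {R : realType}.

Definition coord3 (x : R3 R) (i : 'I_3) : R := tnth [tuple x.1.1; x.1.2; x.2] i.

Definition dir3 (k : 'I_3) : R3 R := ((k == 0)%:R, (k == 1)%:R, (k == 2)%:R).

Definition dot3 (x y : R3 R) : R := \sum_(i < 3) coord3 x i * coord3 y i.

Definition len3 (x : R3 R) : R := Num.sqrt (dot3 x x).

Definition cpt (f : field3 R) (i : 'I_3) : R3 R -> R := fun x => f x 0 i.

(* Indices live in 'I_3 = Z/3Z, so i + 1 and i + 2 are taken cyclically. *)
Definition cross (a b : 'rV[R]_3) : 'rV[R]_3 :=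
  \row_i (a 0 (i + 1) * b 0 (i + 2) - a 0 (i + 2) * b 0 (i + 1)).

Definition e3 : 'rV[R]_3 := delta_mx 0 2.

End Space.

Section Distributions.
Context {R : realType}.

Definition partials (l : seq 'I_3) (phi : R3 R -> R) : R3 R -> R :=
  foldr (fun k g => 'D_(dir3 k) g) phi l.

(* Real-valued Schwartz functions. A complex tempered distribution is
   determined by its values on them. *)
Definition schwartz (phi : R3 R -> R) : Prop :=
  forall l : seq 'I_3,
    [/\ continuous (partials l phi),
        forall (k : 'I_3) (x : R3 R), derivable (partials l phi) x (dir3 k)
      & forall n : nat, exists C : R, forall x : R3 R,
          (1 + len3 x) ^+ n * `|partials l phi x| <= C].

Definition L2 (f : R3 R -> R) : Prop := f \in Lfun (leb3 R) 2%:E.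

Definition cintegral (g : R3 R -> R[i]) : R[i] :=
  Complex (\int[leb3 R]_x complex.Re (g x))
          (\int[leb3 R]_x complex.Im (g x)).

Definition expi (t : R) : R[i] := Complex (cos t) (sin t).

Definition fourier_integral (phi : R3 R -> R) (x : R3 R) : R[i] :=
  cintegral (fun y => expi (- dot3 y x) * (phi y)%:C%C).

(* The Fourier transform of f as a tempered distribution is g. Only Sobolev
   spaces of positive order are needed, so f and g are square integrable. *)
Definition is_fourier (f : R3 R -> R) (g : R3 R -> R[i]) : Prop :=
  [/\ L2 f,
      L2 (fun y => complex.Re (g y)),
      L2 (fun y => complex.Im (g y))
    & forall phi, schwartz phi ->
        cintegral (fun y => g y * (phi y)%:C%C) =
        cintegral (fun x => (f x)%:C%C * fourier_integral phi x)].

(* A representative of the a.e.-class of Fourier transforms of f, which is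
   nonempty for square integrable f; the default 0 occurs only for other f. *)
Definition fourier (f : R3 R -> R) : R3 R -> R[i] :=
  xget (fun=> 0) [set g | is_fourier f g].

Definition fourier_abs (f : field3 R) (xi : R3 R) : R :=
  Num.sqrt (\sum_(i < 3) Normc.normc (fourier (cpt f i) xi) ^+ 2).

Definition has_fourier (f : field3 R) : Prop :=
  forall i, is_fourier (cpt f i) (fourier (cpt f i)).

Definition chi_norm (m : R) (f : field3 R) : \bar R :=
  \int[leb3 R]_xi (len3 xi `^ m * fourier_abs f xi)%:E.

Definition Hs_norm (s : R) (f : field3 R) : \bar R :=
  sqrte (\int[leb3 R]_xi ((1 + len3 xi ^+ 2) `^ s * fourier_abs f xi ^+ 2)%:E).

(* H^s(R^3)^3 for s >= 0, as a space of square integrable functions. *)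
Definition Hs (s : R) (f : field3 R) : Prop :=
  has_fourier f /\ (Hs_norm s f < +oo)%E.

Definition div_free (f : field3 R) : Prop :=
  forall phi, schwartz phi ->
    \int[leb3 R]_x (\sum_(k < 3) cpt f k x * 'D_(dir3 k) phi x) = 0 :> R.

Definition is_partial (k : 'I_3) (f g : field3 R) : Prop :=
  forall i, L2 (cpt f i) /\ L2 (cpt g i) /\
    forall phi, schwartz phi ->
      \int[leb3 R]_x (cpt g i x * phi x) =
      - \int[leb3 R]_x (cpt f i x * 'D_(dir3 k) phi x) :> R.

Definition is_laplacian (f g : field3 R) : Prop :=
  forall i, L2 (cpt f i) /\ L2 (cpt g i) /\
    forall phi, schwartz phi ->
      \int[leb3 R]_x (cpt g i x * phi x) =
      \int[leb3 R]_x (cpt f i x * \sum_(k < 3) partials [:: k; k] phi x) :> R.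

(* g = (f, nabla) f, with distributional derivatives of f. *)
Definition is_advection (f g : field3 R) : Prop :=
  exists2 D : 'I_3 -> field3 R, (forall k, is_partial k f (D k)) &
    g = fun x => \sum_(k < 3) cpt f k x *: D k x.

Definition helmholtz_symbol (xi : R3 R) (i j : 'I_3) : R :=
  (i == j)%:R - coord3 xi i * coord3 xi j / len3 xi ^+ 2.

(* g = P f, with P the Helmholtz projection. *)
Definition is_helmholtz (f g : field3 R) : Prop :=
  has_fourier f /\
  forall i, is_fourier (cpt g i)
    (fun xi => \sum_(j < 3) (helmholtz_symbol xi i j)%:C%C *
                            fourier (cpt f j) xi).

End Distributions.

Section Evolution.
Context {R : realType}.
Implicit Types (s T : R) (u : R -> field3 R).

Definition continuous_Hs s u : Prop :=
  (forall t : R, 0 <= t -> Hs s (u t)) /\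
  forall t0 : R, 0 <= t0 ->
    Hs_norm s (u t - u t0) @[t --> within [set t : R | 0 <= t] (nbhs t0)] --> 0%E.

(* u in AC([0, oo); H^s) *)
Definition AC_Hs s u : Prop :=
  (forall t : R, 0 <= t -> Hs s (u t)) /\
  forall T : R, 0 < T -> forall eps : R, 0 < eps -> exists2 delta : R, 0 < delta &
    forall (n : nat) (a b : 'I_n -> R),
      (forall i, 0 <= a i /\ a i <= b i /\ b i <= T) ->
      trivIset setT (fun i => `]a i, b i[%classic) ->
      \sum_(i < n) (b i - a i) < delta ->
      (\sum_(i < n) Hs_norm s (u (b i) - u (a i))%R < eps%:E)%E.

Definition simple_Hs s u : Prop :=
  exists (n : nat) (A : 'I_n -> set R) (c : 'I_n -> field3 R),
    (forall i, measurable (A i) /\ Hs s (c i)) /\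
    u = fun t => \sum_(i < n) \1_(A i) t *: c i.

(* Bochner integrability on each [0, T]: strong measurability and
   integrability of the norm. *)
Definition L1loc_Hs s u : Prop :=
  forall T : R, 0 < T ->
    [/\ {ae @lebesgue_measure R, forall t, 0 <= t <= T -> Hs s (u t)},
        exists2 w : nat -> R -> field3 R, (forall n, simple_Hs s (w n)) &
          {ae @lebesgue_measure R, forall t, 0 <= t <= T ->
             Hs_norm s (w n t - u t) @[n --> \oo] --> 0%E}
      & (\int[@lebesgue_measure R]_(t in `[0%R, T]) Hs_norm s (u t) < +oo)%E].

Definition has_derivative_Hs s u (t : R) (v : field3 R) : Prop :=
  Hs s v /\
  Hs_norm s (h^-1 *: (u (t + h) - u t) - v) @[h --> 0^'] --> 0%E.

(* Solution of the Navier-Stokes equations with Coriolis force, the pressure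
   being eliminated by the Helmholtz projection:
     u' = nu Lap u - Omega P(e3 x u) - P[(u, nabla) u]
   in H^(s-1) for a.e. t > 0. *)
Definition NSC_solution (nu Omega s : R) (u0 : field3 R) u : Prop :=
  [/\ {ae leb3 R, forall x, u 0 x = u0 x},
      forall t : R, 0 < t -> div_free (u t)
    & {ae @lebesgue_measure R, forall t, 0 < t ->
        exists lap cor adv padv : field3 R,
          [/\ is_laplacian (u t) lap,
              is_helmholtz (fun x => cross e3 (u t x)) cor,
              is_advection (u t) adv,
              is_helmholtz adv padv
            & has_derivative_Hs (s - 1) u t
                (nu *: lap - Omega *: cor - padv)]}].

End Evolution.

(* Main.v *)
(* On the Fourier side consider, for fixed [T], the function
   [G t = int |xi|^-1 exp (- nu (T - t) |xi|^2) |u^(t, xi)| dxi], restricted to an annulus.  The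
   Coriolis term is skew-symmetric and the Helmholtz projection disappears against the
   divergence-free [u^], so almost everywhere the left derivative of [G] is at most
   [int |xi|^-1 |((u, grad) u)^|].  As [div u = 0] the derivative can be put on the output
   frequency, which cancels [|xi|^-1], and Young's inequality together with
   [(int |u^|)^2 <= ||u||_{chi^-1} ||u||_{chi^1}] bounds this by [C ||u||_{chi^1}].  Hence
   [||u(T)||_{chi^-1} <= int |xi|^-1 exp (- nu (T - t0) |xi|^2) |u^(t0, xi)| dxi
   + C int_t0^T ||u||_{chi^1}].  The second term is small for large [t0] because the assumed
   bound makes [||u||_{chi^1}] integrable on [(0, oo)], and then the first one tends to [0] as
   [T -> oo] by dominated convergence. *)
Require Import Defs.
From HB Require Import structures.
From mathcomp Require Import all_boot all_order all_algebra.
From mathcomp Require Import all_classical all_reals all_analysis.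
From mathcomp Require Import complex measurable_realfun ring lra.
Set Implicit Arguments.
Unset Strict Implicit.
Unset Printing Implicit Defensive.
Import Order.TTheory GRing.Theory Num.Theory.
Import numFieldNormedType.Exports.
Local Open Scope classical_set_scope.
Local Open Scope ring_scope.

(** * Integration *)

(** The solution is differentiable only as an H^(s-1)-valued function and only at almost every time,
    so neither a Duhamel formula nor a time derivative of |u^(t, xi)| at fixed xi is at hand. What
    is used instead is a bound of G t - G (t - k) for small k > 0. Left increments are the natural
    ones: Cauchy-Schwarz bounds Re (u^(t) . conj u^(t - k)) by the product of the moduli, and this
    is a lower bound for the earlier modulus. A creeping argument turns this rate, known off a null
    set of times, into a bound of G T - G t0. The annulus is there because |xi|^-1 is not square
    integrable at infinity: the truncated weight lies in L2, so that weighted norms are controlled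
    by H^s norms with s >= 0, and the factor |xi|^4 in the second-order error of a time step stays
    bounded. The transform of a field is a chosen representative defined by duality, so identities
    between transforms hold almost everywhere and come from testing on Gaussians. The smallness of
    u0 enters through the sign of nu - (2 pi)^-3 ||u0||_{chi^-1}, which makes the bound on the time
    integral of ||u||_{chi^1} effective. *)

Section RealIntegrals.
Context d (T : measurableType d) (R : realType).
Variable mu : {measure set T -> \bar R}.
Implicit Types f g : T -> R.

Lemma integrable_funD f g : mu.-integrable setT (EFin \o f) ->
  mu.-integrable setT (EFin \o g) ->
  mu.-integrable setT (EFin \o (fun x => f x + g x)).
Proof.
move=> If Ig; apply: (eq_integrable _ (fun x => (f x)%:E + (g x)%:E)%E) => //.
exact: integrableD.
Qed.

Lemma integrable_funZ (c : R) f : mu.-integrable setT (EFin \o f) ->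
  mu.-integrable setT (EFin \o (fun x => c * f x)).
Proof.
move=> If; apply: (eq_integrable _ (fun x => c%:E * (f x)%:E)%E) => //.
exact: integrableZl.
Qed.

Lemma integrable_funN f : mu.-integrable setT (EFin \o f) ->
  mu.-integrable setT (EFin \o (fun x => - f x)).
Proof.
move=> /(integrable_funZ (-1)); apply: eq_integrable => // x _.
by rewrite /= mulN1r.
Qed.

Lemma integrable_funB f g : mu.-integrable setT (EFin \o f) ->
  mu.-integrable setT (EFin \o g) ->
  mu.-integrable setT (EFin \o (fun x => f x - g x)).
Proof. by move=> If Ig; apply: integrable_funD => //; exact: integrable_funN. Qed.

Lemma integrable_fun_sum (I : Type) (s : seq I) (P : pred I) (h : I -> T -> R) :
  (forall i, P i -> mu.-integrable setT (EFin \o h i)) ->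
  mu.-integrable setT (EFin \o (fun x => \sum_(i <- s | P i) h i x)).
Proof.
move=> Ih; elim: s => [|i s IHs].
  by apply: (eq_integrable _ (cst 0%E)) => // [x _ /=|]; rewrite ?big_nil//; exact: integrable0.
case Pi: (P i).
  have := integrable_funD (Ih _ Pi) IHs; apply: eq_integrable => // x _.
  by rewrite /= big_cons Pi.
by move: IHs; apply: eq_integrable => // x _; rewrite /= big_cons Pi.
Qed.

Lemma Rintegral_fun_sum (I : Type) (s : seq I) (P : pred I) (h : I -> T -> R) :
  (forall i, P i -> mu.-integrable setT (EFin \o h i)) ->
  \int[mu]_x (\sum_(i <- s | P i) h i x) = \sum_(i <- s | P i) \int[mu]_x h i x.
Proof.
move=> Ih; elim: s => [|i s IHs].
  rewrite big_nil; under eq_Rintegral do rewrite big_nil.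
  by rewrite /Rintegral integral0.
rewrite big_cons; case: ifP => Pi.
  under eq_Rintegral do rewrite big_cons Pi.
  by rewrite RintegralD ?IHs//; [exact: Ih|exact: integrable_fun_sum].
by under eq_Rintegral do rewrite big_cons Pi.
Qed.

Lemma integrable_dom f g : measurable_fun setT f ->
  mu.-integrable setT (EFin \o g) -> (forall x, `|f x| <= g x) ->
  mu.-integrable setT (EFin \o f).
Proof.
move=> mf Ig fg; apply: (le_integrable _ _ _ Ig) => //; first exact/measurable_EFinP.
move=> x _ /=; rewrite lee_fin (le_trans (fg x))// ler_norm//.
Qed.

Lemma integrable_measurable f : mu.-integrable setT (EFin \o f) ->
  measurable_fun setT f.
Proof. by move=> /measurable_int/measurable_EFinP. Qed.

Lemma integrable_funn f : mu.-integrable setT (EFin \o f) ->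
  mu.-integrable setT (EFin \o (fun x => `|f x|)).
Proof. by move/integrable_norm. Qed.

Lemma integrable_mul_bounded (C : R) f g : measurable_fun setT g ->
  (forall x, `|g x| <= C) -> mu.-integrable setT (EFin \o f) ->
  mu.-integrable setT (EFin \o (fun x => f x * g x)).
Proof.
move=> mg gC If; apply: integrable_dom (integrable_funZ C (integrable_funn If)) _.
  by apply: measurable_funM => //; exact: integrable_measurable.
by move=> x /=; rewrite normrM mulrC ler_wpM2r.
Qed.

Lemma integrable_L2M f g : f \in Lfun mu 2%:E -> g \in Lfun mu 2%:E ->
  mu.-integrable setT (EFin \o (fun x => f x * g x)).
Proof. by move=> f2 g2; apply/Lfun1_integrable; exact: Lfun2_mul_Lfun1. Qed.

Lemma Lfun_measurable f p : f \in Lfun mu p -> measurable_fun setT f.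
Proof. by move=> /sub_Lfun_mfun; rewrite inE. Qed.

Lemma fun_L2 f : measurable_fun setT f ->
  mu.-integrable setT (EFin \o (fun x => f x ^+ 2)) -> f \in Lfun mu 2%:E.
Proof.
move=> mf If; rewrite inE/=; apply/andP; split; rewrite inE//=.
rewrite /finite_norm unlock /=.
apply: poweR_lty.
have /integrableP[mY iY] := If; apply: le_lt_trans iY; apply: ge0_le_integral => //.
- apply/measurable_EFinP.
  apply: (measurableT_comp (measurable_powR _)) => //.
  exact: measurableT_comp.
- by apply/measurable_EFinP; apply: measurableT_comp => //; exact: measurable_funX.
- by move=> x _; rewrite lee_fin powR_mulrn// -normrX.
Qed.

Lemma Rintegral_ae_eq f g : measurable_fun setT f -> measurable_fun setT g ->
  {ae mu, forall x, f x = g x} -> \int[mu]_x f x = \int[mu]_x g x.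
Proof.
move=> mf mg fg; congr fine; apply: ae_eq_integral => //.
- exact/measurable_EFinP.
- exact/measurable_EFinP.
- by apply: filterS fg => x /= -> _.
Qed.

End RealIntegrals.

Section RealFubini.
Context d1 d2 (T1 : measurableType d1) (T2 : measurableType d2) (R : realType).
Variable m1 : {sigma_finite_measure set T1 -> \bar R}.
Variable m2 : {sigma_finite_measure set T2 -> \bar R}.

(** The inner integral may be infinite on a null set, where [fine] returns a default value;
    [ae_eq_integral] absorbs the difference. *)
Lemma Rfubini1 (f : T1 * T2 -> R) : (m1 \x m2)%E.-integrable setT (EFin \o f) ->
  \int[product_measure1 m1 m2]_z f z = \int[m1]_x \int[m2]_y f (x, y).
Proof.
move=> If; rewrite /Rintegral -integral12_prod_meas1//; congr fine.
have IF := integrable_fubini_F If.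
apply: ae_eq_integral => //.
- exact: measurable_int IF.
- apply/measurable_EFinP; apply: measurableT_comp => //.
  exact: measurable_int IF.
- have := integrable_ae measurableT IF; apply: filterS => x /(_ I) Fx _.
  by rewrite fineK.
Qed.

Lemma Rfubini2 (f : T1 * T2 -> R) : (m1 \x m2)%E.-integrable setT (EFin \o f) ->
  \int[product_measure1 m1 m2]_z f z = \int[m2]_y \int[m1]_x f (x, y).
Proof.
move=> If; rewrite /Rintegral -integral21_prod_meas1//; congr fine.
have IF : m2.-integrable setT (fubini_G m1 (EFin \o f)).
  have := measurable_fubini_G If.
  move=> mG; apply/integrableP; split => //.
  have /(integrable21ltyP _ _ (measurable_int _ If)) := If.
  apply: le_lt_trans; apply: ge0_le_integral => //.
  - exact: measurableT_comp.
  - apply: (measurable_fun_fubini_tonelli_G (abse \o (EFin \o f))) => //=.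
    by apply: measurableT_comp => //; exact: measurable_int If.
  - move=> y _; apply: le_abse_integral => //.
    have := measurable_int _ If => mf.
    exact: measurableT_comp.
apply: ae_eq_integral => //.
- exact: measurable_int IF.
- apply/measurable_EFinP; apply: measurableT_comp => //.
  exact: measurable_int IF.
- have := integrable_ae measurableT IF; apply: filterS => x /(_ I) Fx _.
  by rewrite fineK.
Qed.

Lemma integrable_tensor (f : T1 -> R) (g : T2 -> R) :
  m1.-integrable setT (EFin \o f) -> m2.-integrable setT (EFin \o g) ->
  (m1 \x m2)%E.-integrable setT (EFin \o (fun z => f z.1 * g z.2)).
Proof.
move=> If Ig.
have mf := integrable_measurable If; have mg := integrable_measurable Ig.
apply/integrable12ltyP.
  apply/measurable_EFinP; apply: measurable_funM.
    by apply: (measurableT_comp mf).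
  by apply: (measurableT_comp mg).
under eq_integral => x _.
  under eq_integral => y _ do rewrite /= normrM EFinM.
  rewrite ge0_integralZl//; last first.
    by apply/measurable_EFinP; exact: measurableT_comp.
  over.
rewrite ge0_integralZr//; last 2 first.
- by apply/measurable_EFinP; exact: measurableT_comp.
- exact: integral_ge0.
have /integrableP[_ /= fy] := If.
have /integrableP[_ /= gy] := Ig.
rewrite lte_mul_pinfty//; first exact: integral_ge0.
by rewrite ge0_fin_numE//; exact: integral_ge0.
Qed.

Lemma Rintegral_tensor (f : T1 -> R) (g : T2 -> R) :
  m1.-integrable setT (EFin \o f) -> m2.-integrable setT (EFin \o g) ->
  \int[product_measure1 m1 m2]_z (f z.1 * g z.2) = \int[m1]_x f x * \int[m2]_y g y.
Proof.
move=> If Ig; rewrite Rfubini1 /=; last exact: integrable_tensor.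
under eq_Rintegral do rewrite RintegralZl//.
by rewrite RintegralZr.
Qed.

End RealFubini.

(* The canonical sigma-finite structure on products is only found by unification
   for products of subprobabilities, hence this alias of [m1 \x m2]. *)
Section SigmaFiniteProduct.
Local Open Scope ereal_scope.
Context d1 d2 (T1 : measurableType d1) (T2 : measurableType d2) (R : realType).
Variable m1 : {sigma_finite_measure set T1 -> \bar R}.
Variable m2 : {sigma_finite_measure set T2 -> \bar R}.

Definition sigma_prod : set (T1 * T2) -> \bar R := m1 \x m2.

Let sigma_prodT : sigma_finite setT sigma_prod.
Proof.
have /sigma_finiteP[F [TF ndF Foo]] := sigma_finiteT m1.
have /sigma_finiteP[G [TG ndG Goo]] := sigma_finiteT m2.
exists (fun n => F n `*` G n).
  rewrite -setXTT TF TG; apply/seteqP; split=> -[x y] /=.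
    move=> [[n _ Fnx] [k _ Gky]]; exists (maxn n k) => //; split.
      by move: x Fnx; exact/subsetPset/ndF/leq_maxl.
    by move: y Gky; exact/subsetPset/ndG/leq_maxr.
  by move=> [n _ []/= ? ?]; split; exists n.
move=> k; have [? ?] := Foo k; have [? ?] := Goo k.
split; first exact: measurableX.
by rewrite /sigma_prod product_measure1E// lte_mul_pinfty// ge0_fin_numE.
Qed.

HB.instance Definition _ := Measure.on sigma_prod.
HB.instance Definition _ := Measure_isSigmaFinite.Build _ _ _ sigma_prod sigma_prodT.

End SigmaFiniteProduct.

(* The Borel sigma-algebra is only inferred on this alias of [R], not on [R] itself. *)
Notation mR R := (measurableTypeR R).
Notation mR3 R := (mR R * mR R * mR R)%type.

Section Lebesgue3.
Context {R : realType}.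
Notation mu := (@lebesgue_measure R).

Let mu3 : {sigma_finite_measure set (mR3 R) -> \bar R} :=
  sigma_prod (sigma_prod mu mu) mu.

Definition leb6 : {sigma_finite_measure set (mR3 R * mR3 R)%type -> \bar R} :=
  sigma_prod mu3 mu3.

Lemma integrable_tensor3 (f g h : mR R -> R) :
  mu.-integrable setT (EFin \o f) -> mu.-integrable setT (EFin \o g) ->
  mu.-integrable setT (EFin \o h) ->
  (leb3 R).-integrable setT (EFin \o (fun x : mR3 R => f x.1.1 * g x.1.2 * h x.2)).
Proof.
move=> If Ig Ih; exact: (integrable_tensor (m1 := sigma_prod mu mu) (m2 := mu)
  (integrable_tensor If Ig) Ih).
Qed.

Lemma Rintegral_tensor3 (f g h : mR R -> R) :
  mu.-integrable setT (EFin \o f) -> mu.-integrable setT (EFin \o g) ->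
  mu.-integrable setT (EFin \o h) ->
  \int[leb3 R]_x (f x.1.1 * g x.1.2 * h x.2) =
  \int[mu]_t f t * \int[mu]_t g t * \int[mu]_t h t.
Proof.
move=> If Ig Ih.
have := Rintegral_tensor (m1 := sigma_prod mu mu) (m2 := mu)
  (integrable_tensor If Ig) Ih.
by rewrite (Rintegral_tensor If Ig).
Qed.

Lemma integrable_tensor6 (f g : mR3 R -> R) :
  (leb3 R).-integrable setT (EFin \o f) -> (leb3 R).-integrable setT (EFin \o g) ->
  leb6.-integrable setT (EFin \o (fun z => f z.1 * g z.2)).
Proof. exact: (integrable_tensor (m1 := mu3) (m2 := mu3)). Qed.

Lemma Rfubini6_1 (f : mR3 R * mR3 R -> R) :
  leb6.-integrable setT (EFin \o f) ->
  \int[leb6]_z f z =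
  \int[leb3 R]_x \int[leb3 R]_y f (x, y).
Proof. exact: (Rfubini1 (m1 := mu3) (m2 := mu3)). Qed.

Lemma Rfubini6_2 (f : mR3 R * mR3 R -> R) :
  leb6.-integrable setT (EFin \o f) ->
  \int[leb6]_z f z =
  \int[leb3 R]_y \int[leb3 R]_x f (x, y).
Proof. exact: (Rfubini2 (m1 := mu3) (m2 := mu3)). Qed.

Lemma tonelli6_1 (f : mR3 R * mR3 R -> \bar R) : measurable_fun setT f ->
  (forall z, (0 <= f z)%E) ->
  (\int[leb6]_z f z =
   \int[leb3 R]_x \int[leb3 R]_y f (x, y))%E.
Proof. move=> mf f0; exact: (fubini_tonelli1 (m1 := mu3) (m2 := mu3)). Qed.

Lemma tonelli6_2 (f : mR3 R * mR3 R -> \bar R) : measurable_fun setT f ->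
  (forall z, (0 <= f z)%E) ->
  (\int[leb6]_z f z =
   \int[leb3 R]_y \int[leb3 R]_x f (x, y))%E.
Proof. move=> mf f0; exact: (fubini_tonelli2 (m1 := mu3) (m2 := mu3)). Qed.

End Lebesgue3.

(** * Uniqueness from Gaussian test functions *)

Section PiLambda.
Context d (T : measurableType d) (R : realType).
Variable mu : {measure set T -> \bar R}.

(** Pi-lambda argument: the sets whose preimages carry zero integral form a lambda-system, the
    increasing unions being handled by dominated convergence. Preimages under a map [y] allow one
    coordinate to be treated at a time. *)
Lemma Rintegral_preimage0 d' (Y : measurableType d') (y : T -> Y)
    (G : set (set Y)) (f : T -> R) :
  measurable_fun setT y -> mu.-integrable setT (EFin \o f) ->
  setI_closed G -> G setT -> @measurable _ Y `<=` <<s G>> ->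
  (forall E, G E -> measurable E) ->
  (forall E, G E -> \int[mu]_(x in y @^-1` E) f x = 0) ->
  forall E, measurable E -> \int[mu]_(x in y @^-1` E) f x = 0.
Proof.
move=> my If GI GT sG mG G0 E mE.
have mpre A : measurable A -> measurable (y @^-1` A).
  by move=> mA; rewrite -[_ @^-1` _]setTI; exact: my.
have IS A : measurable A -> mu.-integrable (y @^-1` A) (EFin \o f).
  by move=> mA; apply: integrableS If => //; exact: mpre.
pose H := [set A : set Y | measurable A /\ \int[mu]_(x in y @^-1` A) f x = 0].
suff : <<s G>> `<=` H by move=> /(_ _ (sG _ mE))[].
apply: lambda_system_subset => //.
  split.
  - by [].
  - by split => //; exact: G0.
  - move=> A B BA [mA A0] [mB B0]; split; first exact: measurableD.
    have mAB : measurable (A `\` B) by exact: measurableD.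
    have : \int[mu]_(x in y @^-1` A) f x = 0 by [].
    have -> : y @^-1` A = y @^-1` (A `\` B) `|` y @^-1` B.
      by rewrite -preimage_setU setUC setDUK.
    rewrite Rintegral_setU//; [|exact: mpre|exact: mpre| |].
    + by rewrite B0 addr0.
    + by rewrite -preimage_setU setUC setDUK//; exact: IS.
    + by apply/disj_setPS => x [/= [_ ?]].
  - move=> F ndF HF.
    have mF n : measurable (F n) by have [] := HF n.
    have mU : measurable (\bigcup_n F n) by exact: bigcup_measurable.
    split => //.
    rewrite Rintegral_mkcond.
    have := @dominated_convergence _ _ _ mu setT measurableT
      (fun n => EFin \o (f \_ (y @^-1` (F n))))
      (EFin \o (f \_ (y @^-1` (\bigcup_n F n)))) (EFin \o (fun x => `|f x|)).
    case.
    + move=> n; apply/measurable_EFinP.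
      apply/(measurable_restrictT _ _).1; first exact: mpre.
      by apply: measurable_funTS; exact: integrable_measurable If.
    + apply/measurable_EFinP.
      apply/(measurable_restrictT _ _).1; first exact: mpre.
      by apply: measurable_funTS; exact: integrable_measurable If.
    + apply: aeW => x _; apply: cvg_EFin; first by apply: nearW.
      apply: cvg_near_cst.
      have [[n _ Fn]|nF] := pselect ((\bigcup_n F n) (y x)).
        exists n => // m /= nm; rewrite /= !patchE !mem_set//=; first by exists n.
        by move/subsetPset : (ndF _ _ nm); exact.
      exists 0%N => // m _ /=; rewrite !patchE !memNset//=.
      by apply: contra_not nF => Fm; exists m.
    + exact: integrable_funn.
    + apply: aeW => x n _ /=; rewrite lee_fin patchE; case: ifP => // _.
      by rewrite normr0.
    move=> IU _; rewrite -[X in _ --> X -> _]fineK; last exact: integrable_fin_num.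
    move=> /fine_cvgP[_ h].
    apply/esym/(cvg_unique _ _ h); first exact: Rhausdorff.
    rewrite (_ : _ \o _ = cst 0); first exact: cvg_cst.
    by apply/funext => n /=; rewrite -[LHS]Rintegral_mkcond; have [] := HF n.
by move=> A GA; split; [exact: mG|exact: G0].
Qed.

End PiLambda.

Definition gauss {R : realType} (a c x : R) : R := expR (- (a * (x - c) ^+ 2)).

Lemma eq_ler {R : numDomainType} (x y : R) : x = y -> x <= y.
Proof. by move=> ->. Qed.

Lemma expR_ge1 {R : realType} (x : R) : 0 <= x -> 1 <= expR x.
Proof. by move=> x0; rewrite -[leLHS]expR0 ler_expR. Qed.

Section Gauss.
Context {R : realType}.
Implicit Types a c x q : R.

Lemma gauss_gt0 a c x : 0 < gauss a c x. Proof. exact: expR_gt0. Qed.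

Lemma gauss_le1 a c x : 0 <= a -> gauss a c x <= 1.
Proof. by move=> a0; rewrite expR_le1 oppr_le0 mulr_ge0// sqr_ge0. Qed.

Lemma measurable_gauss a c : measurable_fun setT (gauss a c).
Proof.
apply: (measurableT_comp (@measurable_expR R)) => //.
apply: measurableT_comp => //; apply: measurable_funM => //.
by apply: measurable_funX; exact: measurable_funB.
Qed.

Lemma gaussX a c x n : gauss a c x ^+ n.+1 = gauss (a * n.+1%:R) c x.
Proof. by rewrite /gauss -expRM_natl; congr expR; ring. Qed.

Lemma onemX_ge0 q n : 0 <= q <= 1 -> 0 <= (1 - q) ^+ n <= 1.
Proof.
move=> /andP[q0 q1]; rewrite exprn_ge0 ?subr_ge0//= exprn_ile1 ?subr_ge0//.
by rewrite lerBlDr lerDl.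
Qed.

Lemma onem_onemX_le q n : 0 <= q <= 1 -> 1 - (1 - q) ^+ n <= n%:R * q.
Proof.
move=> q01; elim: n => [|n IHn]; first by rewrite expr0 subrr mul0r.
have /andP[_ h] := onemX_ge0 n q01.
rewrite exprS mulrBl mul1r opprB addrA -[n.+1]addn1 natrD mulrDl mul1r.
rewrite [leLHS](_ : _ = (1 - (1 - q) ^+ n) + q * (1 - q) ^+ n); last by ring.
by rewrite lerD// ler_piMr//; case/andP: q01.
Qed.

Lemma onemX_le_expR q n : q <= 1 -> (1 - q) ^+ n <= expR (- (n%:R * q)).
Proof.
move=> q1; rewrite -mulrN expRM_natl.
by rewrite lerXn2r ?nnegrE ?subr_ge0 ?expR_ge0// expR_ge1Dx.
Qed.

End Gauss.

(** * From Gaussians to indicators of intervals in one variable *)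

Section GaussSlot.
Context d (T : measurableType d) (R : realType).
Variable mu : {measure set T -> \bar R}.

Let null (f : T -> R) :=
  mu.-integrable setT (EFin \o f) /\ \int[mu]_x f x = 0.

Let nullD f g : null f -> null g -> null (fun x => f x + g x).
Proof.
by move=> [If f0] [Ig g0]; split; [exact: integrable_funD|rewrite RintegralD// f0 g0 addr0].
Qed.

Let nullB f g : null f -> null g -> null (fun x => f x - g x).
Proof.
by move=> [If f0] [Ig g0]; split; [exact: integrable_funB|rewrite RintegralB// f0 g0 subr0].
Qed.

Let null_ext f g : f =1 g -> null f -> null g.
Proof. by move=> /funext ->. Qed.

Variables (K y : T -> R).
Hypotheses (mK : measurable_fun setT K) (my : measurable_fun setT y).
Hypothesis K0 : forall a c, 0 < a ->
  mu.-integrable setT (EFin \o (fun x => K x * gauss a c (y x))) /\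
  \int[mu]_x (K x * gauss a c (y x)) = 0.

(** Powers of a Gaussian are Gaussians with the same centre, hence covered by [K0]; each factor 1 -
    g splits the integrand into two such terms. *)
Let null_gaussX a c n k : 0 < a ->
  null (fun x => K x * (gauss a c (y x) ^+ k.+1 * (1 - gauss a c (y x)) ^+ n)).
Proof.
move=> a0; elim: n k => [|n IHn] k.
  have [|I0 h] := K0 (a := a * k.+1%:R) c; first by rewrite mulr_gt0.
  by split; [move: I0; apply: eq_integrable => // x _ /=|rewrite -[RHS]h;
     apply: eq_Rintegral => x _]; rewrite gaussX expr0 mulr1.
apply: null_ext (nullB (IHn k) (IHn k.+1)) => x.
by rewrite !exprS; ring.
Qed.

Let null_onem a c n : 0 < a ->
  null (fun x => K x * (1 - (1 - gauss a c (y x)) ^+ n)).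
Proof.
move=> a0; elim: n => [|n IHn].
  apply: (@null_ext (fun=> 0)) => [x|]; first by rewrite expr0 subrr mulr0.
  split; first by apply: (eq_integrable _ (cst 0%E)) => //; exact: integrable0.
  by rewrite /Rintegral integral0.
apply: null_ext (nullD IHn (null_gaussX c n 0 a0)) => x.
by rewrite expr1 exprS; ring.
Qed.

(** Exponent for which 1 - (1 - g)^m approximates the indicator of [c - r, c + r], where g = exp (-
    (n + 1) D) and D = (y - c)^2. As m is about (n + 1) exp ((n + 1) r^2), the product m g tends to
    infinity for D <= r^2 and to 0 for D > r^2. The extra factor n + 1 settles the endpoints D =
    r^2. *)
Let mult (r : R) (n : nat) : nat :=
  (Num.truncn (n.+1%:R * expR (n.+1%:R * r ^+ 2))).+1.

Let mult_ge r n : n.+1%:R * expR (n.+1%:R * r ^+ 2) <= (mult r n)%:R.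
Proof. by rewrite ltW// truncnS_gt. Qed.

Let mult_le r n : (mult r n)%:R <= n.+2%:R * expR (n.+1%:R * r ^+ 2).
Proof.
rewrite /mult -[X in X%:R <= _]addn1 -[n.+2]addn1 !natrD mulrDl mul1r lerD//.
  by rewrite truncn_le// mulr_ge0// expR_ge0.
by rewrite expR_ge1// mulr_ge0// sqr_ge0.
Qed.

Let approx (r c : R) n x : R := 1 - (1 - gauss n.+1%:R c (y x)) ^+ mult r n.

Let gauss01 n c x : 0 <= gauss n.+1%:R c (y x) <= 1.
Proof. by rewrite ltW ?gauss_gt0// gauss_le1. Qed.

Let approx01 r c n x : 0 <= approx r c n x <= 1.
Proof.
by have /andP[h1 h2] := onemX_ge0 (mult r n) (gauss01 n c x); apply/andP; split; rewrite /approx; lra.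
Qed.

Let approx_le r c n x :
  approx r c n x <= n.+2%:R * expR (- (n.+1%:R * ((y x - c) ^+ 2 - r ^+ 2))).
Proof.
apply: (le_trans (onem_onemX_le _ (gauss01 n c x))).
apply: (le_trans (ler_wpM2r _ (mult_le r n))).
  by case/andP: (gauss01 n c x).
by rewrite /gauss -mulrA -expRD; apply/eq_ler; congr (_ * expR _); ring.
Qed.

(** A majorant independent of n, whose product with [K] is integrable by [K0]. Where D - r^2 <= 1
    the right-hand side is at least 1; elsewhere n + 2 <= exp (n + 1) leaves exp ((n + 1) (1 - (D -
    r^2))), which is largest for n = 0. *)
Let approx_dom r c n x : approx r c n x <= expR (1 + r ^+ 2) * gauss 1 c (y x).
Proof.
rewrite -expRD; set D := (y x - c) ^+ 2.
have [Dr|Dr] := lerP (D - r ^+ 2) 1.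
  case/andP: (approx01 r c n x) => _ /le_trans; apply.
  by apply: expR_ge1; lra.
apply: (le_trans (approx_le _ _ _ _)).
rewrite -/D.
have n2 : n.+2%:R <= expR n.+1%:R :> R.
  by apply: le_trans (expR_ge1Dx _); rewrite [in leLHS]mulrS.
apply: (le_trans (ler_wpM2r _ n2)); first exact: expR_ge0.
rewrite -expRD ler_expR.
have : (1 : R) <= n.+1%:R by rewrite ler1n.
by nra.
Qed.

Let approx_cvg r c x : 0 <= r ->
  approx r c ^~ x @ \oo --> (\1_(`[c - r, c + r]%classic) (y x) : R).
Proof.
move=> r0; rewrite indicE.
have -> : (y x \in `[c - r, c + r]%classic) = ((y x - c) ^+ 2 <= r ^+ 2).
  rewrite mem_setE in_itv/= -ler_distl.
  by rewrite -(@ler_pXn2r _ 2) ?nnegrE// real_normK// num_real.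
set D := (y x - c) ^+ 2; case: (lerP D (r ^+ 2)) => Dr /=.
  apply: (@squeeze_cvgr _ _ _ _ (fun n => 1 - harmonic n) (cst 1)) => //; last 2 first.
    rewrite -[X in _ --> X]subr0; apply: cvgB; first exact: cvg_cst.
    exact: cvg_harmonic.
    exact: cvg_cst.
  apply: nearW => n /=; apply/andP; split; last by case/andP: (approx01 r c n x).
  rewrite /approx lerD2l lerN2; apply: le_trans (onemX_le_expR _ _) _.
    by case/andP: (gauss01 n c x).
  apply: (@le_trans _ _ (expR (- n.+1%:R))).
    rewrite ler_expR lerN2; apply: (le_trans _ (ler_wpM2r _ (mult_ge r n))); last first.
      by case/andP: (gauss01 n c x).
    rewrite /gauss -mulrA ler_peMr// -expRD expR_ge1// -/D.
    rewrite -mulrN -mulrDr.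
    by rewrite mulr_ge0// subr_ge0.
  rewrite expRN lef_pV2 ?posrE ?expR_gt0//.
  by rewrite (le_trans _ (expR_ge1Dx _))// lerDr.
(* With m = n + 1 and 2 k <= D - r^2, the bound exp (- 2 m k) = exp (m k)^-2 <= (k m)^-2 beats the
   factor 2 m and leaves a multiple of 1/m. *)
pose k : R := Num.min 1 ((D - r ^+ 2) / 2).
have k0 : 0 < k by rewrite lt_min ltr01 divr_gt0// subr_gt0.
apply: (@squeeze_cvgr _ _ _ _ (cst 0) (fun n => 2 * k ^- 2 * harmonic n)) => //.
- apply: nearW => n; apply/andP; split; first by case/andP: (approx01 r c n x).
  apply: (le_trans (approx_le _ _ _ _)); rewrite -/D.
  set m : R := n.+1%:R.
  have m1 : 1 <= m by rewrite ler1n.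
  have -> : n.+2%:R = m + 1 by rewrite -natr1.
  have kD : 2 * k <= D - r ^+ 2.
    by rewrite mulrC -ler_pdivlMr// ge_min lexx orbT.
  apply: (@le_trans _ _ ((2 * m) * expR (- (m * (2 * k))))).
    apply: ler_pM => //; [lra|lra|].
    by rewrite ler_expR lerN2 ler_wpM2l//; lra.
  have e1 : k * m <= expR (m * k).
    by apply: le_trans (expR_ge1Dx _); rewrite mulrC; lra.
  have -> : expR (- (m * (2 * k))) = (expR (m * k)) ^- 2.
    by rewrite expRN -expRM_natl; congr (_^-1); congr expR; ring.
  have km : 0 < k * m by rewrite mulr_gt0//; lra.
  apply: (@le_trans _ _ (2 * m * (k * m) ^- 2)).
    rewrite ler_wpM2l//; first lra.
    rewrite lef_pV2 ?posrE ?exprn_gt0 ?expR_gt0//.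
    by rewrite lerXn2r// ?nnegrE ?expR_ge0// ltW.
  by apply/eq_ler; rewrite /harmonic/= -/m; field; rewrite !gt_eqF//; lra.
- exact: cvg_cst.
- by rewrite -[X in _ --> X](mulr0 (2 * k ^- 2)); apply: cvgM; [exact: cvg_cst|exact: cvg_harmonic].
Qed.

Lemma gauss_slot c r : 0 <= r ->
  mu.-integrable setT (EFin \o (fun x => K x * \1_(`[c - r, c + r]%classic) (y x))) /\
  \int[mu]_x (K x * \1_(`[c - r, c + r]%classic) (y x)) = 0.
Proof.
move=> r0.
have Kn n : null (fun x => K x * approx r c n x) by exact: null_onem.
have [I1 _] := K0 c ltr01.
have [|||||IL _ h] := @dominated_convergence _ _ _ mu setT measurableT
  (fun n => EFin \o (fun x => K x * approx r c n x))
  (EFin \o (fun x => K x * \1_(`[c - r, c + r]%classic) (y x)))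
  (EFin \o (fun x => expR (1 + r ^+ 2) * `|K x * gauss 1 c (y x)|)).
- by move=> n; apply: measurable_int (Kn n).1.
- apply/measurable_EFinP; apply: measurable_funM => //.
  by apply: measurableT_comp => //; exact: measurable_indic.
- apply: aeW => x _; apply: cvg_EFin; first by apply: nearW.
  by apply: cvgM; [exact: cvg_cst|exact: approx_cvg].
- exact/integrable_funZ/integrable_funn.
- apply: aeW => x n _ /=; rewrite lee_fin !normrM mulrCA ler_wpM2l//.
  rewrite ger0_norm; last by case/andP: (approx01 r c n x).
  by rewrite ger0_norm; [exact: approx_dom|exact/ltW/gauss_gt0].
split => //.
have : \int[mu]_x (K x * approx r c n x) @[n --> \oo] -->
    \int[mu]_x (K x * \1_(`[c - r, c + r]%classic) (y x)).
  by apply: fine_cvg; rewrite fineK//; exact: integrable_fin_num.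
under eq_fun do rewrite (Kn _).2.
by move=> /cvg_lim <- //; rewrite lim_cst.
Qed.

End GaussSlot.

(** * Functions annihilated by all Gaussians vanish almost everywhere *)

Section Uniqueness.
Context {R : realType}.
Notation mu := (@lebesgue_measure R).

Definition gauss3 (a c x : R3 R) : R :=
  gauss a.1.1 c.1.1 x.1.1 * gauss a.1.2 c.1.2 x.1.2 * gauss a.2 c.2 x.2.

Definition pos3 (a : R3 R) := [/\ 0 < a.1.1, 0 < a.1.2 & 0 < a.2].

(** A pi-system generating the Borel sets: the empty set makes it stable under intersection, and the
    whole line is the top element that the pi-lambda lemma asks for. *)
Definition ccitv : set (set R) := [set A | A = set0 \/ A = setT \/ exists a b : R, a <= b /\ A = `[a, b]%classic].

Lemma ccitvI : setI_closed ccitv.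
Proof.
move=> _ B [->|[->|[a [b [ab ->]]]]]; first by rewrite set0I; left.
  by rewrite setTI.
move=> [->|[->|[a' [b' [ab' ->]]]]]; first by rewrite setI0; left.
  by rewrite setIT; right; right; exists a, b.
have -> : `[a, b]%classic `&` `[a', b']%classic =
    `[Num.max a a', Num.min b b']%classic.
  apply/seteqP; split => x /=; rewrite !in_itv/= ge_max le_min.
    by move=> [/andP[-> ->] /andP[-> ->]].
  by move=> /andP[/andP[-> ->] /andP[-> ->]].
have [h|h] := lerP (Num.max a a') (Num.min b b'); [right; right|left].
  by exists (Num.max a a'), (Num.min b b').
by rewrite set_itv_ge// bnd_simp -ltNge.
Qed.

Lemma measurable_ccitv : @measurable _ (measurableTypeR R) `<=` <<s ccitv>>.
Proof.
apply: smallest_sub; first exact: smallest_sigma_algebra.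
move=> _ [[a b] _ <-] /=.
have [ab|ba] := lerP a b; last first.
  rewrite set_itv_ge ?bnd_simp -?leNgt ?ltW//.
  by apply: sub_sigma_algebra; left.
have -> : `]a, b]%classic = `[a, b]%classic `\` `[a, a]%classic.
  apply/seteqP; split => x /=; rewrite !in_itv/=.
    by move=> /andP[ax ->]; rewrite (ltW ax); split => //; rewrite leNgt ax.
  move=> [/andP[ax ->]]; rewrite ax/= andbT => /negP; by rewrite -ltNge.
have [S0 SD SU] := smallest_sigma_algebra setT ccitv.
rewrite setDE -[A in A `&` _]setCK -setCU -setTD.
apply: (SD) ; rewrite -bigcup2E.
apply: SU => -[|[|i]] /=; last exact: S0.
- by rewrite -setTD; apply: SD; apply: sub_sigma_algebra; right; right; exists a, b.
- by apply: sub_sigma_algebra; right; right; exists a, a.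
Qed.

Lemma Rintegral_indic d (T : measurableType d) (m : {measure set T -> \bar R})
    (D : set T) (f : T -> R) :
  \int[m]_(x in D) f x = \int[m]_x (f x * \1_D x).
Proof.
rewrite Rintegral_mkcond; apply: eq_Rintegral => x _.
by rewrite patchE indicE; case: (x \in D); rewrite ?mulr1 ?mulr0.
Qed.

Lemma integrable_indicM d (T : measurableType d) (m : {measure set T -> \bar R})
    d' (Y : measurableType d') (E : set Y) (y : T -> Y) (f : T -> R) :
  measurable E -> measurable_fun setT y -> m.-integrable setT (EFin \o f) ->
  m.-integrable setT (EFin \o (fun x => f x * \1_E (y x))).
Proof.
move=> mE my If; apply: (@integrable_mul_bounded _ _ _ _ 1) => //.
  by apply: (measurableT_comp (measurable_indic mE)).
by move=> x; rewrite indicE; case: (_ \in _); rewrite ?normr1 ?normr0.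
Qed.

Lemma Rintegral_preimage0' d (T : measurableType d) (m : {measure set T -> \bar R})
    d' (Y : measurableType d') (y : T -> Y) (G : set (set Y)) (f : T -> R) :
  measurable_fun setT y -> m.-integrable setT (EFin \o f) ->
  setI_closed G -> G setT -> @measurable _ Y `<=` <<s G>> ->
  (forall E, G E -> measurable E) ->
  (forall E, G E -> \int[m]_x (f x * \1_E (y x)) = 0) ->
  forall E, measurable E -> \int[m]_x (f x * \1_E (y x)) = 0.
Proof.
move=> my If GI GT sG mG G0 E mE.
have h (A : set Y) : \int[m]_x (f x * \1_A (y x)) = \int[m]_(x in y @^-1` A) f x.
  by rewrite [RHS]Rintegral_indic; congr (Rintegral _ _ _).
by rewrite h; apply: (Rintegral_preimage0 my If GI GT sG mG) => // A /G0; rewrite h.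
Qed.

Lemma measurable_ccitvW A : ccitv A -> measurable A.
Proof. by case=> [->//|[->//|[a [b [_ ->]]]]]; exact: measurable_itv. Qed.

(** [gauss_slot] reaches only bounded intervals given by centre and radius, hence the cut by
    [-n, n]. The second alternative is an empty intersection. *)
Lemma ccitv_cut (A : set R) (n : nat) (x : R) : ccitv A ->
  exists c r : R, 0 <= r /\ ((forall x, \1_A x * \1_(`[- n%:R, n%:R]%classic) x =
    \1_(`[c - r, c + r]%classic) x :> R) \/
    (forall x, \1_A x * \1_(`[- n%:R, n%:R]%classic) x = 0 :> R)).
Proof.
move=> cA.
have cn : ccitv `[- n%:R, n%:R]%classic.
  right; right; exists (- n%:R), n%:R; split=> //.
  by rewrite (@le_trans _ _ 0)// oppr_le0.
have [h|[h|[a [b [ab h]]]]] := ccitvI cA cn.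
- exists 0, 0; split => //; right => z.
  have := congr1 (fun B => \1_B z : R) h; rewrite indicI indic0; exact.
- exists 0, 0; split => //; left => z; exfalso.
  have : (A `&` `[- n%:R, n%:R]%classic) (n.+1%:R : R) by rewrite h.
  by case=> _ /=; rewrite in_itv/= ler_nat ltnn andbF.
- exists ((a + b) / 2), ((b - a) / 2); split; first by rewrite divr_ge0// subr_ge0.
  left => z; rewrite (_ : _ - _ = a); last by field.
  by rewrite (_ : (a + b) / 2 + _ = b); [rewrite -h indicI|field].
Qed.

Section Gauss3Null.
Variable k : mR3 R -> R.
Hypothesis mk : measurable_fun setT k.
Hypothesis k0 : forall a c, pos3 a ->
  (leb3 R).-integrable setT (EFin \o (fun x => k x * gauss3 a c x)) /\
  \int[leb3 R]_x (k x * gauss3 a c x) = 0.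

Let p1 (x : mR3 R) : R := x.1.1.
Let p2 (x : mR3 R) : R := x.1.2.
Let p3 (x : mR3 R) : R := x.2.

Let mp1 : measurable_fun setT p1.
Proof. exact: (measurableT_comp measurable_fst measurable_fst). Qed.
Let mp2 : measurable_fun setT p2.
Proof. exact: (measurableT_comp measurable_snd measurable_fst). Qed.
Let mp3 : measurable_fun setT p3.
Proof. exact: measurable_snd. Qed.

Let J (c r : R) : R -> R := \1_(`[c - r, c + r]%classic).

Let mJ c r : measurable_fun setT (J c r).
Proof. exact: measurable_indic. Qed.

Let mg (y : mR3 R -> R) a c : measurable_fun setT y ->
  measurable_fun setT (fun x => gauss a c (y x)).
Proof. by move=> my; apply: measurableT_comp => //; exact: measurable_gauss. Qed.

Let mJp (y : mR3 R -> R) c r : measurable_fun setT y ->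
  measurable_fun setT (fun x => J c r (y x)).
Proof. by move=> my; apply: measurableT_comp => //; exact: mJ. Qed.

(** The three Gaussian factors are traded for indicators one coordinate at a time, the other two
    factors being counted as part of [K] in each use of [gauss_slot]. *)
Let null_box c1 r1 c2 r2 c3 r3 : 0 <= r1 -> 0 <= r2 -> 0 <= r3 ->
  (leb3 R).-integrable setT
    (EFin \o (fun x => k x * J c1 r1 (p1 x) * J c2 r2 (p2 x) * J c3 r3 (p3 x))) /\
  \int[leb3 R]_x (k x * J c1 r1 (p1 x) * J c2 r2 (p2 x) * J c3 r3 (p3 x)) = 0.
Proof.
move=> h1 h2 h3.
apply: (gauss_slot (K := fun x => k x * J c1 r1 (p1 x) * J c2 r2 (p2 x)) (y := p3)) => //.
  apply: measurable_funM; last exact: mJp.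
  by apply: measurable_funM => //; exact: mJp.
move=> a3 c3' a30.
have : (leb3 R).-integrable setT (EFin \o (fun x => k x * J c1 r1 (p1 x) *
    gauss a3 c3' (p3 x) * J c2 r2 (p2 x))) /\
  \int[leb3 R]_x (k x * J c1 r1 (p1 x) * gauss a3 c3' (p3 x) * J c2 r2 (p2 x)) = 0.
  apply: (gauss_slot (K := fun x => k x * J c1 r1 (p1 x) * gauss a3 c3' (p3 x)) (y := p2)) => //.
    apply: measurable_funM; last exact: mg.
    by apply: measurable_funM => //; exact: mJp.
  move=> a2 c2' a20.
  have : (leb3 R).-integrable setT (EFin \o (fun x => k x * gauss a3 c3' (p3 x) *
      gauss a2 c2' (p2 x) * J c1 r1 (p1 x))) /\
    \int[leb3 R]_x (k x * gauss a3 c3' (p3 x) * gauss a2 c2' (p2 x) * J c1 r1 (p1 x)) = 0.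
    apply: (gauss_slot (K := fun x => k x * gauss a3 c3' (p3 x) * gauss a2 c2' (p2 x)) (y := p1)) => //.
      apply: measurable_funM; last exact: mg.
      by apply: measurable_funM => //; exact: mg.
    move=> a1 c1' a10.
    have := @k0 (a1, a2, a3) (c1', c2', c3'); rewrite /pos3/= => /(_ (And3 a10 a20 a30)).
    rewrite (_ : (fun x => k x * gauss3 _ _ x) = (fun x => k x * gauss a3 c3' (p3 x) *
      gauss a2 c2' (p2 x) * gauss a1 c1' (p1 x)))//.
    by apply/funext => x; rewrite /gauss3/= /p1 /p2 /p3; ring.
  rewrite (_ : (fun x => _ * J c1 r1 (p1 x)) = (fun x => k x * J c1 r1 (p1 x) *
     gauss a3 c3' (p3 x) * gauss a2 c2' (p2 x)))//.
  by apply/funext => x; ring.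
rewrite (_ : (fun x => _ * J c2 r2 (p2 x)) = (fun x => k x * J c1 r1 (p1 x) *
     J c2 r2 (p2 x) * gauss a3 c3' (p3 x)))//.
by apply/funext => x; ring.
Qed.

Let cube (n : nat) : R -> R := J 0 n%:R.

Let cubeE n : cube n = \1_(`[- n%:R, n%:R]%classic).
Proof. by rewrite /cube /J sub0r add0r. Qed.

(** [k] is integrable only against Gaussians. Its truncation to a cube is integrable by itself, as
    the pi-lambda lemma requires. *)
Let kn n x := k x * cube n (p1 x) * cube n (p2 x) * cube n (p3 x).

Let Ikn n : (leb3 R).-integrable setT (EFin \o kn n).
Proof. by have [] := @null_box 0 n%:R 0 n%:R 0 n%:R (ler0n _ _) (ler0n _ _) (ler0n _ _). Qed.

Let kn_box n A1 A2 A3 : ccitv A1 -> ccitv A2 -> ccitv A3 ->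
  \int[leb3 R]_x (kn n x * \1_A1 (p1 x) * \1_A2 (p2 x) * \1_A3 (p3 x)) = 0.
Proof.
move=> cA1 cA2 cA3.
have [c1 [r1 [r10 h1]]] := ccitv_cut n 0 cA1.
have [c2 [r2 [r20 h2]]] := ccitv_cut n 0 cA2.
have [c3 [r3 [r30 h3]]] := ccitv_cut n 0 cA3.
rewrite (_ : (fun x => _) = (fun x => k x * (\1_A1 (p1 x) * cube n (p1 x)) *
  (\1_A2 (p2 x) * cube n (p2 x)) * (\1_A3 (p3 x) * cube n (p3 x)))); last first.
  by apply/funext => x; rewrite /kn; ring.
have z (f : mR3 R -> R) : f =1 (fun=> 0) -> \int[leb3 R]_x f x = 0.
  by move=> /funext ->; rewrite /Rintegral integral0.
rewrite !cubeE.
case: h1 => h1; last by apply: z => x; rewrite h1; ring.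
case: h2 => h2; last by apply: z => x; rewrite h2; ring.
case: h3 => h3; last by apply: z => x; rewrite h3; ring.
by under eq_Rintegral do rewrite h1 h2 h3; have [] := @null_box c1 r1 c2 r2 c3 r3.
Qed.

Let ccT : ccitv setT. Proof. by right; left. Qed.

Let IM n (E : set R) (y : mR3 R -> R) : measurable E -> measurable_fun setT y ->
  (leb3 R).-integrable setT (EFin \o (fun x => kn n x * \1_E (y x))) :=
  fun mE my => integrable_indicM mE my (Ikn n).

(** Each application of the pi-lambda lemma turns the interval of one coordinate into an arbitrary
    Borel set; the factors are reordered so that this coordinate comes last. *)
Let kn_rect n (E1 E2 E3 : set R) : measurable E1 -> measurable E2 -> measurable E3 ->
  \int[leb3 R]_x (kn n x * \1_E1 (p1 x) * \1_E2 (p2 x) * \1_E3 (p3 x)) = 0.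
Proof.
move=> mE1 mE2 mE3.
apply: (Rintegral_preimage0' (G := ccitv)
    (f := fun x => kn n x * \1_E1 (p1 x) * \1_E2 (p2 x)) (y := p3)) => //.
- by apply: integrable_indicM => //; exact: IM.
- exact: ccitvI.
- exact: measurable_ccitv.
- exact: measurable_ccitvW.
move=> A3 cA3; have mA3 := measurable_ccitvW cA3.
transitivity (\int[leb3 R]_x (kn n x * \1_E1 (p1 x) * \1_A3 (p3 x) * \1_E2 (p2 x))).
  by apply: eq_Rintegral => x _; ring.
apply: (Rintegral_preimage0' (G := ccitv)
    (f := fun x => kn n x * \1_E1 (p1 x) * \1_A3 (p3 x)) (y := p2)) => //.
- by apply: integrable_indicM => //; exact: IM.
- exact: ccitvI.
- exact: measurable_ccitv.
- exact: measurable_ccitvW.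
move=> A2 cA2; have mA2 := measurable_ccitvW cA2.
transitivity (\int[leb3 R]_x (kn n x * \1_A2 (p2 x) * \1_A3 (p3 x) * \1_E1 (p1 x))).
  by apply: eq_Rintegral => x _; ring.
apply: (Rintegral_preimage0' (G := ccitv)
    (f := fun x => kn n x * \1_A2 (p2 x) * \1_A3 (p3 x)) (y := p1)) => //.
- by apply: integrable_indicM => //; exact: IM.
- exact: ccitvI.
- exact: measurable_ccitv.
- exact: measurable_ccitvW.
move=> A1 cA1; rewrite -[RHS](kn_box n cA1 cA2 cA3).
by apply: eq_Rintegral => x _; ring.
Qed.

Let indicX d1 d2 (T1 : measurableType d1) (T2 : measurableType d2)
  (A : set T1) (B : set T2) x : \1_(A `*` B) x = \1_A x.1 * \1_B x.2 :> R.
Proof. by rewrite !indicE -natrM mulnb in_setX. Qed.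

Let kn_rect2 n (F : set (mR R * mR R)) (E3 : set (mR R)) : measurable F -> measurable E3 ->
  \int[leb3 R]_x (kn n x * \1_F x.1 * \1_E3 (p3 x)) = 0.
Proof.
move=> mF mE3.
transitivity (\int[leb3 R]_x (kn n x * \1_E3 (p3 x) * \1_F x.1)).
  by apply: eq_Rintegral => x _; ring.
apply: (Rintegral_preimage0' (G := [set A `*` B | A in @measurable _ (measurableTypeR R) &
   B in @measurable _ (measurableTypeR R)]) (f := fun x => kn n x * \1_E3 (p3 x)) (y := fst)) => //.
- exact: IM.
- move=> _ _ [A mA [B mB <-]] [A' mA' [B' mB' <-]].
  rewrite -setXI; exists (A `&` A'); first exact: measurableI.
  by exists (B `&` B') => //; exact: measurableI.
- by exists setT => //; exists setT => //; rewrite setXTT.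
- by rewrite -measurable_prod_measurableType.
- by move=> _ [A mA [B mB <-]]; exact: measurableX.
- move=> _ [A mA [B mB <-]].
  rewrite -[RHS](@kn_rect n A B E3)//.
  by apply: eq_Rintegral => x _; rewrite indicX; ring.
Qed.

Let kn_set n (E : set (mR3 R)) : measurable E -> \int[leb3 R]_(x in E) kn n x = 0.
Proof.
move=> mE; rewrite Rintegral_indic.
apply: (Rintegral_preimage0' (G := [set A `*` B | A in
   @measurable _ (measurableTypeR R * measurableTypeR R)%type &
   B in @measurable _ (measurableTypeR R)]) (f := kn n) (y := id)) => //.
- move=> _ _ [A mA [B mB <-]] [A' mA' [B' mB' <-]].
  rewrite -setXI; exists (A `&` A'); first exact: measurableI.
  by exists (B `&` B') => //; exact: measurableI.
- by exists setT => //; exists setT => //; rewrite setXTT.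
- by rewrite -measurable_prod_measurableType.
- by move=> _ [A mA [B mB <-]]; exact: measurableX.
- move=> _ [A mA [B mB <-]].
  rewrite -[RHS](@kn_rect2 n A B)//.
  by apply: eq_Rintegral => x _; rewrite indicX; ring.
Qed.

(** Each truncation integrates to 0 over every measurable set and so vanishes almost everywhere, and
    every point lies in one of countably many cubes. All uniqueness statements for transforms rest
    on this lemma. *)
Lemma gauss3_ae0 : {ae leb3 R, forall x, k x = 0}.
Proof.
have h n : {ae leb3 R, forall x, kn n x = 0}.
  have := @integral_ae_eq _ _ R (leb3 R) setT measurableT (cst 0%E) (EFin \o kn n) (Ikn n).
  case=> // [E _ mE|].
    rewrite integral0 -[LHS]fineK; first by rewrite -[fine _]/(Rintegral _ _ _) kn_set.
    by apply: integrable_fin_num => //; apply: integrableS (Ikn n).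
  move=> N [mN N0 sub]; exists N; split => // x /= nx; apply: sub => /= /(_ I).
  by move=> [].
have : {ae leb3 R, forall x n, kn n x = 0} by apply/ae_foralln.
apply: filterS => x /= kx.
have [n nx] : exists n : nat, `|x.1.1| + `|x.1.2| + `|x.2| <= n%:R.
  exists (Num.truncn (`|x.1.1| + `|x.1.2| + `|x.2|)).+1.
  by rewrite ltW// truncnS_gt.
have := kx n; rewrite /kn !cubeE !indicE !mem_set ?mulr1//= in_itv/= -ler_norml;
  apply: le_trans nx.
- by rewrite lerDr addr_ge0.
- by rewrite (addrC `|x.1.1|) -addrA lerDl addr_ge0.
- by rewrite -addrA lerDl addr_ge0.
Qed.

End Gauss3Null.

End Uniqueness.

(** * Schwartz functions and the Fourier transform *)

Section RealDerivatives.
Context {R : realType}.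
Implicit Types (f g : R -> R) (x a b : R).

Lemma is_der_add f g x a b : is_derive x 1 f a -> is_derive x 1 g b ->
  is_derive x 1 (fun y => f y + g y) (a + b).
Proof. by move=> fa gb; exact: is_deriveD. Qed.

Lemma is_der_mul f g x a b : is_derive x 1 f a -> is_derive x 1 g b ->
  is_derive x 1 (fun y => f y * g y) (f x * b + g x * a).
Proof. by move=> fa gb; exact: is_deriveM. Qed.

Lemma is_der_scale f x a (k : R) : is_derive x 1 f a ->
  is_derive x 1 (fun y => k * f y) (k * a).
Proof. by move=> fa; exact: is_deriveZ. Qed.

Lemma is_der_opp f x a : is_derive x 1 f a -> is_derive x 1 (fun y => - f y) (- a).
Proof. by move=> fa; exact: is_deriveN. Qed.

Lemma is_der_id x : is_derive x 1 (fun y : R => y) 1.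
Proof. exact: is_derive_id. Qed.

Lemma is_der_cst (k x : R) : is_derive x 1 (fun _ : R => k) 0.
Proof. exact: is_derive_cst. Qed.

Lemma is_der_comp f g x a b : is_derive (g x) 1 f a -> is_derive x 1 g b ->
  is_derive x 1 (fun y => f (g y)) (a * b).
Proof. by move=> fa gb; exact: is_derive1_comp. Qed.

Lemma is_der_eq f x a b : is_derive x 1 f a -> a = b -> is_derive x 1 f b.
Proof. by move=> + <-. Qed.

Lemma der_continuous f x a : is_derive x 1 f a -> {for x, continuous f}.
Proof.
by move=> [fx _]; apply: differentiable_continuous; exact/derivable1_diffP.
Qed.

Lemma der_cos_scale (k x : R) :
  is_derive x 1 (fun y : R => cos (k * y)) (- (k * sin (k * x))).
Proof.
apply: is_der_eq (is_der_comp (is_derive_cos _) (is_der_scale k (is_der_id x))) _.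
by rewrite mulr1 mulNr mulrC.
Qed.

Lemma der_sin_scale (k x : R) :
  is_derive x 1 (fun y : R => sin (k * y)) (k * cos (k * x)).
Proof.
apply: is_der_eq (is_der_comp (is_derive_sin _) (is_der_scale k (is_der_id x))) _.
by rewrite mulr1 mulrC.
Qed.

Lemma der_gauss (a c x : R) :
  is_derive x 1 (gauss a c) (- (2 * a * (x - c)) * gauss a c x).
Proof.
have h : is_derive x 1 (fun y : R => - (a * (y - c) ^+ 2)) (- (2 * a * (x - c))).
  apply: is_der_eq (is_der_opp (is_der_scale a (is_der_mul (is_der_add (is_der_id x) (is_der_cst (- c) x))
    (is_der_add (is_der_id x) (is_der_cst (- c) x))))) _; ring.
by apply: is_der_eq (is_der_comp (is_derive_expR _) h) _; rewrite /gauss mulrC.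
Qed.

Lemma measurable_cont f : continuous f -> measurable_fun setT f.
Proof. exact: continuous_measurable_fun. Qed.

End RealDerivatives.

Section Schwartz1.
Context {R : realType}.
Notation mu := (@lebesgue_measure R).
Implicit Types (f g tau : R -> R).

Definition decaying f :=
  forall m : nat, exists C : R, forall x, `|x| ^+ m * `|f x| <= C.

(* The greatest class of decaying functions that is closed under derivation. *)
Definition schwartz1 f := exists2 P : set (R -> R), P f &
  forall g, P g -> decaying g /\
    exists g', P g' /\ forall x : R, is_derive x 1 g (g' x).

Lemma schwartz1_decaying f : schwartz1 f -> decaying f.
Proof. by move=> [P Pf PP]; have [] := PP _ Pf. Qed.

Lemma schwartz1_der f : schwartz1 f ->
  exists f', schwartz1 f' /\ forall x : R, is_derive x 1 f (f' x).
Proof.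
move=> [P Pf PP]; have [_ [f' [Pf' ff']]] := PP _ Pf.
by exists f'; split => //; exists P.
Qed.

Lemma schwartz1_continuous f : schwartz1 f -> continuous f.
Proof. by move=> /schwartz1_der[f' [_ ff']] x; exact: der_continuous (ff' x). Qed.

Lemma schwartz1_measurable f : schwartz1 f -> measurable_fun setT f.
Proof. by move=> /schwartz1_continuous/measurable_cont. Qed.

Lemma decayingD f g : decaying f -> decaying g -> decaying (fun x => f x + g x).
Proof.
move=> df dg m; have [C fC] := df m; have [D gD] := dg m.
exists (C + D) => x; apply: le_trans (lerD (fC x) (gD x)).
by rewrite -mulrDr ler_wpM2l// ?exprn_ge0// ler_normD.
Qed.

Lemma decayingZ (k : R) f : decaying f -> decaying (fun x => k * f x).
Proof.
move=> df m; have [C fC] := df m; exists (`|k| * C) => x.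
by rewrite normrM mulrCA ler_wpM2l.
Qed.

Lemma decayingX f : decaying f -> decaying (fun x => x * f x).
Proof.
move=> df m; have [C fC] := df m.+1; exists C => x.
by rewrite normrM mulrA -exprSr.
Qed.

Lemma schwartz1D f g : schwartz1 f -> schwartz1 g -> schwartz1 (fun x => f x + g x).
Proof.
move=> sf sg.
exists [set h | exists h1 h2, [/\ schwartz1 h1, schwartz1 h2 & h = fun x => h1 x + h2 x]].
  by exists f, g.
move=> _ [h1 [h2 [s1 s2 ->]]]; split.
  by apply: decayingD; exact: schwartz1_decaying.
have [h1' [s1' d1]] := schwartz1_der s1; have [h2' [s2' d2]] := schwartz1_der s2.
exists (fun x => h1' x + h2' x); split; first by exists h1', h2'.
by move=> x; exact: is_der_add.
Qed.

Lemma schwartz1Z (k : R) f : schwartz1 f -> schwartz1 (fun x => k * f x).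
Proof.
move=> sf; exists [set h | exists2 h1, schwartz1 h1 & h = fun x => k * h1 x].
  by exists f.
move=> _ [h1 s1 ->]; split; first by apply: decayingZ; exact: schwartz1_decaying.
have [h1' [s1' d1]] := schwartz1_der s1.
exists (fun x => k * h1' x); split; first by exists h1'.
by move=> x; exact: is_der_scale.
Qed.

(** Deriving x h1 produces the additional term h1, so products x h1 alone are not stable; the class
    of all x h1 + h2 is. The given function is the member with h2 = 0, written [0 * f]. *)
Lemma schwartz1X f : schwartz1 f -> schwartz1 (fun x => x * f x).
Proof.
move=> sf; exists [set h | exists h1 h2, [/\ schwartz1 h1, schwartz1 h2 &
    h = fun x => x * h1 x + h2 x]].
  exists f, (fun x => 0 * f x); split => //; first exact: schwartz1Z.
  by apply/funext => x; rewrite mul0r addr0.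
move=> _ [h1 [h2 [s1 s2 ->]]]; split.
  by apply: decayingD; [apply: decayingX|]; exact: schwartz1_decaying.
have [h1' [s1' d1]] := schwartz1_der s1; have [h2' [s2' d2]] := schwartz1_der s2.
exists (fun x => x * h1' x + (h1 x + h2' x)); split.
  by exists h1', (fun x => h1 x + h2' x); split => //; exact: schwartz1D.
move=> x; apply: is_der_eq (is_der_add (is_der_mul (is_der_id x) (d1 x)) (d2 x)) _.
by rewrite mulr1 addrA.
Qed.

(** Polynomials times a Gaussian: a class stable under derivation that witnesses [schwartz1] for the
    Gaussian itself. *)
Inductive gauss_span (a c : R) : (R -> R) -> Prop :=
| gauss_span1 : gauss_span a c (gauss a c)
| gauss_spanX f : gauss_span a c f -> gauss_span a c (fun x => x * f x)
| gauss_spanZ (k : R) f : gauss_span a c f -> gauss_span a c (fun x => k * f x)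
| gauss_spanD f g : gauss_span a c f -> gauss_span a c g ->
    gauss_span a c (fun x => f x + g x).

Lemma gauss_span_der a c f : gauss_span a c f ->
  exists f', gauss_span a c f' /\ forall x : R, is_derive x 1 f (f' x).
Proof.
elim => [|{}f gf [f' [gf' d]]|k {}f gf [f' [gf' d]]|
    {}f g gf [f' [gf' d]] gg [g' [gg' e]]].
- exists (fun x => - (2 * a) * (x * gauss a c x) + 2 * a * c * gauss a c x); split.
    by apply: gauss_spanD; apply: gauss_spanZ; [apply: gauss_spanX|];
      exact: gauss_span1.
  by move=> x; apply: is_der_eq (der_gauss a c x) _; ring.
- exists (fun x => x * f' x + f x); split.
    by apply: gauss_spanD => //; exact: gauss_spanX.
  by move=> x; apply: is_der_eq (is_der_mul (is_der_id x) (d x)) _; rewrite mulr1.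
- exists (fun x => k * f' x); split; first exact: gauss_spanZ.
  by move=> x; exact: is_der_scale.
- exists (fun x => f' x + g' x); split; first exact: gauss_spanD.
  by move=> x; exact: is_der_add.
Qed.

Lemma decaying_gauss a c : 0 < a -> decaying (gauss a c).
Proof.
move=> a0 m.
(* With D = (x - c)^2, the factor |x|^m will cost at most exp (m b D), and m b <= a lets the
   Gaussian absorb it. The number l below is chosen so that l (1 + D) <= 1 + b D <= exp (b D). *)
pose b := a / m.+1%:R; have b0 : 0 < b by rewrite divr_gt0.
pose l : R := Num.min 1 b; have l0 : 0 < l by rewrite lt_min ltr01.
have l1 : l <= 1 by rewrite ge_min lexx.
have lb : l <= b by rewrite ge_min lexx orbT.
pose K := ((1 + `|c|) / l).
have K0 : 0 <= K by rewrite divr_ge0 ?addr_ge0// ltW.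
exists (K ^+ m) => x.
rewrite [X in _ * X]ger0_norm; last exact/ltW/gauss_gt0.
set D := (x - c) ^+ 2; have D0 : 0 <= D by exact: sqr_ge0.
have h1 : `|x| <= (1 + `|c|) * (1 + D).
  have : `|x| <= `|x - c| + `|c| by rewrite -{1}(subrK c x) ler_normD.
  have : `|x - c| <= 1 + D.
    rewrite /D -real_normK ?num_real//.
    have := normr_ge0 (x - c); set y := `|x - c| => y0.
    by have := sqr_ge0 (y - 1); rewrite !expr2; nra.
  by have := normr_ge0 c; nra.
have h2 : l * (1 + D) <= expR (b * D).
  by apply: le_trans (expR_ge1Dx _); nra.
have h3 : `|x| <= K * expR (b * D).
  apply: (le_trans h1); rewrite /K -mulrA ler_wpM2l ?addr_ge0//.
  by rewrite mulrC ler_pdivlMr// mulrC.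
apply: (@le_trans _ _ ((K * expR (b * D)) ^+ m * gauss a c x)).
  apply: ler_wpM2r; first exact/ltW/gauss_gt0.
  by apply: lerXn2r => //; rewrite nnegrE// mulr_ge0// expR_ge0.
rewrite exprMn -mulrA ler_piMr ?exprn_ge0//.
rewrite -expRM_natl /gauss -expRD expR_le1 -/D subr_le0 mulrA ler_wpM2r//.
rewrite /b mulrCA -[leRHS]mulr1; apply: ler_wpM2l; first exact: ltW.
by rewrite ler_pdivrMr// mul1r ler_nat.
Qed.

Lemma schwartz1_gauss a c : 0 < a -> schwartz1 (gauss a c).
Proof.
move=> a0; exists (gauss_span a c); first exact: gauss_span1.
move=> g sg; split; last exact: gauss_span_der.
elim: sg => [|f _ df|k f _ df|f h _ df _ dh].
- exact: decaying_gauss.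
- exact: decayingX.
- exact: decayingZ.
- exact: decayingD.
Qed.

Lemma integrable_oneDsqrV :
  mu.-integrable setT (EFin \o (fun x : R => (1 + x ^+ 2)^-1)).
Proof.
have m : measurable_fun setT (fun x : R => (1 + x ^+ 2)^-1).
  by apply: measurable_cont; exact: continuous_oneDsqrV.
have p (x : R) : 0 <= (1 + x ^+ 2)^-1 by rewrite invr_ge0 addr_ge0// sqr_ge0.
apply/integrableP; split; first exact/measurable_EFinP.
under eq_integral do rewrite /= ger0_norm//.
rewrite ge0_symfun_integralT//; last 2 first.
- exact: continuous_oneDsqrV.
- by move=> x /=; rewrite sqrrN.
rewrite (_ : [set x | _] = `[0, +oo[%classic); last first.
  by apply/seteqP; split => x/=; rewrite in_itv/= andbT.
by have := integral0y_oneDsqr R; rewrite /oneDsqr => ->; rewrite -EFinM ltry.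
Qed.

Lemma decaying_integrable f : measurable_fun setT f -> decaying f ->
  mu.-integrable setT (EFin \o f).
Proof.
move=> mf df; have [C fC] := df 0%N; have [D fD] := df 2%N.
have mf' : measurable_fun setT (f : mR R -> R) by exact: mf.
apply: (integrable_dom mf' (integrable_funZ (C + D) integrable_oneDsqrV)) => x.
rewrite ler_pdivlMr; last by rewrite ltr_pwDl// sqr_ge0.
rewrite mulrDr mulr1 lerD//; first by have := fC x; rewrite expr0 mul1r.
by have := fD x; rewrite real_normK ?num_real// mulrC.
Qed.

Lemma schwartz1_integrable f : schwartz1 f -> mu.-integrable setT (EFin \o f).
Proof.
by move=> sf; apply: decaying_integrable; [exact: schwartz1_measurable|exact: schwartz1_decaying].
Qed.

Lemma decaying_cvgy f : decaying f -> f n%:R @[n --> \oo] --> 0.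
Proof.
move=> df; have [C fC] := df 1%N.
apply: norm_cvg0; apply: (@squeeze_cvgr _ _ _ _ (cst 0) (fun n => C * harmonic n.-1)).
- exists 1%N => // n /= n1; rewrite normr_ge0/= prednK//.
  by rewrite ler_pdivlMr ?ltr0n// mulrC; have := fC n%:R; rewrite expr1 ger0_norm.
- exact: cvg_cst.
- rewrite -[X in _ --> X](mulr0 C); apply: cvgM; first exact: cvg_cst.
  by rewrite -(cvg_shiftn 1); under eq_fun do rewrite addn1; exact: cvg_harmonic.
Qed.

Lemma decaying_opp f : decaying f -> decaying (fun x => f (- x)).
Proof.
move=> df m; have [C fC] := df m; exists C => x.
by have := fC (- x); rewrite normrN.
Qed.

(** Source of all integrations by parts: the fundamental theorem on [-n, n], boundary values that
    vanish by decay, and dominated convergence as n grows. *)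
Lemma Rintegral_der0 f g : (forall x : R, is_derive x 1 f (g x)) -> continuous g ->
  decaying f -> mu.-integrable setT (EFin \o g) -> \int[mu]_x g x = 0.
Proof.
move=> fg cg df Ig.
have cf : continuous f by move=> x; exact: der_continuous (fg x).
pose I n : set R := `[- n%:R, n%:R]%classic.
have [|||||_ _ h] := @dominated_convergence _ _ _ mu setT measurableT
  (fun n => EFin \o (g \_ (I n))) (EFin \o g) (EFin \o (fun x => `|g x|)).
- move=> n; apply/measurable_EFinP; apply/(measurable_restrictT _ _).1 => //.
    exact: measurable_itv.
  have mg : measurable_fun setT (g : mR R -> R) by exact: measurable_cont.
  exact: measurable_funTS.
- exact: measurable_int Ig.
- apply: aeW => x _; apply: cvg_EFin; first exact: nearW.
  apply: cvg_near_cst; exists (Num.truncn `|x|).+1 => // n /= xn.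
  rewrite /= patchE mem_set// /I /= in_itv/= -ler_norml.
  by rewrite (le_trans (ltW (truncnS_gt _)))// ler_nat.
- exact: integrable_funn.
- apply: aeW => x n _ /=; rewrite lee_fin patchE; case: ifP => // _.
  by rewrite normr0.
have E n : (0 < n)%N -> (\int[mu]_x (EFin \o (g \_ (I n))) x = (f n%:R - f (- n%:R))%:E)%E.
  move=> n0; rewrite -restrict_EFin -integral_mkcond.
  rewrite (@continuous_FTC2 _ g f) ?EFinB//.
  - by rewrite gtrN// ltr0n.
  - by apply: continuous_subspaceT.
  - split.
    + by move=> x _; have [] := fg x.
    + by apply: cvg_at_right_filter; exact: cf.
    + by apply: cvg_at_left_filter; exact: cf.
  - by move=> x _; rewrite derive1E; exact: derive_val.
rewrite /Rintegral.
have -> : (\int[mu]_x (g x)%:E = 0)%E; last by [].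
apply: (cvg_unique _ h); first exact: ereal_hausdorff.
have : (f n%:R - f (- n%:R))%:E @[n --> \oo] --> 0%E.
  apply: cvg_EFin; first exact: nearW.
  rewrite /= -[X in _ --> X]subr0; apply: cvgB; first exact: decaying_cvgy.
  by apply: (@decaying_cvgy (fun x => f (- x))); exact: decaying_opp.
apply: cvg_trans; apply: near_eq_cvg; exists 1%N => // n /= n1.
by rewrite E.
Qed.

End Schwartz1.

Lemma der_under_integral d (T : measurableType d) (R : realType)
    (mu : {measure set T -> \bar R}) (F F' : R -> T -> R) (G : T -> R) (a : R) :
  (forall x, mu.-integrable setT (EFin \o F x)) ->
  (forall (x : R) y, is_derive x 1 (F ^~ y) (F' x y)) ->
  mu.-integrable setT (EFin \o G) -> (forall x y, `|F' x y| <= G y) ->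
  is_derive a 1 (fun x => \int[mu]_y F x y) (\int[mu]_y F' a y).
Proof.
move=> IF dF IG FG.
have E x y : partial1of2 F x y = F' x y.
  by rewrite partial1of2E; exact: (@derive_val _ _ _ _ _ _ _ (dF x y)).
have aI : `]a - 1, a + 1[%classic a by rewrite /= in_itv/= ltrBlDr ltrDl ltr01.
have h1 x : `]a - 1, a + 1[%classic x -> mu.-integrable setT (EFin \o F x) by [].
have h2 (x : R) y : `]a - 1, a + 1[%classic x -> [set: T] y -> derivable (F ^~ y) x 1.
  by move=> _ _; have [] := dF x y.
have h3 y : 0 <= G y by apply: le_trans (FG a y).
have h4 (x : R) y : `]a - 1, a + 1[%classic x -> [set: T] y -> `|partial1of2 F x y| <= G y.
  by move=> _ _; rewrite E.
apply: DeriveDef.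
  exact: (derivable_under_integral measurableT aI h1 h2 h3 IG h4).
rewrite -derive1E (differentiation_under_integral measurableT aI h1 h2 h3 IG h4).
by apply: eq_Rintegral => y _; rewrite E.
Qed.

(** * Cosine and sine transforms in one variable *)

Section Fourier1.
Context {R : realType}.
Notation mu := (@lebesgue_measure R).
Implicit Types (f g tau : R -> R).

(** The Fourier transform of a real function is [cosT tau - i sinT tau]; the splitting keeps all
    integrals real. *)
Definition cosT tau (x : R) : R := \int[mu]_xi (tau xi * cos (x * xi)).
Definition sinT tau (x : R) : R := \int[mu]_xi (tau xi * sin (x * xi)).

Let mcos (x : R) : measurable_fun setT (fun xi : mR R => cos (x * xi)).
Proof. by apply: measurable_cont => y; exact: der_continuous (der_cos_scale x y). Qed.

Let msin (x : R) : measurable_fun setT (fun xi : mR R => sin (x * xi)).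
Proof. by apply: measurable_cont => y; exact: der_continuous (der_sin_scale x y). Qed.

Lemma integrable_cosM tau (x : R) : mu.-integrable setT (EFin \o tau) ->
  mu.-integrable setT (EFin \o (fun xi => tau xi * cos (x * xi))).
Proof.
move=> It; apply: (integrable_mul_bounded (C := 1)) It; first exact: mcos.
by move=> xi; exact: cos_max.
Qed.

Lemma integrable_sinM tau (x : R) : mu.-integrable setT (EFin \o tau) ->
  mu.-integrable setT (EFin \o (fun xi => tau xi * sin (x * xi))).
Proof.
move=> It; apply: (integrable_mul_bounded (C := 1)) It; first exact: msin.
by move=> xi; exact: sin_max.
Qed.

Lemma der_cosT tau (x : R) : schwartz1 tau ->
  is_derive x 1 (cosT tau) (- sinT (fun xi => xi * tau xi) x).
Proof.
move=> st; have It := schwartz1_integrable st.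
have It1 := schwartz1_integrable (schwartz1X st).
have -> : - sinT (fun xi => xi * tau xi) x =
    \int[mu]_xi ((- 1) * (xi * tau xi * sin (x * xi))).
  by rewrite RintegralZl ?mulN1r//; exact: integrable_sinM.
apply: (@der_under_integral _ _ _ mu (fun x xi => tau xi * cos (x * xi))
  (fun x xi => - 1 * (xi * tau xi * sin (x * xi))) (fun xi => `|xi * tau xi|)).
- by move=> y; exact: integrable_cosM.
- move=> y xi; have := is_der_scale (tau xi) (der_cos_scale xi y).
  rewrite (_ : (fun z => _) = (fun z => tau xi * cos (z * xi))); last first.
    by apply/funext => z; rewrite (mulrC z).
  by move=> h; apply: is_der_eq h _; rewrite (mulrC xi y); ring.
- exact: integrable_funn.
- by move=> y xi; rewrite mulN1r normrN normrM ler_piMr// sin_max.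
Qed.

Lemma der_sinT tau (x : R) : schwartz1 tau ->
  is_derive x 1 (sinT tau) (cosT (fun xi => xi * tau xi) x).
Proof.
move=> st; have It := schwartz1_integrable st.
have It1 := schwartz1_integrable (schwartz1X st).
apply: (@der_under_integral _ _ _ mu (fun x xi => tau xi * sin (x * xi))
  (fun x xi => xi * tau xi * cos (x * xi)) (fun xi => `|xi * tau xi|)).
- by move=> y; exact: integrable_sinM.
- move=> y xi; have := is_der_scale (tau xi) (der_sin_scale xi y).
  rewrite (_ : (fun z => _) = (fun z => tau xi * sin (z * xi))); last first.
    by apply/funext => z; rewrite (mulrC z).
  by move=> h; apply: is_der_eq h _; rewrite (mulrC xi y); ring.
- exact: integrable_funn.
- by move=> y xi; rewrite normrM ler_piMr// cos_max.
Qed.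

Let decaying_bounded (f h : R -> R) : decaying f -> (forall x, `|h x| <= 1) ->
  decaying (fun x => f x * h x).
Proof.
move=> df h1 m; have [C fC] := df m; exists C => x; apply: le_trans (fC x).
by rewrite normrM ler_wpM2l ?exprn_ge0// ler_piMr.
Qed.

(** The integrand of [cosT tau' x - x * sinT tau x] is the derivative of tau (xi) cos (x xi), so its
    integral is 0. *)
Lemma cosT_der tau tau' (x : R) : schwartz1 tau -> schwartz1 tau' ->
  (forall y : R, is_derive y 1 tau (tau' y)) -> x * sinT tau x = cosT tau' x.
Proof.
move=> st st' d.
have It := schwartz1_integrable st; have It' := schwartz1_integrable st'.
apply/eqP; rewrite -subr_eq0 -oppr_eq0 opprB; apply/eqP.
rewrite /sinT -RintegralZl//; last exact: integrable_sinM.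
rewrite /cosT -RintegralB//; [|exact: integrable_cosM|exact/integrable_funZ/integrable_sinM].
apply: (@Rintegral_der0 _ (fun xi => tau xi * cos (x * xi))).
- move=> y; apply: is_der_eq (is_der_mul (d y) (der_cos_scale x y)) _; ring.
- move=> y; apply: cvgB.
    apply: cvgM; first exact: schwartz1_continuous.
    exact: der_continuous (der_cos_scale x y).
  apply: cvgM; first exact: cvg_cst.
  apply: cvgM; first exact: schwartz1_continuous.
  exact: der_continuous (der_sin_scale x y).
- apply: decaying_bounded; first exact: schwartz1_decaying.
  by move=> y; exact: cos_max.
- by apply: integrable_funB; [exact: integrable_cosM|exact/integrable_funZ/integrable_sinM].
Qed.

Lemma sinT_der tau tau' (x : R) : schwartz1 tau -> schwartz1 tau' ->
  (forall y : R, is_derive y 1 tau (tau' y)) -> x * cosT tau x = - sinT tau' x.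
Proof.
move=> st st' d.
have It := schwartz1_integrable st; have It' := schwartz1_integrable st'.
apply/eqP; rewrite -subr_eq0 opprK addrC; apply/eqP.
rewrite /cosT -RintegralZl//; last exact: integrable_cosM.
rewrite /sinT -RintegralD//; [|exact: integrable_sinM|exact/integrable_funZ/integrable_cosM].
apply: (@Rintegral_der0 _ (fun xi => tau xi * sin (x * xi))).
- move=> y; apply: is_der_eq (is_der_mul (d y) (der_sin_scale x y)) _; ring.
- move=> y; apply: cvgD.
    apply: cvgM; first exact: schwartz1_continuous.
    exact: der_continuous (der_sin_scale x y).
  apply: cvgM; first exact: cvg_cst.
  apply: cvgM; first exact: schwartz1_continuous.
  exact: der_continuous (der_cos_scale x y).
- apply: decaying_bounded; first exact: schwartz1_decaying.
  by move=> y; exact: sin_max.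
- by apply: integrable_funD; [exact: integrable_sinM|exact/integrable_funZ/integrable_cosM].
Qed.

Lemma cosT_bounded tau (x : R) : mu.-integrable setT (EFin \o tau) ->
  `|cosT tau x| <= \int[mu]_xi `|tau xi|.
Proof.
move=> It; apply: le_trans (le_normr_Rintegral _ _) _ => //.
  exact: integrable_cosM.
apply: le_Rintegral => //.
- exact/integrable_funn/integrable_cosM.
- exact/integrable_funn.
- by move=> y _; rewrite normrM ler_piMr// cos_max.
Qed.

Lemma sinT_bounded tau (x : R) : mu.-integrable setT (EFin \o tau) ->
  `|sinT tau x| <= \int[mu]_xi `|tau xi|.
Proof.
move=> It; apply: le_trans (le_normr_Rintegral _ _) _ => //.
  exact: integrable_sinM.
apply: le_Rintegral => //.
- exact/integrable_funn/integrable_sinM.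
- exact/integrable_funn.
- by move=> y _; rewrite normrM ler_piMr// sin_max.
Qed.

(** A factor x is traded for a derivative of [tau], which exchanges cosine and sine; both transforms
    therefore go through the induction together. *)
Let decaying_trig m tau : schwartz1 tau -> exists C, forall x,
  `|x| ^+ m * `|cosT tau x| <= C /\ `|x| ^+ m * `|sinT tau x| <= C.
Proof.
elim: m tau => [|m IHm] tau st.
  exists (\int[mu]_xi `|tau xi|) => x; rewrite !expr0 !mul1r.
  by split; [apply: cosT_bounded|apply: sinT_bounded]; exact: schwartz1_integrable.
have [tau' [st' d]] := schwartz1_der st.
have [C hC] := IHm _ st'; exists C => x; have [h1 h2] := hC x.
rewrite !exprSr -!mulrA -!normrM (cosT_der _ st st')// (sinT_der _ st st')//.
by rewrite normrN.
Qed.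

(** Cosine and sine transforms form a single class because derivation exchanges them, up to a factor
    xi or -xi on [tau]. *)
Lemma schwartz1_trig f : (exists2 tau, schwartz1 tau & (f = cosT tau \/ f = sinT tau)) ->
  schwartz1 f.
Proof.
move=> h; exists [set f | exists2 tau, schwartz1 tau & (f = cosT tau \/ f = sinT tau)] => //.
move=> _ [tau st [->|->]]; split.
- by move=> m; have [C hC] := decaying_trig m st; exists C => x; have [] := hC x.
- exists (sinT (fun xi => -1 * (xi * tau xi))); split.
    by eexists; last (by right; reflexivity); exact/schwartz1Z/schwartz1X.
  move=> x; apply: is_der_eq (der_cosT x st) _; rewrite -[LHS]mulN1r /sinT -RintegralZl//.
    by apply: eq_Rintegral => y _; rewrite mulrA.
  exact/integrable_sinM/schwartz1_integrable/schwartz1X.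
- by move=> m; have [C hC] := decaying_trig m st; exists C => x; have [] := hC x.
- exists (cosT (fun xi => xi * tau xi)); split.
    by eexists; last (by left; reflexivity); exact/schwartz1X.
  by move=> x; exact: der_sinT.
Qed.

Lemma schwartz1_cosT tau : schwartz1 tau -> schwartz1 (cosT tau).
Proof. by move=> st; apply: schwartz1_trig; exists tau => //; left. Qed.

Lemma schwartz1_sinT tau : schwartz1 tau -> schwartz1 (sinT tau).
Proof. by move=> st; apply: schwartz1_trig; exists tau => //; right. Qed.

Definition gauss_mass (a : R) : R := Num.sqrt (pi / a).

Lemma gauss_mass_gt0 a : 0 < a -> 0 < gauss_mass a.
Proof. by move=> a0; rewrite sqrtr_gt0 divr_gt0// pi_gt0. Qed.

Lemma Rintegral_gauss a c : 0 < a -> \int[mu]_xi gauss a c xi = gauss_mass a.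
Proof.
(* The variance s^2 = 1 / (2 a) turns the exponent (x - c)^2 / (2 s^2) of the normal density into a
   (x - c)^2. *)
move=> a0; pose s : R := (Num.sqrt (2 * a))^-1.
have s0 : s != 0 by rewrite invr_eq0 gt_eqF// sqrtr_gt0 mulr_gt0.
have s2 : s ^+ 2 = (2 * a)^-1 by rewrite exprVn sqr_sqrtr// mulr_ge0// ltW.
have nf : normal_fun c s = gauss a c.
  apply/funext => x; rewrite /normal_fun /gauss s2 -mulr_natr; congr expR.
  by field; rewrite gt_eqF.
have := integral_normal_pdf c s; rewrite normal_pdfE// /normal_peak.
under eq_integral do rewrite EFinM nf.
rewrite integralZl//=; last exact/schwartz1_integrable/schwartz1_gauss.
have -> : (s ^+ 2 * pi *+ 2) = pi / a.
  by rewrite s2 -mulr_natr; field; rewrite gt_eqF.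
have fin := integrable_fin_num measurableT (schwartz1_integrable (schwartz1_gauss c a0)).
rewrite -[X in (_ * X)%E]fineK// -EFinM => -[].
rewrite -/(gauss_mass a) -[fine _]/(Rintegral _ _ _) => h.
have m0 := gauss_mass_gt0 a0.
by rewrite -[RHS]mulr1 -h mulrA divff ?gt_eqF// mul1r.
Qed.

Let solve_lin (a c y F S X : R) : a != 0 ->
  y * S = - (2 * a) * X + 2 * a * c * F -> X = c * F - y / (2 * a) * S.
Proof.
move=> a0 h; have -> : y / (2 * a) * S = (y * S) / (2 * a) by field.
by rewrite h; field.
Qed.

(** Derivation under the integral and integration by parts give a linear differential system for F
    and S. Multiplied by E = exp (x^2 / (4 a)) and rotated by the angle c x, the pair becomes (U, V)
    with zero derivative, and its value at 0 is ([gauss_mass a], 0). *)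
Lemma trigT_gauss a c (x : R) : 0 < a ->
  cosT (gauss a c) x = gauss_mass a * cos (c * x) * expR (- (x ^+ 2 / (4 * a))) /\
  sinT (gauss a c) x = gauss_mass a * sin (c * x) * expR (- (x ^+ 2 / (4 * a))).
Proof.
move=> a0; have sg := schwartz1_gauss c a0.
have a0' : a != 0 by rewrite gt_eqF.
pose F := cosT (gauss a c); pose S := sinT (gauss a c).
pose E x := expR (x ^+ 2 / (4 * a)).
pose g' := fun xi : R => - (2 * a) * (xi * gauss a c xi) + 2 * a * c * gauss a c xi.
have sX := schwartz1X sg.
have sg' : schwartz1 g' by apply: schwartz1D; exact: schwartz1Z.
have dg (xi : R) : is_derive xi 1 (gauss a c) (g' xi).
  by apply: is_der_eq (der_gauss a c xi) _; rewrite /g'; ring.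
have IX := schwartz1_integrable sX; have Ig := schwartz1_integrable sg.
have cX y : cosT (fun xi => xi * gauss a c xi) y = c * F y - y / (2 * a) * S y.
  have : y * S y = - (2 * a) * cosT (fun xi => xi * gauss a c xi) y + 2 * a * c * F y.
    rewrite /S (cosT_der y sg sg' dg) /F /cosT -!RintegralZl//; try exact: integrable_cosM.
    rewrite -RintegralD//; try exact/integrable_funZ/integrable_cosM.
    by apply: eq_Rintegral => z _; rewrite /g'; ring.
  by apply: solve_lin; rewrite gt_eqF.
have sX' y : sinT (fun xi => xi * gauss a c xi) y = c * S y + y / (2 * a) * F y.
  have : y * F y = - (- (2 * a) * sinT (fun xi => xi * gauss a c xi) y + 2 * a * c * S y).
    rewrite /F (sinT_der y sg sg' dg) /S /sinT -!RintegralZl//; try exact: integrable_sinM.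
    rewrite -RintegralD//; try exact/integrable_funZ/integrable_sinM.
    by congr (- _); apply: eq_Rintegral => z _; rewrite /g'; ring.
  move=> h; rewrite -[y / (2 * a) * F y]opprK -mulrN.
  by apply: solve_lin; [rewrite gt_eqF|rewrite mulrN h opprK].
have dF (y : R) : is_derive y 1 F (- (c * S y + y / (2 * a) * F y)).
  by apply: is_der_eq (der_cosT y sg) _; rewrite sX'.
have dS (y : R) : is_derive y 1 S (c * F y - y / (2 * a) * S y).
  by apply: is_der_eq (der_sinT y sg) _; rewrite cX.
have dE (y : R) : is_derive y 1 E (E y * (y / (2 * a))).
  have h : is_derive y 1 (fun z : R => z ^+ 2 / (4 * a)) (y / (2 * a)).
    apply: is_der_eq (is_der_mul (is_der_mul (is_der_id y) (is_der_id y)) (is_der_cst (4 * a)^-1 y)) _.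
    by rewrite mulr0 add0r; field.
  exact: is_der_comp (is_derive_expR _) h.
have dC (y : R) := der_cos_scale c y; have dN (y : R) := der_sin_scale c y.
pose U y := E y * F y * cos (c * y) + E y * S y * sin (c * y).
pose V y := E y * S y * cos (c * y) + - (E y * F y * sin (c * y)).
have dU (y : R) : is_derive y 1 U 0.
  apply: is_der_eq (is_der_add (is_der_mul (is_der_mul (dE y) (dF y)) (dC y))
     (is_der_mul (is_der_mul (dE y) (dS y)) (dN y))) _; ring.
have dV (y : R) : is_derive y 1 V 0.
  apply: is_der_eq (is_der_add (is_der_mul (is_der_mul (dE y) (dS y)) (dC y))
     (is_der_opp (is_der_mul (is_der_mul (dE y) (dF y)) (dN y)))) _; ring.
have F0 : F 0 = gauss_mass a.
  rewrite -(Rintegral_gauss c a0) /F /cosT; apply: eq_Rintegral => z _.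
  by rewrite mul0r cos0 mulr1.
have S0 : S 0 = 0.
  rewrite /S /sinT; under eq_Rintegral do rewrite mul0r sin0 mulr0.
  by rewrite /Rintegral integral0.
have E0 : E 0 = 1 by rewrite /E expr0n/= mul0r expR0.
have hU : U x = gauss_mass a.
  by rewrite (is_derive_0_is_cst x 0 dU) /U F0 S0 E0 !mulr0 cos0; ring.
have hV : V x = 0.
  by rewrite (is_derive_0_is_cst x 0 dV) /V F0 S0 E0 !mulr0 sin0; ring.
have EK : E x * expR (- (x ^+ 2 / (4 * a))) = 1 by rewrite /E -expRD subrr expR0.
have CS := cos2Dsin2 (c * x).
have e1 : E x * F x = U x * cos (c * x) - V x * sin (c * x).
  by rewrite /U /V -[LHS]mulr1 -CS; ring.
have e2 : E x * S x = U x * sin (c * x) + V x * cos (c * x).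
  by rewrite /U /V -[LHS]mulr1 -CS; ring.
rewrite -/F -/S; split.
- have -> : F x = E x * F x * expR (- (x ^+ 2 / (4 * a))) by rewrite mulrAC EK mul1r.
  by rewrite e1 hU hV; ring.
- have -> : S x = E x * S x * expR (- (x ^+ 2 / (4 * a))) by rewrite mulrAC EK mul1r.
  by rewrite e2 hU hV; ring.
Qed.

End Fourier1.

(** * Sums of tensor products as test functions *)

Section Schwartz3.
Context {R : realType}.

Lemma coord30 (x : R3 R) : coord3 x 0 = x.1.1. Proof. by []. Qed.
Lemma coord31 (x : R3 R) : coord3 x 1 = x.1.2. Proof. by []. Qed.
Lemma coord32 (x : R3 R) : coord3 x 2 = x.2. Proof. by []. Qed.

Lemma sum3E (V : nmodType) (F : 'I_3 -> V) : \sum_(i < 3) F i = F 0 + F 1 + F 2.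
Proof.
rewrite 3!big_ord_recl big_ord0 addr0 addrA; congr (F _ + F _ + F _); exact: val_inj.
Qed.

Lemma dot3E (x y : R3 R) : dot3 x y = x.1.1 * y.1.1 + x.1.2 * y.1.2 + x.2 * y.2.
Proof. by rewrite /dot3 sum3E. Qed.

Lemma dot3_ge0 (x : R3 R) : 0 <= dot3 x x.
Proof. by rewrite dot3E -!expr2 !addr_ge0// sqr_ge0. Qed.

Lemma len3_ge0 (x : R3 R) : 0 <= len3 x. Proof. exact: sqrtr_ge0. Qed.

Lemma len3_sqr (x : R3 R) : len3 x ^+ 2 = dot3 x x.
Proof. by rewrite sqr_sqrtr// dot3_ge0. Qed.

Lemma len3_le (x : R3 R) : len3 x <= `|x.1.1| + `|x.1.2| + `|x.2|.
Proof.
have h : 0 <= `|x.1.1| + `|x.1.2| + `|x.2| by rewrite !addr_ge0.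
rewrite -(ger0_norm h) -sqrtr_sqr ler_wsqrtr// dot3E -!expr2.
rewrite -(real_normK (num_real x.1.1)) -(real_normK (num_real x.1.2)).
rewrite -(real_normK (num_real x.2)).
have := normr_ge0 x.1.1; have := normr_ge0 x.1.2; have := normr_ge0 x.2.
by move: `|x.1.1| `|x.1.2| `|x.2| => a b c *; nra.
Qed.

(** Reduces directional derivatives in three variables to the one-variable calculus above. *)
Lemma der_line (phi : R3 R -> R) (x v : R3 R) (d : R) :
  is_derive (0 : R) 1 (fun h : R => phi (h *: v + x)) d -> is_derive x v phi d.
Proof.
have E : (fun h : R => h^-1 *: ((phi \o shift x) (h *: v) - phi x)) =
   (fun h : R => h^-1 *: (((fun h : R => phi (h *: v + x)) \o shift 0) (h *: 1) -
      (fun h : R => phi (h *: v + x)) 0)).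
  apply/funext => h /=; rewrite scale0r add0r addr0.
  by rewrite [h *: 1]mulr1.
case=> [D dE]; split; first by move: D; rewrite /derivable -E.
by rewrite -dE /derive -E.
Qed.

(** Test functions simple enough for derivatives and integrals to reduce to one variable, yet stable
    under derivation, multiplication by coordinates and the Fourier transform, and rich enough to
    contain all Gaussians [gauss3 a c]. *)
Inductive tensor_sum : (R3 R -> R) -> Prop :=
| tensor_sum1 f1 f2 f3 : schwartz1 f1 -> schwartz1 f2 -> schwartz1 f3 ->
    tensor_sum (fun x => f1 x.1.1 * f2 x.1.2 * f3 x.2)
| tensor_sumD phi psi : tensor_sum phi -> tensor_sum psi ->
    tensor_sum (fun x => phi x + psi x).

Lemma tensor_sum_der phi (v : R3 R) : tensor_sum phi ->
  exists phi', tensor_sum phi' /\ forall x : R3 R, is_derive x v phi (phi' x).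
Proof.
elim=> [f1 f2 f3 s1 s2 s3|{}phi psi _ [phi' [tp dp]] _ [psi' [tq dq]]]; last first.
  exists (fun x => phi' x + psi' x); split; first exact: tensor_sumD.
  by move=> x; exact: is_deriveD.
have [f1' [s1' d1]] := schwartz1_der s1.
have [f2' [s2' d2]] := schwartz1_der s2.
have [f3' [s3' d3]] := schwartz1_der s3.
exists (fun x => ((fun t => v.1.1 * f1' t) x.1.1 * f2 x.1.2 * f3 x.2 +
    f1 x.1.1 * (fun t => v.1.2 * f2' t) x.1.2 * f3 x.2) +
  f1 x.1.1 * f2 x.1.2 * (fun t => v.2 * f3' t) x.2); split.
  apply: tensor_sumD; first apply: tensor_sumD.
  - exact: (tensor_sum1 (schwartz1Z v.1.1 s1') s2 s3).
  - exact: (tensor_sum1 s1 (schwartz1Z v.1.2 s2') s3).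
  - exact: (tensor_sum1 s1 s2 (schwartz1Z v.2 s3')).
move=> x; apply: der_line.
have dl (f f' : R -> R) (w z : R) : (forall y : R, is_derive y 1 f (f' y)) ->
    is_derive (0 : R) 1 (fun h : R => f (h * w + z)) (w * f' z).
  move=> df.
  have -> : w * f' z = f' (0 * w + z) * w by rewrite mul0r add0r mulrC.
  apply: (is_der_comp (g := fun h : R => h * w + z) (df _)).
  have := is_der_add (is_der_mul (is_der_id 0) (is_der_cst w 0)) (is_der_cst z 0).
  by move=> h; apply: is_der_eq h _; ring.
have := is_der_mul (is_der_mul (dl _ _ v.1.1 x.1.1 d1) (dl _ _ v.1.2 x.1.2 d2)) (dl _ _ v.2 x.2 d3).
by move=> h; apply: is_der_eq h _; rewrite !mul0r !add0r; ring.
Qed.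

Lemma tensor_sum_continuous phi : tensor_sum phi -> continuous phi.
Proof.
elim=> [f1 f2 f3 s1 s2 s3|{}phi psi _ cphi _ cpsi] x; last first.
  by apply: (@cvgD _ _ _ _ _ phi psi); [exact: cphi|exact: cpsi].
apply: cvgM; first apply: cvgM.
- apply: (@continuous_comp _ _ _ (fun x : R3 R => x.1.1) f1); last exact: schwartz1_continuous.
  by apply: (@continuous_comp _ _ _ fst fst); exact: cvg_fst.
- apply: (@continuous_comp _ _ _ (fun x : R3 R => x.1.2) f2); last exact: schwartz1_continuous.
  by apply: (@continuous_comp _ _ _ fst snd); [exact: cvg_fst|exact: cvg_snd].
- apply: (@continuous_comp _ _ _ (fun x : R3 R => x.2) f3); last exact: schwartz1_continuous.
  exact: cvg_snd.
Qed.

Lemma schwartz1_bound f (n : nat) : schwartz1 f ->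
  exists C : R, forall t, (1 + `|t|) ^+ n * `|f t| <= C.
Proof.
elim: n f => [|n IHn] f sf.
  by have [C h] := schwartz1_decaying sf 0; exists C => t; have := h t; rewrite !expr0.
have [C hC] := IHn _ sf; have [D hD] := IHn _ (schwartz1X sf).
exists (C + D) => t; apply: le_trans (lerD (hC t) (hD t)).
by apply: eq_ler; rewrite exprSr normrM; ring.
Qed.

Lemma tensor_sum_bound phi (n : nat) : tensor_sum phi ->
  exists C : R, forall x, (1 + len3 x) ^+ n * `|phi x| <= C.
Proof.
elim=> [f1 f2 f3 s1 s2 s3|{}phi psi _ [C hC] _ [D hD]]; last first.
  exists (C + D) => x; apply: le_trans (lerD (hC x) (hD x)).
  by rewrite -mulrDr ler_wpM2l ?ler_normD// exprn_ge0// addr_ge0// len3_ge0.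
have [C1 h1] := schwartz1_bound n s1; have [C2 h2] := schwartz1_bound n s2.
have [C3 h3] := schwartz1_bound n s3.
exists (C1 * C2 * C3) => x; have lx := len3_le x.
apply: (@le_trans _ _ (((1 + `|x.1.1|) ^+ n * `|f1 x.1.1|) *
    ((1 + `|x.1.2|) ^+ n * `|f2 x.1.2|) * ((1 + `|x.2|) ^+ n * `|f3 x.2|))).
  rewrite !normrM [leRHS](_ : _ = ((1 + `|x.1.1|) * (1 + `|x.1.2|) * (1 + `|x.2|)) ^+ n *
     (`|f1 x.1.1| * `|f2 x.1.2| * `|f3 x.2|)); last by rewrite !exprMn; ring.
  rewrite ler_wpM2r ?mulr_ge0//; apply: lerXn2r; rewrite ?nnegrE.
  - by rewrite addr_ge0// len3_ge0.
  - by rewrite !mulr_ge0// addr_ge0.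
  have := normr_ge0 x.1.1; have := normr_ge0 x.1.2; have := normr_ge0 x.2.
  move: lx; move: `|x.1.1| `|x.1.2| `|x.2| => a b c lx c0 b0 a0.
  have := mulr_ge0 a0 b0; have := mulr_ge0 a0 c0; have := mulr_ge0 b0 c0.
  by have := mulr_ge0 (mulr_ge0 a0 b0) c0; nra.
have p (t : R) f : 0 <= (1 + `|t|) ^+ n * `|f t : R|.
  by rewrite mulr_ge0// exprn_ge0// addr_ge0.
by apply: ler_pM => //; apply: ler_pM.
Qed.

Lemma tensor_sum_schwartz phi : tensor_sum phi -> schwartz phi.
Proof.
move=> tphi l.
have : tensor_sum (partials l phi).
  elim: l => //= k l IHl.
  have [psi [tpsi dpsi]] := tensor_sum_der (dir3 k) IHl.
  suff -> : 'D_(dir3 k) (partials l phi) = psi by [].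
  by apply/funext => x; exact: (@derive_val _ _ _ _ _ _ _ (dpsi x)).
move=> tl; split.
- exact: tensor_sum_continuous.
- move=> k x; have [psi [_ dpsi]] := tensor_sum_der (dir3 k) tl.
  by have [] := dpsi x.
- by move=> n; exact: tensor_sum_bound.
Qed.

Lemma tensor_sum_derive phi (v : R3 R) : tensor_sum phi -> tensor_sum ('D_v phi).
Proof.
move=> tphi; have [psi [tpsi dpsi]] := tensor_sum_der v tphi.
suff -> : 'D_v phi = psi by [].
by apply/funext => x; exact: (@derive_val _ _ _ _ _ _ _ (dpsi x)).
Qed.

Lemma tensor_sumZ (k : R) phi : tensor_sum phi -> tensor_sum (fun x => k * phi x).
Proof.
elim=> [f1 f2 f3 s1 s2 s3|{}phi psi _ tp _ tq].
  rewrite (_ : (fun x => _) = fun x : R3 R => (fun t => k * f1 t) x.1.1 * f2 x.1.2 * f3 x.2).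
    exact: (tensor_sum1 (schwartz1Z k s1) s2 s3).
  by apply/funext => x; ring.
rewrite (_ : (fun x => _) = fun x : R3 R => k * phi x + k * psi x); first exact: tensor_sumD.
by apply/funext => x; rewrite mulrDr.
Qed.

Notation mR3f := (mR3 R -> R).

Lemma tensor_sum_integrable (phi : mR3f) : tensor_sum phi ->
  (leb3 R).-integrable setT (EFin \o phi).
Proof.
elim=> [f1 f2 f3 s1 s2 s3|{}phi psi _ Ip _ Iq]; last exact: integrable_funD.
by apply: integrable_tensor3; exact: schwartz1_integrable.
Qed.

Lemma tensor_sum_measurable (phi : mR3f) : tensor_sum phi -> measurable_fun setT phi.
Proof. by move=> /tensor_sum_integrable/integrable_measurable. Qed.

Lemma tensor_sum_bounded phi : tensor_sum phi -> exists C, forall x, `|phi x| <= C.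
Proof.
by move=> /(tensor_sum_bound 0)[C h]; exists C => x; have := h x; rewrite expr0 mul1r.
Qed.

Lemma tensor_sum_L2 (phi : mR3f) : tensor_sum phi -> phi \in Lfun (leb3 R) 2%:E.
Proof.
move=> tphi; apply: fun_L2; first exact: tensor_sum_measurable.
have [C hC] := tensor_sum_bounded tphi.
have := integrable_mul_bounded (tensor_sum_measurable tphi) hC (tensor_sum_integrable tphi).
by apply: eq_integrable => // x _; rewrite /= expr2.
Qed.

End Schwartz3.

Section MeasurePreserving.
Context d1 d2 (T1 : measurableType d1) (T2 : measurableType d2) (R : realType).
Variable m1 : {sigma_finite_measure set T1 -> \bar R}.
Variable m2 : {sigma_finite_measure set T2 -> \bar R}.

Lemma pushforward_prod (f : T1 -> T1) (g : T2 -> T2) :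
  measurable_fun setT f -> measurable_fun setT g ->
  (forall A, measurable A -> pushforward m1 f A = m1 A) ->
  (forall A, measurable A -> pushforward m2 g A = m2 A) ->
  forall X, measurable X ->
    pushforward (m1 \x m2)%E (fun z => (f z.1, g z.2)) X = (m1 \x m2)%E X.
Proof.
move=> mf mg pf pg X mX.
have mfg : measurable_fun setT (fun z : T1 * T2 => (f z.1, g z.2)).
  by apply: measurable_fun_pair; [exact: measurableT_comp|exact: measurableT_comp].
apply/esym/product_measure_unique => // A B mA mB.
rewrite -(pf _ mA) -(pg _ mB) /= /pushforward.
rewrite (_ : _ @^-1` _ = (f @^-1` A) `*` (g @^-1` B)) ?product_measure1E//.
- by rewrite -[_ @^-1` _]setTI; exact: mf.
- by rewrite -[_ @^-1` _]setTI; exact: mg.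
Qed.

End MeasurePreserving.

Lemma eq_ereal_le (R : realDomainType) (x y : \bar R) : x = y -> (x <= y)%E.
Proof. by move=> ->. Qed.

(** * Translation invariance and convolution *)

Section Translation.
Context {R : realType}.
Notation mu := (@lebesgue_measure R).

Let shift1 (a : R) (x : mR R) : mR R := x + a.

Let measurable_shift1 (a : R) : measurable_fun setT (shift1 a).
Proof. by apply: measurable_funD. Qed.

Let lebesgue_measure_shift1 (a : R) (A : set (mR R)) : measurable A ->
  pushforward mu (shift1 a) A = mu A.
Proof.
move=> mA; have ms := measurable_shift1 a.
apply/esym/lebesgue_measure_unique => //= _ [[x y]] _ <- /=.
rewrite /pushforward (_ : _ @^-1` _ = `](x - a), (y - a)]%classic).
  by rewrite !lebesgue_measure_itv/= !lte_fin ltrD2r; case: ifP => // _; rewrite -!EFinB; congr EFin; ring.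
by apply/seteqP; split => z /=; rewrite !in_itv/= /shift1 ltrBlDr lerBrDr.
Qed.

Definition shift3 (a : R3 R) (x : mR3 R) : mR3 R := ((x : R3 R) + a)%R.

Lemma measurable_shift3 (a : R3 R) : measurable_fun setT (shift3 a).
Proof.
have h : measurable_fun setT (fun z : mR R * mR R => (shift1 a.1.1 z.1, shift1 a.1.2 z.2)).
  by apply: measurable_fun_pair; exact: measurableT_comp.
apply: (measurable_fun_pair (f := fun x : mR3 R => (shift1 a.1.1 x.1.1, shift1 a.1.2 x.1.2))
  (g := fun x : mR3 R => shift1 a.2 x.2)).
  exact: (measurableT_comp h).
exact: measurableT_comp.
Qed.

Lemma leb3_shift (a : R3 R) (A : set (mR3 R)) : measurable A ->
  pushforward (leb3 R) (shift3 a) A = leb3 R A.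
Proof.
have h : measurable_fun setT (fun z : mR R * mR R => (shift1 a.1.1 z.1, shift1 a.1.2 z.2)).
  by apply: measurable_fun_pair; exact: measurableT_comp.
apply: (pushforward_prod (m1 := sigma_prod mu mu) (m2 := mu)
  (f := fun z : mR R * mR R => (shift1 a.1.1 z.1, shift1 a.1.2 z.2))
  (g := shift1 a.2) h (measurable_shift1 _) _ (@lebesgue_measure_shift1 _)).
apply: (pushforward_prod (m1 := mu) (m2 := mu) (f := shift1 a.1.1) (g := shift1 a.1.2)) => //.
- exact: lebesgue_measure_shift1.
- exact: lebesgue_measure_shift1.
Qed.

Lemma ge0_integral_shift3 (a : R3 R) (f : mR3 R -> \bar R) : measurable_fun setT f ->
  (forall x, (0 <= f x)%E) -> (\int[leb3 R]_x f (shift3 a x) = \int[leb3 R]_x f x)%E.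
Proof.
move=> mf f0; have ms := measurable_shift3 a.
rewrite [RHS](eq_measure_integral (pushforward (leb3 R) (shift3 a))); last first.
  by move=> A mA _; rewrite /= leb3_shift.
by rewrite ge0_integral_pushforward.
Qed.

Lemma integral_shift3 (a : R3 R) (f : mR3 R -> \bar R) : measurable_fun setT f ->
  (\int[leb3 R]_x f (shift3 a x) = \int[leb3 R]_x f x)%E.
Proof.
move=> mf; rewrite -[LHS]/(\int[leb3 R]_x (f \o shift3 a) x)%E.
rewrite integralE [RHS]integralE funepos_comp funeneg_comp /comp.
by rewrite ge0_integral_shift3 ?ge0_integral_shift3//;
  [exact: measurable_funeneg|exact: measurable_funepos].
Qed.

Lemma Rintegral_shift3 (a : R3 R) (f : mR3 R -> R) : measurable_fun setT f ->
  \int[leb3 R]_x f (shift3 a x) = \int[leb3 R]_x f x.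
Proof.
by move=> mf; congr fine; apply: (integral_shift3 a (f := EFin \o f)); exact/measurable_EFinP.
Qed.

Lemma measurable_add3 : measurable_fun setT
  (fun z : mR3 R * mR3 R => ((z.1 : R3 R) + z.2 : mR3 R)).
Proof.
have D (p q : mR3 R * mR3 R -> mR R) : measurable_fun setT p -> measurable_fun setT q ->
  measurable_fun setT (fun z => p z + q z : mR R) by exact: measurable_funD.
pose c1 := measurableT_comp (measurableT_comp measurable_fst measurable_fst).
have m11 := measurableT_comp (@measurable_fst _ _ (mR R) (mR R))
  (@measurable_fst _ _ (mR R * mR R)%type (mR R)).
have m12 := measurableT_comp (@measurable_snd _ _ (mR R) (mR R))
  (@measurable_fst _ _ (mR R * mR R)%type (mR R)).
have m2 := @measurable_snd _ _ (mR R * mR R)%type (mR R).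
have f1 := @measurable_fst _ _ (mR3 R) (mR3 R).
have f2 := @measurable_snd _ _ (mR3 R) (mR3 R).
apply: (measurable_fun_pair
  (f := fun z : mR3 R * mR3 R => (z.1.1.1 + z.2.1.1 : mR R, z.1.1.2 + z.2.1.2 : mR R))
  (g := fun z : mR3 R * mR3 R => (z.1.2 + z.2.2 : mR R))).
  apply: (measurable_fun_pair (f := fun z : mR3 R * mR3 R => (z.1.1.1 + z.2.1.1 : mR R))
    (g := fun z : mR3 R * mR3 R => (z.1.1.2 + z.2.1.2 : mR R))).
    by apply: D; [exact: (measurableT_comp m11 f1)|exact: (measurableT_comp m11 f2)].
  by apply: D; [exact: (measurableT_comp m12 f1)|exact: (measurableT_comp m12 f2)].
by apply: D; [exact: (measurableT_comp m2 f1)|exact: (measurableT_comp m2 f2)].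
Qed.

Lemma measurable_opp3 : measurable_fun setT (fun z : mR3 R => (- (z : R3 R) : mR3 R)).
Proof.
have D (p : mR3 R -> mR R) : measurable_fun setT p ->
  measurable_fun setT (fun z => - p z : mR R) by move=> mp; apply: measurableT_comp.
apply: (measurable_fun_pair
  (f := fun z : mR3 R => (- z.1.1 : mR R, - z.1.2 : mR R))
  (g := fun z : mR3 R => (- z.2 : mR R))).
  apply: (measurable_fun_pair (f := fun z : mR3 R => (- z.1.1 : mR R))
    (g := fun z : mR3 R => (- z.1.2 : mR R))).
    by apply: D; exact: (measurableT_comp measurable_fst measurable_fst).
  by apply: D; exact: (measurableT_comp measurable_snd measurable_fst).
by apply: D; exact: measurable_snd.
Qed.

Let shear (z : mR3 R * mR3 R) : mR3 R * mR3 R :=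
  (((z.1 : R3 R) - (z.2 : R3 R) : mR3 R), z.2).

Let measurable_shear : measurable_fun setT shear.
Proof.
apply: measurable_fun_pair; last exact: measurable_snd.
have h : measurable_fun setT (fun z : mR3 R * mR3 R => (z.1, - (z.2 : R3 R) : mR3 R)).
  apply: measurable_fun_pair; first exact: measurable_fst.
  exact: (measurableT_comp measurable_opp3 measurable_snd).
exact: (measurableT_comp measurable_add3 h).
Qed.

Let shearK x y : shear (shift3 y x, y) = (x, y).
Proof. by rewrite /shear /shift3 /= addrK. Qed.

Lemma ge0_integral_shear (f : mR3 R * mR3 R -> \bar R) : measurable_fun setT f ->
  (forall z, (0 <= f z)%E) -> (\int[leb6]_z f (shear z) = \int[leb6]_z f z)%E.
Proof.
move=> mf f0; have mfs := measurableT_comp mf measurable_shear.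
rewrite tonelli6_2// [RHS]tonelli6_2//; apply: eq_integral => y _.
rewrite -(ge0_integral_shift3 y (f := fun x => f (shear (x, y))))//.
  by apply: eq_integral => x _; rewrite shearK.
exact: (measurable_fun_pair1 (f := f \o shear)).
Qed.

(** W z is the integral of K (z - y, y) in y, that is, the density of the image of K under (x, y) ->
    x + y; for K (x, y) = p x q y it is the convolution. The norm bound is Young's inequality, and
    the duality with bounded [b] is how W is recognised later. *)
Lemma convolution_L1 (K : mR3 R * mR3 R -> R) : leb6.-integrable setT (EFin \o K) ->
  exists W : mR3 R -> R, [/\ (leb3 R).-integrable setT (EFin \o W),
    (\int[leb3 R]_z `|W z|%:E <= \int[leb6]_z `|K z|%:E)%E &
    forall (b : mR3 R -> R) (C : R), measurable_fun setT b -> (forall x, `|b x| <= C) ->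
      \int[leb3 R]_z (W z * b z) = \int[leb6]_z (K z * b ((z.1 : R3 R) + z.2))].
Proof.
move=> IK; have mK := integrable_measurable IK.
pose S z := K (shear z).
have mS : measurable_fun setT S := measurableT_comp mK measurable_shear.
have IS : leb6.-integrable setT (EFin \o S).
  apply/integrableP; split; first exact/measurable_EFinP.
  rewrite (ge0_integral_shear (f := fun z => `|(K z)%:E|%E))//.
    by have /integrableP[] := IK.
  by apply: measurableT_comp => //; exact/measurable_EFinP.
pose F z := (\int[leb3 R]_y (S (z, y))%:E)%E.
have IF : (leb3 R).-integrable setT F.
  exact: (integrable_fubini_F (m1 := sigma_prod (sigma_prod mu mu) mu)
    (m2 := sigma_prod (sigma_prod mu mu) mu) IS).
pose W z := fine (F z).
have mW : measurable_fun setT W.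
  by apply: measurableT_comp => //; exact: measurable_int IF.
have aeF : {ae leb3 R, forall z, F z = (W z)%:E}.
  have := integrable_ae measurableT IF; apply: filterS => z /(_ I) Fz.
  by rewrite /W fineK.
have IW : (leb3 R).-integrable setT (EFin \o W).
  apply/integrableP; split; first exact/measurable_EFinP.
  have /integrableP[mF FY] := IF; apply: le_lt_trans FY.
  apply: (@eq_ereal_le _); apply: ae_eq_integral => //.
  - by apply: measurableT_comp => //; exact/measurable_EFinP.
  - exact: measurableT_comp.
  - by apply: filterS aeF => z -> _.
exists W; split => //.
- rewrite -(ge0_integral_shear (f := fun z => `|K z|%:E))//; last first.
    by apply/measurable_EFinP; exact: measurableT_comp.
  rewrite tonelli6_1//; last by apply/measurable_EFinP; exact: measurableT_comp.
  rewrite (ae_eq_integral (fun z => `|F z|)%E) //; last 3 first.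
  - by apply/measurable_EFinP; exact: measurableT_comp.
  - by apply: measurableT_comp => //; exact: measurable_int IF.
  - by apply: filterS aeF => z -> _.
  apply: ge0_le_integral => //.
  - by apply: measurableT_comp => //; exact: measurable_int IF.
  - apply: (measurable_fun_fubini_tonelli_F (m2 := sigma_prod (sigma_prod mu mu) mu)
      (fun z => `|S z|%:E)) => //.
    by apply/measurable_EFinP; exact: measurableT_comp.
  - move=> z _; apply: le_trans (le_abse_integral _ _ _) _ => //.
    by apply/measurable_EFinP; exact: measurable_fun_pair2.
move=> b C mb bC.
have mb6 : measurable_fun setT (fun z : mR3 R * mR3 R => b ((z.1 : R3 R) + z.2)).
  exact: (measurableT_comp mb measurable_add3).
have IKb : leb6.-integrable setT (EFin \o (fun z => K z * b ((z.1 : R3 R) + z.2))).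
  by apply: (integrable_mul_bounded (C := C)) IK => // z.
have ISb : leb6.-integrable setT (EFin \o (fun z => S z * b z.1)).
  apply: (integrable_mul_bounded (C := C)) IS => //.
  exact: (measurableT_comp mb measurable_fst).
transitivity (\int[leb6]_z (S z * b z.1)).
  rewrite Rfubini6_1//; apply: Rintegral_ae_eq => //.
  - exact: measurable_funM.
  - rewrite /Rintegral; apply: measurableT_comp => //.
    exact: (measurable_fubini_F (m1 := sigma_prod (sigma_prod mu mu) mu)
      (m2 := sigma_prod (sigma_prod mu mu) mu) ISb).
  - have := ae_integrable1 (m1 := sigma_prod (sigma_prod mu mu) mu)
      (m2 := sigma_prod (sigma_prod mu mu) mu) IS.
    by apply: filterS => z Sz; exact/esym/(RintegralZr (b z) measurableT Sz).
rewrite Rfubini6_2// Rfubini6_2//; apply: eq_Rintegral => y _ /=.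
rewrite -(Rintegral_shift3 y (f := fun x => S (x, y) * b x)); last first.
  apply: measurable_funM => //.
  exact: measurable_fun_pair1.
by apply: eq_Rintegral => x _; rewrite /S shearK.
Qed.

End Translation.

(** * Transforms in three variables *)

Section Fourier3.
Context {R : realType}.
Notation mu := (@lebesgue_measure R).

Definition cosT3 (phi : R3 R -> R) (x : R3 R) : R :=
  \int[leb3 R]_y (phi y * cos (dot3 y x)).
Definition sinT3 (phi : R3 R -> R) (x : R3 R) : R :=
  \int[leb3 R]_y (phi y * sin (dot3 y x)).

Lemma dot3C (x y : R3 R) : dot3 x y = dot3 y x.
Proof. by apply: eq_bigr => i _; rewrite mulrC. Qed.

Lemma dot3Dl (x y z : R3 R) : dot3 (x + y) z = dot3 x z + dot3 y z.
Proof. by rewrite !dot3E /=; ring. Qed.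

Lemma dot3Nl (x z : R3 R) : dot3 (- x) z = - dot3 x z.
Proof. by rewrite !dot3E /=; ring. Qed.

Lemma dot3Bl (x y z : R3 R) : dot3 (x - y) z = dot3 x z - dot3 y z.
Proof. by rewrite dot3Dl dot3Nl. Qed.

Lemma dot3_dir3 (y : R3 R) (k : 'I_3) : dot3 y (dir3 k) = coord3 y k.
Proof.
rewrite dot3E /=.
case: k => -[|[|[|//]]] i; rewrite ?eqxx /= !(mulr1, mulr0, addr0, add0r) /coord3;
  by rewrite (tnth_nth 0).
Qed.

Let mfst1 := measurableT_comp (@measurable_fst _ _ (mR R) (mR R))
  (@measurable_fst _ _ (mR R * mR R)%type (mR R)).
Let msnd1 := measurableT_comp (@measurable_snd _ _ (mR R) (mR R))
  (@measurable_fst _ _ (mR R * mR R)%type (mR R)).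
Let msnd := @measurable_snd _ _ (mR R * mR R)%type (mR R).

Lemma measurable_coord3 (k : 'I_3) : measurable_fun setT (fun y : mR3 R => coord3 y k).
Proof.
case: k => -[|[|[|//]]] i.
- by rewrite (_ : (fun _ => _) = fun y : mR3 R => y.1.1)//; apply/funext => y; rewrite /coord3 (tnth_nth 0).
- by rewrite (_ : (fun _ => _) = fun y : mR3 R => y.1.2)//; apply/funext => y; rewrite /coord3 (tnth_nth 0).
- by rewrite (_ : (fun _ => _) = fun y : mR3 R => y.2)//; apply/funext => y; rewrite /coord3 (tnth_nth 0).
Qed.

Lemma measurable_dot3 : measurable_fun setT (fun z : mR3 R * mR3 R => dot3 z.1 z.2).
Proof.
rewrite (_ : (fun _ => _) = (fun z : mR3 R * mR3 R => z.1.1.1 * z.2.1.1 + z.1.1.2 * z.2.1.2 + z.1.2 * z.2.2)); last first.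
  by apply/funext => z; rewrite dot3E.
have f1 := @measurable_fst _ _ (mR3 R) (mR3 R).
have f2 := @measurable_snd _ _ (mR3 R) (mR3 R).
apply: measurable_funD; [apply: measurable_funD|]; apply: measurable_funM.
- exact: (measurableT_comp mfst1 f1).
- exact: (measurableT_comp mfst1 f2).
- exact: (measurableT_comp msnd1 f1).
- exact: (measurableT_comp msnd1 f2).
- exact: (measurableT_comp msnd f1).
- exact: (measurableT_comp msnd f2).
Qed.

Lemma measurable_dot3l (x : R3 R) : measurable_fun setT (fun y : mR3 R => dot3 y x).
Proof. exact: (measurable_fun_pair1 (x : mR3 R) measurable_dot3). Qed.

Lemma measurable_cosR : measurable_fun setT (@cos R).
Proof. by apply: measurable_cont; exact: continuous_cos. Qed.

Lemma measurable_sinR : measurable_fun setT (@sin R).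
Proof. by apply: measurable_cont; exact: continuous_sin. Qed.

Lemma integrable_cosM3 (phi : mR3 R -> R) (x : R3 R) :
  (leb3 R).-integrable setT (EFin \o phi) ->
  (leb3 R).-integrable setT (EFin \o (fun y => phi y * cos (dot3 y x))).
Proof.
apply: (integrable_mul_bounded (C := 1)); last by move=> y; exact: cos_max.
exact: (measurableT_comp measurable_cosR (measurable_dot3l x)).
Qed.

Lemma integrable_sinM3 (phi : mR3 R -> R) (x : R3 R) :
  (leb3 R).-integrable setT (EFin \o phi) ->
  (leb3 R).-integrable setT (EFin \o (fun y => phi y * sin (dot3 y x))).
Proof.
apply: (integrable_mul_bounded (C := 1)); last by move=> y; exact: sin_max.
exact: (measurableT_comp measurable_sinR (measurable_dot3l x)).
Qed.

Lemma tensor_sum_ext (phi psi : R3 R -> R) :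
  phi =1 psi -> tensor_sum phi -> tensor_sum psi.
Proof. by move=> /funext ->. Qed.

Lemma tensor_sumX (k : 'I_3) phi : tensor_sum phi ->
  tensor_sum (fun x : R3 R => coord3 x k * phi x).
Proof.
elim=> [f1 f2 f3 s1 s2 s3|{}phi psi _ tp _ tq].
  case: k => -[|[|[|//]]] i.
  - apply: tensor_sum_ext (tensor_sum1 (schwartz1X s1) s2 s3) => x.
    by rewrite /coord3 (tnth_nth 0)/=; ring.
  - apply: tensor_sum_ext (tensor_sum1 s1 (schwartz1X s2) s3) => x.
    by rewrite /coord3 (tnth_nth 0)/=; ring.
  - apply: tensor_sum_ext (tensor_sum1 s1 s2 (schwartz1X s3)) => x.
    by rewrite /coord3 (tnth_nth 0)/=; ring.
rewrite (_ : (fun x => _) = fun x : R3 R => coord3 x k * phi x + coord3 x k * psi x).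
  exact: tensor_sumD.
by apply/funext => x; rewrite mulrDr.
Qed.

Lemma der_cosT3 phi (k : 'I_3) (x : R3 R) : tensor_sum phi ->
  is_derive x (dir3 k) (cosT3 phi) (- sinT3 (fun y => coord3 y k * phi y) x).
Proof.
move=> tphi; apply: der_line.
have Ip := tensor_sum_integrable tphi.
have IX := tensor_sum_integrable (tensor_sumX k tphi).
have -> : - sinT3 (fun y => coord3 y k * phi y) x =
    \int[leb3 R]_y (- (coord3 y k * phi y * sin (dot3 y (0 *: dir3 k + x)))).
  rewrite scale0r add0r -mulN1r /sinT3 -RintegralZl//; last exact: integrable_sinM3.
  by apply: eq_Rintegral => y _; rewrite mulN1r.
apply: (@der_under_integral _ _ _ (leb3 R)
  (fun h y => phi y * cos (dot3 y (h *: dir3 k + x)))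
  (fun h y => - (coord3 y k * phi y * sin (dot3 y (h *: dir3 k + x))))
  (fun y => `|coord3 y k * phi y|)).
- by move=> h; exact: integrable_cosM3.
- move=> h y.
  have dl : is_derive h 1 (fun z : R => dot3 y (z *: dir3 k + x)) (coord3 y k).
    have := is_der_add (is_der_scale (coord3 y k) (is_der_id h)) (is_der_cst (dot3 y x) h).
    rewrite mulr1 addr0 (_ : (fun z : R => _) = (fun z : R => dot3 y (z *: dir3 k + x)))//.
    by apply/funext => z; rewrite -dot3_dir3 !dot3E /=; rewrite /GRing.scale/=; ring.
  have := is_der_scale (phi y) (is_der_comp (is_derive_cos _) dl).
  by move=> h1; apply: is_der_eq h1 _; ring.
- exact: integrable_funn.
- by move=> h y; rewrite normrN normrM ler_piMr// sin_max.
Qed.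

Lemma der_sinT3 phi (k : 'I_3) (x : R3 R) : tensor_sum phi ->
  is_derive x (dir3 k) (sinT3 phi) (cosT3 (fun y => coord3 y k * phi y) x).
Proof.
move=> tphi; apply: der_line.
have Ip := tensor_sum_integrable tphi.
have IX := tensor_sum_integrable (tensor_sumX k tphi).
have -> : cosT3 (fun y => coord3 y k * phi y) x =
    \int[leb3 R]_y (coord3 y k * phi y * cos (dot3 y (0 *: dir3 k + x))).
  by rewrite scale0r add0r.
apply: (@der_under_integral _ _ _ (leb3 R)
  (fun h y => phi y * sin (dot3 y (h *: dir3 k + x)))
  (fun h y => (coord3 y k * phi y * cos (dot3 y (h *: dir3 k + x))))
  (fun y => `|coord3 y k * phi y|)).
- by move=> h; exact: integrable_sinM3.
- move=> h y.
  have dl : is_derive h 1 (fun z : R => dot3 y (z *: dir3 k + x)) (coord3 y k).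
    have := is_der_add (is_der_scale (coord3 y k) (is_der_id h)) (is_der_cst (dot3 y x) h).
    rewrite mulr1 addr0 (_ : (fun z : R => _) = (fun z : R => dot3 y (z *: dir3 k + x)))//.
    by apply/funext => z; rewrite -dot3_dir3 !dot3E /=; rewrite /GRing.scale/=; ring.
  have := is_der_scale (phi y) (is_der_comp (is_derive_sin _) dl).
  by move=> h1; apply: is_der_eq h1 _; ring.
- exact: integrable_funn.
- by move=> h y; rewrite normrM ler_piMr// cos_max.
Qed.

(** The addition formulas expand the cosine and sine of a sum of three phases into products, and
    each product integrates as a tensor product. *)
Lemma trigT3_tensor f1 f2 f3 (x : R3 R) :
  schwartz1 f1 -> schwartz1 f2 -> schwartz1 f3 ->
  let c1 := cosT f1 x.1.1 in let s1 := sinT f1 x.1.1 in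
  let c2 := cosT f2 x.1.2 in let s2 := sinT f2 x.1.2 in
  let c3 := cosT f3 x.2 in let s3 := sinT f3 x.2 in
  cosT3 (fun y => f1 y.1.1 * f2 y.1.2 * f3 y.2) x =
    c1 * c2 * c3 - c1 * s2 * s3 - s1 * c2 * s3 - s1 * s2 * c3 /\
  sinT3 (fun y => f1 y.1.1 * f2 y.1.2 * f3 y.2) x =
    s1 * c2 * c3 + c1 * s2 * c3 + c1 * c2 * s3 - s1 * s2 * s3.
Proof.
move=> S1 S2 S3 c1 s1 c2 s2 c3 s3.
have I1 := schwartz1_integrable S1; have I2 := schwartz1_integrable S2.
have I3 := schwartz1_integrable S3.
have C1 := integrable_cosM x.1.1 I1; have N1 := integrable_sinM x.1.1 I1.
have C2 := integrable_cosM x.1.2 I2; have N2 := integrable_sinM x.1.2 I2.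
have C3 := integrable_cosM x.2 I3; have N3 := integrable_sinM x.2 I3.
have T (g1 g2 g3 : R -> R) := @integrable_tensor3 R g1 g2 g3.
have E (g1 g2 g3 : R -> R) := @Rintegral_tensor3 R g1 g2 g3.
split.
- rewrite /c1 /s1 /c2 /s2 /c3 /s3 /cosT /sinT -!E// /cosT3.
  have J1 := integrable_funB (T _ _ _ C1 C2 C3) (T _ _ _ C1 N2 N3).
  have J2 := integrable_funB J1 (T _ _ _ N1 C2 N3).
  rewrite -(RintegralB measurableT (T _ _ _ C1 C2 C3) (T _ _ _ C1 N2 N3)).
  rewrite -(RintegralB measurableT J1 (T _ _ _ N1 C2 N3)).
  rewrite -(RintegralB measurableT J2 (T _ _ _ N1 N2 C3)).
  apply: eq_Rintegral => y _; rewrite dot3E !(cosD, sinD).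
  by rewrite (mulrC x.1.1) (mulrC x.1.2) (mulrC x.2); ring.
- rewrite /c1 /s1 /c2 /s2 /c3 /s3 /cosT /sinT -!E// /sinT3.
  have J1 := integrable_funD (T _ _ _ N1 C2 C3) (T _ _ _ C1 N2 C3).
  have J2 := integrable_funD J1 (T _ _ _ C1 C2 N3).
  rewrite -(RintegralD measurableT (T _ _ _ N1 C2 C3) (T _ _ _ C1 N2 C3)).
  rewrite -(RintegralD measurableT J1 (T _ _ _ C1 C2 N3)).
  rewrite -(RintegralB measurableT J2 (T _ _ _ N1 N2 N3)).
  apply: eq_Rintegral => y _; rewrite dot3E !(cosD, sinD).
  by rewrite (mulrC x.1.1) (mulrC x.1.2) (mulrC x.2); ring.
Qed.

Lemma cosT3D phi psi : tensor_sum phi -> tensor_sum psi ->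
  cosT3 (fun x => phi x + psi x) = fun x => cosT3 phi x + cosT3 psi x.
Proof.
move=> tp tq; apply/funext => x; rewrite /cosT3 -RintegralD//.
- by apply: eq_Rintegral => y _; rewrite mulrDl.
- exact/integrable_cosM3/tensor_sum_integrable.
- exact/integrable_cosM3/tensor_sum_integrable.
Qed.

Lemma sinT3D phi psi : tensor_sum phi -> tensor_sum psi ->
  sinT3 (fun x => phi x + psi x) = fun x => sinT3 phi x + sinT3 psi x.
Proof.
move=> tp tq; apply/funext => x; rewrite /sinT3 -RintegralD//.
- by apply: eq_Rintegral => y _; rewrite mulrDl.
- exact/integrable_sinM3/tensor_sum_integrable.
- exact/integrable_sinM3/tensor_sum_integrable.
Qed.

Lemma tensor_sumN phi : tensor_sum phi -> tensor_sum (fun x : R3 R => - phi x).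
Proof.
move=> /(tensor_sumZ (-1)); rewrite (_ : (fun x => _) = (fun x => - phi x))//.
by apply/funext => x; rewrite mulN1r.
Qed.

Lemma tensor_sum_cosT3 phi : tensor_sum phi -> tensor_sum (cosT3 phi).
Proof.
elim=> [f1 f2 f3 s1 s2 s3|{}phi psi tp IHp tq IHq]; last first.
  by rewrite cosT3D//; exact: tensor_sumD.
rewrite (_ : cosT3 _ = fun x => cosT f1 x.1.1 * cosT f2 x.1.2 * cosT f3 x.2 +
  - (cosT f1 x.1.1 * sinT f2 x.1.2 * sinT f3 x.2) +
  - (sinT f1 x.1.1 * cosT f2 x.1.2 * sinT f3 x.2) +
  - (sinT f1 x.1.1 * sinT f2 x.1.2 * cosT f3 x.2)); last first.
  by apply/funext => x; have [-> _] := trigT3_tensor x s1 s2 s3.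
have C := schwartz1_cosT; have N := schwartz1_sinT.
do !apply: tensor_sumD.
- exact: tensor_sum1 (C _ _ s1) (C _ _ s2) (C _ _ s3).
- exact: tensor_sumN (tensor_sum1 (C _ _ s1) (N _ _ s2) (N _ _ s3)).
- exact: tensor_sumN (tensor_sum1 (N _ _ s1) (C _ _ s2) (N _ _ s3)).
- exact: tensor_sumN (tensor_sum1 (N _ _ s1) (N _ _ s2) (C _ _ s3)).
Qed.

Lemma tensor_sum_sinT3 phi : tensor_sum phi -> tensor_sum (sinT3 phi).
Proof.
elim=> [f1 f2 f3 s1 s2 s3|{}phi psi tp IHp tq IHq]; last first.
  by rewrite sinT3D//; exact: tensor_sumD.
rewrite (_ : sinT3 _ = fun x => sinT f1 x.1.1 * cosT f2 x.1.2 * cosT f3 x.2 +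
  cosT f1 x.1.1 * sinT f2 x.1.2 * cosT f3 x.2 +
  cosT f1 x.1.1 * cosT f2 x.1.2 * sinT f3 x.2 +
  - (sinT f1 x.1.1 * sinT f2 x.1.2 * sinT f3 x.2)); last first.
  by apply/funext => x; have [_ ->] := trigT3_tensor x s1 s2 s3.
have C := schwartz1_cosT; have N := schwartz1_sinT.
do !apply: tensor_sumD.
- exact: tensor_sum1 (N _ _ s1) (C _ _ s2) (C _ _ s3).
- exact: tensor_sum1 (C _ _ s1) (N _ _ s2) (C _ _ s3).
- exact: tensor_sum1 (C _ _ s1) (C _ _ s2) (N _ _ s3).
- exact: tensor_sumN (tensor_sum1 (N _ _ s1) (N _ _ s2) (N _ _ s3)).
Qed.

Lemma tensor_sum_gauss3 a c : pos3 a -> tensor_sum (gauss3 a c : R3 R -> R).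
Proof.
by move=> [a1 a2 a3]; exact: (tensor_sum1 (schwartz1_gauss c.1.1 a1)
  (schwartz1_gauss c.1.2 a2) (schwartz1_gauss c.2 a3)).
Qed.

(** Parameters of the transformed Gaussian: exp (- a x^2) has a transform proportional to exp (- x^2
    / (4 a)). *)
Definition dual3 (a : R3 R) : R3 R := ((4 * a.1.1)^-1, (4 * a.1.2)^-1, (4 * a.2)^-1).

Definition gauss_mass3 (a : R3 R) : R :=
  gauss_mass a.1.1 * gauss_mass a.1.2 * gauss_mass a.2.

Lemma dual3_pos a : pos3 a -> pos3 (dual3 a).
Proof. by move=> [a1 a2 a3]; split; rewrite /= invr_gt0 mulr_gt0. Qed.

Lemma dual3K a : pos3 a -> dual3 (dual3 a) = a.
Proof.
case: a => [[x y] z] [/= x0 y0 z0]; rewrite /dual3/=.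
by congr (_, _, _); field; rewrite gt_eqF.
Qed.

Lemma trigT3_gauss3 a c (x : R3 R) : pos3 a ->
  cosT3 (gauss3 a c) x = gauss_mass3 a * cos (dot3 c x) * gauss3 (dual3 a) 0 x /\
  sinT3 (gauss3 a c) x = gauss_mass3 a * sin (dot3 c x) * gauss3 (dual3 a) 0 x.
Proof.
move=> [a1 a2 a3].
have := trigT3_tensor x (schwartz1_gauss c.1.1 a1) (schwartz1_gauss c.1.2 a2) (schwartz1_gauss c.2 a3).
cbv zeta.
have [-> ->] := trigT_gauss c.1.1 x.1.1 a1.
have [-> ->] := trigT_gauss c.1.2 x.1.2 a2.
have [-> ->] := trigT_gauss c.2 x.2 a3.
have G b t : expR (- (t ^+ 2 / (4 * b))) = gauss (4 * b)^-1 0 t.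
  by rewrite /gauss subr0 mulrC.
rewrite !G => -[hc hs]; split.
- rewrite [LHS]hc /gauss_mass3 /gauss3 /dual3/= dot3E !(cosD, sinD); ring.
- rewrite [LHS]hs /gauss_mass3 /gauss3 /dual3/= dot3E !(cosD, sinD); ring.
Qed.

(** Each coordinate contributes sqrt (pi / b) sqrt (4 pi b) = 2 pi. This is the origin of the factor
    in the inversion formula. *)
Lemma gauss_mass3_dual a : pos3 a ->
  gauss_mass3 a * gauss_mass3 (dual3 a) = (2 * pi) ^+ 3.
Proof.
have h (b : R) : 0 < b -> gauss_mass b * gauss_mass (4 * b)^-1 = 2 * pi.
  move=> b0; have p0 := pi_gt0 R.
  rewrite /gauss_mass -sqrtrM; last by apply: divr_ge0; exact: ltW.
  rewrite (_ : pi / b * (pi / (4 * b)^-1) = (2 * pi) ^+ 2); last by field; rewrite gt_eqF.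
  by rewrite sqrtr_sqr ger0_norm// mulr_ge0//; exact: ltW.
move=> [a1 a2 a3]; rewrite /gauss_mass3 /dual3/=.
rewrite [LHS](_ : _ = (gauss_mass a.1.1 * gauss_mass (4 * a.1.1)^-1) *
  (gauss_mass a.1.2 * gauss_mass (4 * a.1.2)^-1) *
  (gauss_mass a.2 * gauss_mass (4 * a.2)^-1)); last by ring.
by rewrite !h//; ring.
Qed.

End Fourier3.

Lemma Rintegral_funN d (T : measurableType d) (R : realType)
    (mu : {measure set T -> \bar R}) (f : T -> R) :
  mu.-integrable setT (EFin \o f) -> \int[mu]_x (- f x) = - \int[mu]_x f x.
Proof.
move=> If; rewrite -mulN1r -(RintegralZl _ measurableT If).
by apply: eq_Rintegral => x _; rewrite mulN1r.
Qed.

(** * The Fourier transform in the sense of distributions *)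

Section WeakFourier.
Context {R : realType}.
Implicit Types (f p q : mR3 R -> R).

(** Covers L1, L2 and bounded functions and is stable under multiplication by coordinates. Symbols
    such as xi_k f^ of derivatives stay in this class even when they leave those spaces. *)
Definition tempered p := measurable_fun setT p /\
  forall phi : mR3 R -> R, tensor_sum phi ->
    (leb3 R).-integrable setT (EFin \o (fun x => p x * phi x)).

(* [p + i q] is the Fourier transform of the real function [f], tested only on
   sums of tensor products of one-variable Schwartz functions. *)
Definition weakF f p q := forall phi, tensor_sum phi ->
  \int[leb3 R]_y (p y * phi y) = \int[leb3 R]_x (f x * cosT3 phi x) /\
  \int[leb3 R]_y (q y * phi y) = - \int[leb3 R]_x (f x * sinT3 phi x).

Lemma tempered_L2 p : p \in Lfun (leb3 R) 2%:E -> tempered p.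
Proof.
move=> p2; split; first exact: Lfun_measurable p2.
by move=> phi tphi; apply: integrable_L2M => //; exact: tensor_sum_L2.
Qed.

Lemma tempered_L1 p : (leb3 R).-integrable setT (EFin \o p) -> tempered p.
Proof.
move=> Ip; split; first exact: integrable_measurable Ip.
move=> phi tphi; have [C hC] := tensor_sum_bounded tphi.
exact: integrable_mul_bounded (tensor_sum_measurable tphi) hC Ip.
Qed.

Lemma tempered_bounded p (C : R) : measurable_fun setT p -> (forall x, `|p x| <= C) ->
  tempered p.
Proof.
move=> mp pC; split => // phi tphi.
have := integrable_mul_bounded mp pC (tensor_sum_integrable tphi).
by apply: eq_integrable => // x _; rewrite /= mulrC.
Qed.

Lemma temperedZ (k : R) p : tempered p -> tempered (fun x => k * p x).
Proof.
move=> [mp tp]; split; first exact: measurable_funM.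
move=> phi tphi; have := integrable_funZ k (tp _ tphi).
by apply: eq_integrable => // x _; rewrite /= mulrA.
Qed.

Lemma temperedD p q : tempered p -> tempered q -> tempered (fun x => p x + q x).
Proof.
move=> [mp tp] [mq tq]; split; first exact: measurable_funD.
move=> phi tphi; have := integrable_funD (tp _ tphi) (tq _ tphi).
by apply: eq_integrable => // x _; rewrite /= mulrDl.
Qed.

Lemma temperedN p : tempered p -> tempered (fun x => - p x).
Proof.
move=> /(temperedZ (-1)); rewrite (_ : (fun x => _) = (fun x => - p x))//.
by apply/funext => x; rewrite mulN1r.
Qed.

Lemma temperedB p q : tempered p -> tempered q -> tempered (fun x => p x - q x).
Proof. by move=> tp tq; apply: temperedD => //; exact: temperedN. Qed.

Lemma temperedX (k : 'I_3) p : tempered p -> tempered (fun x => coord3 x k * p x).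
Proof.
move=> [mp tp]; split; first by apply: measurable_funM => //; exact: measurable_coord3.
move=> phi tphi; have := tp _ (tensor_sumX k tphi).
by apply: eq_integrable => // x _; rewrite /=; congr EFin; ring.
Qed.

Lemma tempered_sum3 (p : 'I_3 -> mR3 R -> R) : (forall k, tempered (p k)) ->
  tempered (fun x => \sum_(k < 3) p k x).
Proof.
move=> tp; rewrite (_ : (fun x => _) = fun x => p 0 x + p 1 x + p 2 x).
  by do !apply: temperedD.
by apply/funext => x; rewrite sum3E.
Qed.

Lemma tempered_gauss0 p : tempered p ->
  (forall a c, pos3 a -> \int[leb3 R]_x (p x * gauss3 a c x) = 0) ->
  {ae leb3 R, forall x, p x = 0}.
Proof.
move=> [mp tp] h; apply: gauss3_ae0 => // a c a0; split; last exact: h.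
exact: tp (tensor_sum_gauss3 c a0).
Qed.

Lemma tempered_gauss_eq p q : tempered p -> tempered q ->
  (forall a c, pos3 a -> \int[leb3 R]_x (p x * gauss3 a c x) =
    \int[leb3 R]_x (q x * gauss3 a c x)) ->
  {ae leb3 R, forall x, p x = q x}.
Proof.
move=> tp tq h; have := tempered_gauss0 (temperedB tp tq).
have h0 a c : pos3 a -> \int[leb3 R]_x ((p x - q x) * gauss3 a c x) = 0.
  move=> a0; have tg := tensor_sum_gauss3 c a0.
  rewrite (_ : (fun x => _) = fun x => p x * gauss3 a c x - q x * gauss3 a c x).
    by rewrite (RintegralB measurableT (tp.2 _ tg) (tq.2 _ tg)) h// subrr.
  by apply/funext => x; rewrite mulrBl.
by move=> /(_ h0); apply: filterS => x /eqP; rewrite subr_eq0 => /eqP.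
Qed.

Lemma weakF_unique f p q p' q' :
  tempered p -> tempered q -> tempered p' -> tempered q' ->
  weakF f p q -> weakF f p' q' ->
  {ae leb3 R, forall x, p x = p' x /\ q x = q' x}.
Proof.
move=> tp tq tp' tq' w w'.
have hp : {ae leb3 R, forall x, p x = p' x}.
  apply: tempered_gauss_eq => // a c a0; have tg := tensor_sum_gauss3 c a0.
  by rewrite (w _ tg).1 (w' _ tg).1.
have hq : {ae leb3 R, forall x, q x = q' x}.
  apply: tempered_gauss_eq => // a c a0; have tg := tensor_sum_gauss3 c a0.
  by rewrite (w _ tg).2 (w' _ tg).2.
by apply: filterS2 hp hq.
Qed.

Lemma weakF_lin f f' p p' q q' (k k' : R) :
  f \in Lfun (leb3 R) 2%:E -> f' \in Lfun (leb3 R) 2%:E ->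
  tempered p -> tempered p' -> tempered q -> tempered q' ->
  weakF f p q -> weakF f' p' q' ->
  weakF (fun x => k * f x + k' * f' x) (fun x => k * p x + k' * p' x)
    (fun x => k * q x + k' * q' x).
Proof.
move=> f2 f2' [_ tp] [_ tp'] [_ tq] [_ tq'] w w' phi tphi.
have E (h h' g : mR3 R -> R) : (leb3 R).-integrable setT (EFin \o (fun x => h x * g x)) ->
    (leb3 R).-integrable setT (EFin \o (fun x => h' x * g x)) ->
    \int[leb3 R]_x ((k * h x + k' * h' x) * g x) =
    k * \int[leb3 R]_x (h x * g x) + k' * \int[leb3 R]_x (h' x * g x).
  move=> I1 I2; rewrite -(RintegralZl k measurableT I1) -(RintegralZl k' measurableT I2).
  rewrite -(RintegralD measurableT (integrable_funZ k I1) (integrable_funZ k' I2)).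
  by apply: eq_Rintegral => x _; ring.
have L2c (h : mR3 R -> R) (psi : R3 R -> R) : h \in Lfun (leb3 R) 2%:E -> tensor_sum psi ->
    (leb3 R).-integrable setT (EFin \o (fun x => h x * psi x)).
  by move=> h2 tpsi; apply: integrable_L2M => //; exact: tensor_sum_L2.
have tc := tensor_sum_cosT3 tphi; have ts := tensor_sum_sinT3 tphi.
rewrite (E p p' phi (tp _ tphi) (tp' _ tphi)) (E q q' phi (tq _ tphi) (tq' _ tphi)).
rewrite (E f f' _ (L2c f _ f2 tc) (L2c f' _ f2' tc)) (E f f' _ (L2c f _ f2 ts) (L2c f' _ f2' ts)).
have [-> ->] := w _ tphi; have [-> ->] := w' _ tphi.
by split => //; ring.
Qed.

Lemma is_fourier_weakF f (g : R3 R -> R[i]) : is_fourier f g ->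
  weakF f (fun x => complex.Re (g x)) (fun x => complex.Im (g x)).
Proof.
move=> [f2 _ _ fg] phi tphi; have := fg _ (tensor_sum_schwartz tphi).
have -> : fourier_integral phi = fun x => Complex (cosT3 phi x) (- sinT3 phi x).
  apply/funext => x; rewrite /fourier_integral /cintegral; congr Complex.
    rewrite /cosT3; apply: eq_Rintegral => y _ /=.
    by rewrite cosN mulr0 subr0 mulrC.
  rewrite -mulN1r -RintegralZl//; last exact/integrable_sinM3/tensor_sum_integrable.
  by apply: eq_Rintegral => y _ /=; rewrite sinN mulr0 add0r; ring.
rewrite /cintegral => -[h1 h2]; split.
- transitivity (\int[leb3 R]_y complex.Re (g y * (phi y)%:C%C)).
    by apply: eq_Rintegral => y _; case: (g y) => a b /=; rewrite mulr0 subr0.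
  by rewrite h1; apply: eq_Rintegral => x _ /=; rewrite mul0r subr0.
- transitivity (\int[leb3 R]_y complex.Im (g y * (phi y)%:C%C)).
    by apply: eq_Rintegral => y _; case: (g y) => a b /=; rewrite mulr0 add0r.
  have I : (leb3 R).-integrable setT (EFin \o (fun x : mR3 R => f x * sinT3 phi x)).
    by apply: integrable_L2M f2 _; exact/tensor_sum_L2/tensor_sum_sinT3.
  rewrite h2 -(Rintegral_funN I).
  by apply: eq_Rintegral => x _ /=; rewrite mul0r addr0; ring.
Qed.

(** The transform of a divergence is the sum of i xi_k (p_k + i q_k), which explains the sign and
    the exchange of [p] and [q]. The derivative falls on the transformed test function, where
    [der_cosT3] and [der_sinT3] turn it into a factor xi_k. *)
Lemma weakF_div (h : mR3 R -> R) (F p q : 'I_3 -> mR3 R -> R) :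
  (forall k, F k \in Lfun (leb3 R) 2%:E) ->
  (forall k, tempered (p k)) -> (forall k, tempered (q k)) ->
  (forall k, weakF (F k) (p k) (q k)) ->
  (forall phi, tensor_sum phi -> \int[leb3 R]_x (h x * phi x) =
     - \sum_(k < 3) \int[leb3 R]_x (F k x * 'D_(dir3 k) phi x)) ->
  weakF h (fun x => \sum_(k < 3) - (coord3 x k * q k x))
          (fun x => \sum_(k < 3) coord3 x k * p k x).
Proof.
move=> F2 tp tq w hF phi tphi.
have IX (r : 'I_3 -> mR3 R -> R) k : (forall k, tempered (r k)) ->
    (leb3 R).-integrable setT (EFin \o (fun x => r k x * (coord3 x k * phi x))).
  by move=> tr; have [_] := tr k; apply; exact: tensor_sumX.
have L2c k psi : tensor_sum psi ->
    (leb3 R).-integrable setT (EFin \o (fun x => F k x * psi x)).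
  by move=> tpsi; apply: integrable_L2M => //; exact: tensor_sum_L2.
split.
- rewrite (hF _ (tensor_sum_cosT3 tphi)).
  transitivity (\sum_(k < 3) - \int[leb3 R]_x (q k x * (coord3 x k * phi x))).
    under eq_Rintegral do rewrite mulr_suml.
    transitivity (\sum_(k < 3) \int[leb3 R]_x (- (coord3 x k * q k x) * phi x)).
      apply: (Rintegral_fun_sum _ (h := fun k (x : mR3 R) => - (coord3 x k * q k x) * phi x)).
      move=> k _; have := integrable_funZ (-1) (IX q k tq).
      by apply: eq_integrable => // x _; rewrite /=; congr EFin; ring.
    apply: eq_bigr => k _; rewrite -mulN1r -(RintegralZl _ measurableT (IX q k tq)).
    by apply: eq_Rintegral => x _; ring.
  rewrite -sumrN; apply: eq_bigr => k _; congr (- _).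
  have tX := tensor_sumX k tphi.
  rewrite (w k _ tX).2 -mulN1r -(RintegralZl _ measurableT (L2c k _ (tensor_sum_sinT3 tX))).
  apply: eq_Rintegral => x _.
  by rewrite (@derive_val _ _ _ _ _ _ _ (der_cosT3 k x tphi)); ring.
- rewrite (hF _ (tensor_sum_sinT3 tphi)) opprK.
  transitivity (\sum_(k < 3) \int[leb3 R]_x (p k x * (coord3 x k * phi x))).
    under eq_Rintegral do rewrite mulr_suml.
    transitivity (\sum_(k < 3) \int[leb3 R]_x (coord3 x k * p k x * phi x)).
      apply: (Rintegral_fun_sum _ (h := fun k (x : mR3 R) => coord3 x k * p k x * phi x)).
      move=> k _; have := IX p k tp.
      by apply: eq_integrable => // x _; rewrite /=; congr EFin; ring.
    by apply: eq_bigr => k _; apply: eq_Rintegral => x _; ring.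
  apply: eq_bigr => k _; have tX := tensor_sumX k tphi.
  rewrite (w k _ tX).1; apply: eq_Rintegral => x _.
  by rewrite (@derive_val _ _ _ _ _ _ _ (der_sinT3 k x tphi)).
Qed.

End WeakFourier.

(** * Fourier inversion for integrable transforms *)

Section Inversion.
Context {R : realType}.
Notation mu := (@lebesgue_measure R).
Let mu3 : {sigma_finite_measure set (mR3 R) -> \bar R} :=
  sigma_prod (sigma_prod mu mu) mu.
Implicit Types (f p q : mR3 R -> R).

Lemma measurable_cos_dot3 :
  measurable_fun setT (fun z : mR3 R * mR3 R => cos (dot3 z.1 z.2)).
Proof. exact: (measurableT_comp measurable_cosR measurable_dot3). Qed.

Lemma measurable_sin_dot3 :
  measurable_fun setT (fun z : mR3 R * mR3 R => sin (dot3 z.1 z.2)).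
Proof. exact: (measurableT_comp measurable_sinR measurable_dot3). Qed.

Lemma integrable6_trig (h : R -> R) p q :
  measurable_fun setT (fun z : mR3 R * mR3 R => h (dot3 z.1 z.2)) ->
  (forall t, `|h t| <= 1) ->
  (leb3 R).-integrable setT (EFin \o p) -> (leb3 R).-integrable setT (EFin \o q) ->
  leb6.-integrable setT (EFin \o (fun z => p z.1 * q z.2 * h (dot3 z.1 z.2))).
Proof.
move=> mh h1 Ip Iq.
exact: integrable_mul_bounded mh (fun z => h1 (dot3 z.1 z.2)) (integrable_tensor6 Ip Iq).
Qed.

(** Symmetry of the kernel and Fubini; [h] stands for the cosine or the sine, so that one proof
    serves both. *)
Lemma trigT3_dual (h : R -> R) p q :
  measurable_fun setT (fun z : mR3 R * mR3 R => h (dot3 z.1 z.2)) ->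
  (forall t, `|h t| <= 1) ->
  (leb3 R).-integrable setT (EFin \o p) -> (leb3 R).-integrable setT (EFin \o q) ->
  \int[leb3 R]_x (\int[leb3 R]_y (p y * h (dot3 y x)) * q x) =
  \int[leb3 R]_y (p y * \int[leb3 R]_x (q x * h (dot3 x y))).
Proof.
move=> mh h1 Ip Iq; have I6 := integrable6_trig mh h1 Ip Iq.
have Ih (r : mR3 R -> R) (x : mR3 R) : (leb3 R).-integrable setT (EFin \o r) ->
    (leb3 R).-integrable setT (EFin \o (fun y => r y * h (dot3 y x))).
  move=> Ir; apply: integrable_mul_bounded Ir; first exact: (measurable_fun_pair1 x mh).
  by move=> y; exact: h1.
transitivity (\int[leb6]_z (p z.1 * q z.2 * h (dot3 z.1 z.2))).
  rewrite Rfubini6_2//; apply: eq_Rintegral => x _ /=.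
  rewrite mulrC -(RintegralZl (q x) measurableT (Ih p x Ip)).
  by apply: eq_Rintegral => y _; ring.
rewrite Rfubini6_1//; apply: eq_Rintegral => y _ /=.
rewrite -(RintegralZl (p y) measurableT (Ih q y Iq)).
by apply: eq_Rintegral => x _; rewrite dot3C mulrA.
Qed.

Lemma measurable_trigT3 (h : R -> R) p :
  measurable_fun setT (fun z : mR3 R * mR3 R => h (dot3 z.1 z.2)) ->
  (forall t, `|h t| <= 1) -> (leb3 R).-integrable setT (EFin \o p) ->
  measurable_fun setT (fun x : mR3 R => \int[leb3 R]_y (p y * h (dot3 y x))).
Proof.
move=> mh h1 Ip.
have a1 : pos3 ((1, 1, 1) : R3 R) by split => /=.
(* The product of p y and h (y . x) need not be integrable in (x, y) jointly, so Fubini does not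
   apply to it. The factor G x repairs this, and H = 1 / G, a [gauss3] with negative parameters,
   removes it again. *)
pose G : mR3 R -> R := gauss3 (1, 1, 1) 0.
have IG : (leb3 R).-integrable setT (EFin \o G).
  exact/tensor_sum_integrable/tensor_sum_gauss3.
have I6 := integrable6_trig mh h1 IG Ip.
pose H : mR3 R -> R := gauss3 (-1, -1, -1) 0.
have mH : measurable_fun setT H.
  apply: measurable_funM; [apply: measurable_funM|].
  - exact: (measurableT_comp (measurable_gauss _ _) (measurable_coord3 0)).
  - exact: (measurableT_comp (measurable_gauss _ _) (measurable_coord3 1)).
  - exact: (measurableT_comp (measurable_gauss _ _) (measurable_coord3 2)).
have GH x : G x * H x = 1.
  by rewrite /G /H /gauss3 /gauss /= -!expRD -[RHS]expR0; congr expR; ring.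
rewrite (_ : (fun x => _) = fun x =>
    \int[leb3 R]_y (G x * p y * h (dot3 x y)) * H x).
  apply: measurable_funM; last exact: mH.
  apply: measurableT_comp => //.
  exact: (measurable_fubini_F (m1 := mu3) (m2 := mu3) I6).
apply/funext => x.
have Ih : (leb3 R).-integrable setT (EFin \o (fun y => p y * h (dot3 y x))).
  apply: integrable_mul_bounded Ip; first exact: (measurable_fun_pair1 x mh).
  by move=> y; exact: h1.
rewrite -(RintegralZr (H x) measurableT).
  apply: eq_Rintegral => y _; rewrite (dot3C x).
  by rewrite -[LHS]mulr1 -(GH x); ring.
have := integrable_funZ (G x) Ih; apply: eq_integrable => // y _ /=.
by rewrite dot3C; congr EFin; ring.
Qed.

Lemma measurable_cosT3 p : (leb3 R).-integrable setT (EFin \o p) ->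
  measurable_fun setT (cosT3 p : mR3 R -> R).
Proof. exact: (measurable_trigT3 measurable_cos_dot3 (@cos_max R)). Qed.

Lemma measurable_sinT3 p : (leb3 R).-integrable setT (EFin \o p) ->
  measurable_fun setT (sinT3 p : mR3 R -> R).
Proof. exact: (measurable_trigT3 measurable_sin_dot3 (@sin_max R)). Qed.

Lemma trigT3_bounded (h : R -> R) p (x : R3 R) :
  measurable_fun setT (fun y : mR3 R => h (dot3 y x)) ->
  (forall t, `|h t| <= 1) -> (leb3 R).-integrable setT (EFin \o p) ->
  `|\int[leb3 R]_y (p y * h (dot3 y x))| <= \int[leb3 R]_y `|p y|.
Proof.
move=> mh h1 Ip.
have Ih : (leb3 R).-integrable setT (EFin \o (fun y => p y * h (dot3 y x))).
  by apply: integrable_mul_bounded Ip => // y; exact: h1.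
apply: le_trans (le_normr_Rintegral measurableT Ih) _.
apply: (le_Rintegral measurableT (integrable_funn Ih) (integrable_funn Ip)) => y _.
by rewrite normrM ler_piMr.
Qed.

Lemma tempered_cosT3 p : (leb3 R).-integrable setT (EFin \o p) -> tempered (cosT3 p).
Proof.
move=> Ip; apply: tempered_bounded; first exact: measurable_cosT3.
move=> x; apply: (trigT3_bounded (h := cos)) => //; last exact: cos_max.
exact: (measurableT_comp measurable_cosR (measurable_dot3l x)).
Qed.

Lemma tempered_sinT3 p : (leb3 R).-integrable setT (EFin \o p) -> tempered (sinT3 p).
Proof.
move=> Ip; apply: tempered_bounded; first exact: measurable_sinT3.
move=> x; apply: (trigT3_bounded (h := sin)) => //; last exact: sin_max.
exact: (measurableT_comp measurable_sinR (measurable_dot3l x)).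
Qed.

(** Inversion for Gaussians is explicit: the phases combine into the cosine and sine of (c - x) . y,
    so the second transform is that of a Gaussian centred at 0, evaluated at c - x with centre phase
    0. *)
Lemma gauss3_trigT3_trigT3 a c (x : R3 R) : pos3 a ->
  let G := gauss3 a c in
  cosT3 (cosT3 G) x + sinT3 (sinT3 G) x = (2 * pi) ^+ 3 * G x /\
  cosT3 (sinT3 G) x - sinT3 (cosT3 G) x = 0.
Proof.
move=> a0 G.
have tG : tensor_sum G := tensor_sum_gauss3 c a0.
have IcG := tensor_sum_integrable (tensor_sum_cosT3 tG).
have IsG := tensor_sum_integrable (tensor_sum_sinT3 tG).
have d0 := dual3_pos a0.
have ID : (leb3 R).-integrable setT (EFin \o (gauss3 (dual3 a) 0 : mR3 R -> R)).
  exact/tensor_sum_integrable/tensor_sum_gauss3.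
have [hc hs] := trigT3_gauss3 0 (c - x) d0.
have dot30 : dot3 0 (c - x) = 0 :> R by rewrite /dot3 big1// => i _; case: i => -[|[|[|]]]//= ?; rewrite mul0r.
have E (y : R3 R) : dot3 y (c - x) = dot3 c y - dot3 y x.
  by rewrite dot3C dot3Bl (dot3C x).
split.
- rewrite -(RintegralD measurableT (integrable_cosM3 x IcG) (integrable_sinM3 x IsG)).
  transitivity (\int[leb3 R]_y (gauss_mass3 a *
      (gauss3 (dual3 a) 0 y * cos (dot3 y (c - x))))).
    apply: eq_Rintegral => y _; have [-> ->] := trigT3_gauss3 c y a0.
    by rewrite E cosB; ring.
  rewrite (RintegralZl _ measurableT (integrable_cosM3 _ ID)) -/(cosT3 _ _) hc dot30 cos0.
  rewrite dual3K// mulr1 mulrA gauss_mass3_dual//; congr (_ * _).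
  by rewrite /G /gauss3 /gauss /=; congr (expR _ * expR _ * expR _); ring.
- rewrite -(RintegralB measurableT (integrable_cosM3 x IsG) (integrable_sinM3 x IcG)).
  transitivity (\int[leb3 R]_y (gauss_mass3 a *
      (gauss3 (dual3 a) 0 y * sin (dot3 y (c - x))))).
    apply: eq_Rintegral => y _; have [-> ->] := trigT3_gauss3 c y a0.
    by rewrite E sinB; ring.
  rewrite (RintegralZl _ measurableT (integrable_sinM3 _ ID)) -/(sinT3 _ _) hs dot30 sin0.
  by rewrite !(mulr0, mul0r).
Qed.

(** A Gaussian test function is replaced by its double transform; one transform is moved onto [f] by
    [weakF], the other onto [p] and [q] by Fubini. The second identity is the vanishing imaginary
    part of the inverse transform, [f] being real. *)
Lemma weakF_inversion f p q : f \in Lfun (leb3 R) 2%:E ->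
  (leb3 R).-integrable setT (EFin \o p) -> (leb3 R).-integrable setT (EFin \o q) ->
  weakF f p q ->
  {ae leb3 R, forall x, f x = (2 * pi) ^- 3 * (cosT3 p x - sinT3 q x) /\
     sinT3 p x + cosT3 q x = 0}.
Proof.
move=> f2 Ip Iq w.
have [tcp tsp] := (tempered_cosT3 Ip, tempered_sinT3 Ip).
have [tcq tsq] := (tempered_cosT3 Iq, tempered_sinT3 Iq).
have k0 : (2 * pi) ^+ 3 != 0 :> R by rewrite expf_neq0// mulf_neq0// gt_eqF// pi_gt0.
have L2c psi : tensor_sum psi ->
    (leb3 R).-integrable setT (EFin \o (fun x : mR3 R => f x * psi x)).
  by move=> tpsi; apply: integrable_L2M f2 _; exact: tensor_sum_L2.
have cdual r phi : (leb3 R).-integrable setT (EFin \o r) -> tensor_sum phi ->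
    \int[leb3 R]_x (cosT3 r x * phi x) = \int[leb3 R]_y (r y * cosT3 phi y).
  move=> Ir tphi; apply: (trigT3_dual measurable_cos_dot3 (@cos_max R)) => //.
  exact: tensor_sum_integrable.
have sdual r phi : (leb3 R).-integrable setT (EFin \o r) -> tensor_sum phi ->
    \int[leb3 R]_x (sinT3 r x * phi x) = \int[leb3 R]_y (r y * sinT3 phi y).
  move=> Ir tphi; apply: (trigT3_dual measurable_sin_dot3 (@sin_max R)) => //.
  exact: tensor_sum_integrable.
have h1 : {ae leb3 R, forall x, f x = (2 * pi) ^- 3 * (cosT3 p x - sinT3 q x)}.
  apply: tempered_gauss_eq; [exact: tempered_L2|exact/temperedZ/temperedB|].
  move=> a c a0; have tG := tensor_sum_gauss3 c a0.
  have [tcG tsG] := (tensor_sum_cosT3 tG, tensor_sum_sinT3 tG).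
  have IG := tensor_sum_integrable tG.
  transitivity (\int[leb3 R]_x ((2 * pi) ^- 3 *
      (f x * cosT3 (cosT3 (gauss3 a c)) x + f x * sinT3 (sinT3 (gauss3 a c)) x))).
    apply: eq_Rintegral => x _; rewrite -mulrDr (gauss3_trigT3_trigT3 c x a0).1.
    by move: (gauss3 a c x) (f x) => g y; rewrite (mulrCA y) mulKf.
  have Icc := L2c _ (tensor_sum_cosT3 tcG); have Iss := L2c _ (tensor_sum_sinT3 tsG).
  rewrite (RintegralZl _ measurableT (integrable_funD Icc Iss)).
  rewrite (RintegralD measurableT Icc Iss) -(w _ tcG).1.
  rewrite -[X in _ + X]opprK -(w _ tsG).2 -cdual// -sdual//.
  rewrite -(RintegralB measurableT (tcp.2 _ tG) (tsq.2 _ tG)).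
  rewrite -(RintegralZl _ measurableT (integrable_funB (tcp.2 _ tG) (tsq.2 _ tG))).
  by apply: eq_Rintegral => x _; rewrite -mulrBl mulrA.
have h2 : {ae leb3 R, forall x, sinT3 p x + cosT3 q x = 0}.
  apply: tempered_gauss0; first exact: temperedD.
  move=> a c a0; have tG := tensor_sum_gauss3 c a0.
  have [tcG tsG] := (tensor_sum_cosT3 tG, tensor_sum_sinT3 tG).
  have Ics := L2c _ (tensor_sum_cosT3 tsG); have Isc := L2c _ (tensor_sum_sinT3 tcG).
  transitivity (\int[leb3 R]_x (f x * cosT3 (sinT3 (gauss3 a c)) x -
      f x * sinT3 (cosT3 (gauss3 a c)) x)); last first.
    under eq_Rintegral do rewrite -mulrBr (gauss3_trigT3_trigT3 c _ a0).2 mulr0.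
    by rewrite /Rintegral integral0.
  rewrite (RintegralB measurableT Ics Isc) -(w _ tsG).1 -(w _ tcG).2 -cdual// -sdual//.
  rewrite -(RintegralD measurableT (tsp.2 _ tG) (tcq.2 _ tG)).
  by apply: eq_Rintegral => x _; rewrite mulrDl.
by apply: filterS2 h1 h2.
Qed.

End Inversion.

(** * The convection term *)

Section ProductFormula.
Context {R : realType}.
Notation mu := (@lebesgue_measure R).
Let mu3 : {sigma_finite_measure set (mR3 R) -> \bar R} :=
  sigma_prod (sigma_prod mu mu) mu.
Implicit Types (f p q : mR3 R -> R).

Lemma integrable_fine d (T : measurableType d) (m : {measure set T -> \bar R})
    (F : T -> \bar R) : m.-integrable setT F -> m.-integrable setT (EFin \o (fine \o F)).
Proof.
move=> IF; apply: (le_integrable measurableT _ _ IF).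
  by apply/measurable_EFinP; apply: measurableT_comp => //; exact: measurable_int IF.
by move=> x _ /=; case: (F x) => [r| |] //=; rewrite normr0 leey.
Qed.

Lemma integrable_fubini_G d1 d2 (T1 : measurableType d1) (T2 : measurableType d2)
    (m1 : {sigma_finite_measure set T1 -> \bar R})
    (m2 : {sigma_finite_measure set T2 -> \bar R}) (f : T1 * T2 -> \bar R) :
  (m1 \x m2)%E.-integrable setT f -> m2.-integrable setT (fubini_G m1 f).
Proof.
move=> If; have := measurable_fubini_G If.
move=> mG; apply/integrableP; split => //.
have /(integrable21ltyP _ _ (measurable_int _ If)) := If.
apply: le_lt_trans; apply: ge0_le_integral => //.
- exact: measurableT_comp.
- apply: (measurable_fun_fubini_tonelli_G (abse \o f)) => //=.
  by apply: measurableT_comp => //; exact: measurable_int If.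
- move=> y _; apply: le_abse_integral => //.
  have := measurable_int _ If => mf.
  exact: measurableT_comp.
Qed.

Lemma Rintegrable6_2 (f : mR3 R * mR3 R -> R) : leb6.-integrable setT (EFin \o f) ->
  (leb3 R).-integrable setT (EFin \o (fun y => \int[leb3 R]_x f (x, y))).
Proof.
move=> If; have := integrable_fubini_G (m1 := mu3) (m2 := mu3) If.
exact: integrable_fine.
Qed.

Lemma gauss3_shift (a c eta x : R3 R) : gauss3 a (c - eta) x = gauss3 a c (x + eta).
Proof. by rewrite /gauss3 /gauss /=; congr (expR _ * expR _ * expR _); ring. Qed.

(* The real part of [(al - i be) * int p exp (i (c - eta) . x)] and its companion
   for [q] are handled together, so that [al = 1, be = 0] yields the real part of the
   transform of the product and [al = 0, be = 1] its imaginary part. *)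
Lemma product_gauss3 (u g p q P Q : mR3 R -> R) (a c : R3 R) (al be : R) :
  u \in Lfun (leb3 R) 2%:E -> g \in Lfun (leb3 R) 2%:E ->
  (leb3 R).-integrable setT (EFin \o p) -> (leb3 R).-integrable setT (EFin \o q) ->
  weakF u p q -> weakF g P Q -> pos3 a ->
  let IP eta := \int[leb3 R]_x (P x * gauss3 a (c - eta) x) in
  let IQ eta := \int[leb3 R]_x (Q x * gauss3 a (c - eta) x) in
  let B eta := p eta * (al * IP eta + be * IQ eta) + q eta * (be * IP eta - al * IQ eta) in
  (leb3 R).-integrable setT (EFin \o B) /\
  \int[leb3 R]_x (u x * g x * (al * cosT3 (gauss3 a c) x - be * sinT3 (gauss3 a c) x)) =
  (2 * pi) ^- 3 * \int[leb3 R]_eta B eta.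
Proof.
move=> u2 g2 Ip Iq wu wg a0 IP IQ B.
have d0 := dual3_pos a0.
(* The transform of [gauss3 a c] is this centred Gaussian times the cosine and sine of c . x. Joined
   to [g], which is only in L2, it gives an integrable factor. *)
pose ga : mR3 R -> R := fun x => g x * (gauss_mass3 a * gauss3 (dual3 a) 0 x).
have Iga : (leb3 R).-integrable setT (EFin \o ga).
  apply: integrable_L2M g2 _; apply: tensor_sum_L2.
  exact/tensor_sumZ/tensor_sum_gauss3.
pose C (z : mR3 R * mR3 R) := cos (dot3 (c - z.2) z.1).
pose S (z : mR3 R * mR3 R) := sin (dot3 (c - z.2) z.1).
have md : measurable_fun setT (fun z : mR3 R * mR3 R => dot3 (c - z.2) z.1).
  rewrite (_ : (fun z => _) = (fun z : mR3 R * mR3 R => dot3 z.1 c - dot3 z.1 z.2)).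
    apply: measurable_funB measurable_dot3.
    exact: (measurableT_comp (measurable_dot3l c) measurable_fst).
  by apply/funext => z; rewrite dot3Bl (dot3C c) (dot3C z.2).
have mC : measurable_fun setT C := measurableT_comp measurable_cosR md.
have mS : measurable_fun setT S := measurableT_comp measurable_sinR md.
have IC r : (leb3 R).-integrable setT (EFin \o r) ->
    leb6.-integrable setT (EFin \o (fun z => ga z.1 * r z.2 * C z)).
  move=> Ir; apply: integrable_mul_bounded mC _ (integrable_tensor6 Iga Ir) => z.
  exact: cos_max.
have IS r : (leb3 R).-integrable setT (EFin \o r) ->
    leb6.-integrable setT (EFin \o (fun z => ga z.1 * r z.2 * S z)).
  move=> Ir; apply: integrable_mul_bounded mS _ (integrable_tensor6 Iga Ir) => z.
  exact: sin_max.
pose Phi z := al * (ga z.1 * p z.2 * C z) - be * (ga z.1 * p z.2 * S z) +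
  (al * (ga z.1 * q z.2 * S z) + be * (ga z.1 * q z.2 * C z)).
have IPhi : leb6.-integrable setT (EFin \o Phi).
  apply: integrable_funD (integrable_funB _ _) (integrable_funD _ _);
    apply: integrable_funZ; by [exact: IC|exact: IS].
have PhiB eta : \int[leb3 R]_x Phi (x, eta) = B eta.
  have tG := tensor_sum_gauss3 (c - eta) a0.
  have Igc : (leb3 R).-integrable setT (EFin \o (fun x => g x * cosT3 (gauss3 a (c - eta)) x)).
    by apply: integrable_L2M g2 _; exact/tensor_sum_L2/tensor_sum_cosT3.
  have Igs : (leb3 R).-integrable setT (EFin \o (fun x => g x * sinT3 (gauss3 a (c - eta)) x)).
    by apply: integrable_L2M g2 _; exact/tensor_sum_L2/tensor_sum_sinT3.
  have [hP hQ] := wg _ tG.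
  rewrite /B /IP /IQ hP hQ.
  set X := \int[leb3 R]_x (g x * cosT3 _ x); set Y := \int[leb3 R]_x (g x * sinT3 _ x).
  transitivity ((al * p eta + be * q eta) * X + (al * q eta - be * p eta) * Y); last first.
    by move: X Y => X Y; ring.
  transitivity (\int[leb3 R]_x ((al * p eta + be * q eta) *
        (g x * cosT3 (gauss3 a (c - eta)) x) +
      (al * q eta - be * p eta) * (g x * sinT3 (gauss3 a (c - eta)) x))).
    apply: eq_Rintegral => x _; have [-> ->] := trigT3_gauss3 (c - eta) x a0.
    by rewrite /Phi /ga /C /S /=; ring.
  rewrite (RintegralD measurableT (integrable_funZ _ Igc) (integrable_funZ _ Igs)).
  by rewrite (RintegralZl _ measurableT Igc) (RintegralZl _ measurableT Igs).
split; first by have := Rintegrable6_2 IPhi; rewrite (funext PhiB).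
under [in RHS]eq_Rintegral do rewrite -PhiB.
rewrite -Rfubini6_2// Rfubini6_1//.
have IPhi1 : (leb3 R).-integrable setT (EFin \o (fun x => \int[leb3 R]_y Phi (x, y))).
  exact: integrable_fine (integrable_fubini_F (m1 := mu3) (m2 := mu3) IPhi).
rewrite -(RintegralZl _ measurableT IPhi1).
have PhiE (x : R3 R) : \int[leb3 R]_eta Phi (x, eta) = ga x *
   ((al * cos (dot3 c x) - be * sin (dot3 c x)) * (cosT3 p x - sinT3 q x) +
    (al * sin (dot3 c x) + be * cos (dot3 c x)) * (sinT3 p x + cosT3 q x)).
  have [Ipc Ips] := (integrable_cosM3 x Ip, integrable_sinM3 x Ip).
  have [Iqc Iqs] := (integrable_cosM3 x Iq, integrable_sinM3 x Iq).
  set s := sin (dot3 c x); set k := cos (dot3 c x).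
  rewrite /cosT3 /sinT3 -(RintegralB measurableT Ipc Iqs) -(RintegralD measurableT Ips Iqc).
  rewrite -(RintegralZl _ measurableT (integrable_funB Ipc Iqs)).
  rewrite -(RintegralZl _ measurableT (integrable_funD Ips Iqc)).
  rewrite -(RintegralD measurableT (integrable_funZ _ (integrable_funB Ipc Iqs))
    (integrable_funZ _ (integrable_funD Ips Iqc))).
  rewrite -(RintegralZl (ga x) measurableT (integrable_funD
    (integrable_funZ _ (integrable_funB Ipc Iqs))
    (integrable_funZ _ (integrable_funD Ips Iqc)))).
  apply: eq_Rintegral => eta _; rewrite /Phi /C /S /= dot3Bl cosB sinB -/s -/k.
  by ring.
apply: Rintegral_ae_eq.
- apply: measurable_funM.
    by apply: measurable_funM; [exact: Lfun_measurable u2|exact: Lfun_measurable g2].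
  have tG := tensor_sum_gauss3 c a0.
  apply: measurable_funB; apply: measurable_funM => //; apply: tensor_sum_measurable.
    exact: tensor_sum_cosT3.
  exact: tensor_sum_sinT3.
- by apply: measurable_funM; [|exact: integrable_measurable IPhi1].
(* Inversion for [u] identifies the two brackets of [PhiE]: one is (2 pi)^3 u x, the other is 0, for
   almost every x. *)
- have := weakF_inversion u2 Ip Iq wu; apply: filterS => x [ux u0x].
  rewrite PhiE u0x mulr0 addr0 ux /ga.
  have [-> ->] := trigT3_gauss3 c x a0.
  by ring.
Qed.

End ProductFormula.

Section Convection.
Context {R : realType}.
Notation mu := (@lebesgue_measure R).

(* With [P = - xi_k Q] and [Q = xi_k P] the factor [xi_k] may be replaced by the
   frequency [xi_k + eta_k] of the product because [p], [q] are divergence free. *)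
Lemma convection_repr (u g p q : 'I_3 -> mR3 R -> R) (w a b pj qj : mR3 R -> R) (al be : R) :
  (forall k, u k \in Lfun (leb3 R) 2%:E) -> (forall k, g k \in Lfun (leb3 R) 2%:E) ->
  (forall k, (leb3 R).-integrable setT (EFin \o p k)) ->
  (forall k, (leb3 R).-integrable setT (EFin \o q k)) ->
  (leb3 R).-integrable setT (EFin \o pj) -> (leb3 R).-integrable setT (EFin \o qj) ->
  (forall k, weakF (u k) (p k) (q k)) ->
  (forall k, weakF (g k) (fun x => - (coord3 x k * qj x)) (fun x => coord3 x k * pj x)) ->
  {ae leb3 R, forall x : mR3 R, \sum_(k < 3) coord3 x k * p k x = 0} ->
  {ae leb3 R, forall x : mR3 R, \sum_(k < 3) coord3 x k * q k x = 0} ->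
  tempered a -> tempered b -> w \in Lfun (leb3 R) 2%:E -> weakF w a b ->
  (forall x, w x = \sum_(k < 3) u k x * g k x) ->
  let A k (z : mR3 R * mR3 R) := (be * pj z.1 - al * qj z.1) * p k z.2 -
    (al * pj z.1 + be * qj z.1) * q k z.2 in
  exists W : 'I_3 -> mR3 R -> R,
    (forall k, (leb3 R).-integrable setT (EFin \o W k) /\
      (\int[leb3 R]_z `|W k z|%:E <= \int[leb6]_z `|A k z|%:E)%E) /\
    {ae leb3 R, forall x : mR3 R, al * a x + be * b x =
      (2 * pi) ^- 3 * \sum_(k < 3) coord3 x k * W k x}.
Proof.
move=> u2 g2 Ip Iq Ipj Iqj wu wg p0 q0 ta tb w2 ww wE A.
have IA k : leb6.-integrable setT (EFin \o A k).
  exact: (integrable_funB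
    (integrable_tensor6 (integrable_funB (integrable_funZ be Ipj) (integrable_funZ al Iqj)) (Ip k))
    (integrable_tensor6 (integrable_funD (integrable_funZ al Ipj) (integrable_funZ be Iqj)) (Iq k))).
have [W hW] := choice (fun k => convolution_L1 (IA k)).
exists W; split; first by move=> k; have [] := hW k.
have IW k : (leb3 R).-integrable setT (EFin \o W k) by have [] := hW k.
have tXW k : tempered (fun x => coord3 x k * W k x) by apply: temperedX; exact: tempered_L1.
apply: tempered_gauss_eq.
- by apply: temperedD; exact: temperedZ.
- by apply: temperedZ; exact: tempered_sum3.
move=> aa c a0; have tG := tensor_sum_gauss3 c a0.
pose b_ k (x : R3 R) := coord3 x k * gauss3 aa c x.
have tb_ k : tensor_sum (b_ k) := tensor_sumX k tG.
pose IP k (eta : mR3 R) := \int[leb3 R]_x (- (coord3 x k * qj x) * gauss3 aa (c - eta) x).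
pose IQ k (eta : mR3 R) := \int[leb3 R]_x (coord3 x k * pj x * gauss3 aa (c - eta) x).
pose B k (eta : mR3 R) := p k eta * (al * IP k eta + be * IQ k eta) +
  q k eta * (be * IP k eta - al * IQ k eta).
have hB k : (leb3 R).-integrable setT (EFin \o B k) /\
    \int[leb3 R]_x (u k x * g k x * (al * cosT3 (gauss3 aa c) x - be * sinT3 (gauss3 aa c) x)) =
    (2 * pi) ^- 3 * \int[leb3 R]_eta B k eta.
  exact: product_gauss3 (u2 k) (g2 k) (Ip k) (Iq k) (wu k) (wg k) a0.
pose K k (z : mR3 R * mR3 R) := A k z * b_ k ((z.1 : R3 R) + z.2).
have IK k : leb6.-integrable setT (EFin \o K k).
  have [C hC] := tensor_sum_bounded (tb_ k).
  apply: integrable_mul_bounded (IA k) => [|z]; last exact: hC.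
  exact: (measurableT_comp (tensor_sum_measurable (tb_ k)) measurable_add3).
pose B' k (eta : mR3 R) := \int[leb3 R]_x K k (x, eta).
have IB' k : (leb3 R).-integrable setT (EFin \o B' k) := Rintegrable6_2 (IK k).
have BB' : {ae leb3 R, forall eta : mR3 R, \sum_(k < 3) B k eta = \sum_(k < 3) B' k eta}.
  apply: filterS2 p0 q0 => eta p0 q0.
  have tGe := tensor_sum_gauss3 (c - eta) a0.
  pose Ge : mR3 R -> R := gauss3 aa (c - eta).
  have I1 (r : mR3 R -> R) : (leb3 R).-integrable setT (EFin \o r) ->
      (leb3 R).-integrable setT (EFin \o (fun x => r x * Ge x)).
    by move=> /tempered_L1 tr; exact: tr.2 _ tGe.
  have IX k (r : mR3 R -> R) : (leb3 R).-integrable setT (EFin \o r) ->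
      (leb3 R).-integrable setT (EFin \o (fun x => coord3 x k * r x * Ge x)).
    by move=> /tempered_L1/(temperedX k) tr; exact: tr.2 _ tGe.
  pose X0 (r : mR3 R -> R) := \int[leb3 R]_x (r x * Ge x).
  pose X k (r : mR3 R -> R) := \int[leb3 R]_x (coord3 x k * r x * Ge x).
  have BE k : B k eta = p k eta * (be * X k pj - al * X k qj) -
      q k eta * (al * X k pj + be * X k qj).
    rewrite /B (_ : IP k eta = - X k qj); first by rewrite /IQ -/(X k pj); ring.
    rewrite /IP -(Rintegral_funN (IX k _ Iqj)); apply: eq_Rintegral => x _.
    by rewrite mulNr.
  have B'E k : B' k eta = p k eta * (be * (X k pj + coord3 eta k * X0 pj) -
      al * (X k qj + coord3 eta k * X0 qj)) - q k eta *
      (al * (X k pj + coord3 eta k * X0 pj) + be * (X k qj + coord3 eta k * X0 qj)).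
    have Ir r : (leb3 R).-integrable setT (EFin \o r) ->
        (leb3 R).-integrable setT (EFin \o (fun x => coord3 x k * r x * Ge x +
          coord3 eta k * (r x * Ge x))).
      by move=> Ir; apply: integrable_funD; [exact: IX|exact/integrable_funZ/I1].
    have Er r : (leb3 R).-integrable setT (EFin \o r) ->
        \int[leb3 R]_x (coord3 x k * r x * Ge x + coord3 eta k * (r x * Ge x)) =
        X k r + coord3 eta k * X0 r.
      move=> Irr; rewrite (RintegralD measurableT (IX k _ Irr) (integrable_funZ _ (I1 _ Irr))).
      by rewrite (RintegralZl _ measurableT (I1 _ Irr)).
    rewrite -!Er//.
    transitivity (\int[leb3 R]_x ((be * p k eta - al * q k eta) *
        (coord3 x k * pj x * Ge x + coord3 eta k * (pj x * Ge x)) +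
        (- al * p k eta - be * q k eta) *
        (coord3 x k * qj x * Ge x + coord3 eta k * (qj x * Ge x)))).
      apply: eq_Rintegral => x _.
      rewrite /K /A /b_ /= -gauss3_shift -/(Ge x).
      have -> : coord3 ((x : R3 R) + eta) k = coord3 x k + coord3 eta k.
        by rewrite -!dot3_dir3 dot3Dl.
      by ring.
    rewrite (RintegralD measurableT (integrable_funZ _ (Ir _ Ipj)) (integrable_funZ _ (Ir _ Iqj))).
    rewrite (RintegralZl _ measurableT (Ir _ Ipj)) (RintegralZl _ measurableT (Ir _ Iqj)).
    set Z1 := Rintegral _ _ _; set Z2 := Rintegral _ _ _; move: Z1 Z2 => Z1 Z2.
    by ring.
  have -> : \sum_(k < 3) B' k eta = \sum_(k < 3) B k eta +
      (be * X0 pj - al * X0 qj) * \sum_(k < 3) coord3 eta k * p k eta -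
      (al * X0 pj + be * X0 qj) * \sum_(k < 3) coord3 eta k * q k eta.
    rewrite !mulr_sumr -big_split/= -sumrB; apply: eq_bigr => k _.
    by rewrite B'E BE; ring.
  by rewrite p0 q0 !mulr0 addr0 subr0.
have Iw psi : tensor_sum psi ->
    (leb3 R).-integrable setT (EFin \o (fun x : mR3 R => w x * psi x)).
  by move=> tpsi; apply: integrable_L2M w2 _; exact: tensor_sum_L2.
have [tcG tsG] := (tensor_sum_cosT3 tG, tensor_sum_sinT3 tG).
have [tca tsb] := (ta.2 _ tG, tb.2 _ tG).
transitivity (al * \int[leb3 R]_x (a x * gauss3 aa c x) +
    be * \int[leb3 R]_x (b x * gauss3 aa c x)).
  rewrite -(RintegralZl _ measurableT tca) -(RintegralZl _ measurableT tsb).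
  rewrite -(RintegralD measurableT (integrable_funZ _ tca) (integrable_funZ _ tsb)).
  by apply: eq_Rintegral => x _; ring.
rewrite (ww _ tG).1 (ww _ tG).2 mulrN.
rewrite -(RintegralZl _ measurableT (Iw _ tcG)) -(RintegralZl _ measurableT (Iw _ tsG)).
rewrite -(RintegralB measurableT (integrable_funZ _ (Iw _ tcG)) (integrable_funZ _ (Iw _ tsG))).
pose T x := al * cosT3 (gauss3 aa c) x - be * sinT3 (gauss3 aa c) x.
have tT : tensor_sum T.
  apply: tensor_sumD; first exact: tensor_sumZ.
  exact/tensor_sumN/tensor_sumZ.
transitivity (\sum_(k < 3) \int[leb3 R]_x (u k x * g k x * T x)).
  rewrite -(Rintegral_fun_sum _ (h := fun k (x : mR3 R) => u k x * g k x * T x)).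
    apply: eq_Rintegral => x _; rewrite -mulr_suml -wE /T; ring.
  move=> k _; have [C hC] := tensor_sum_bounded tT.
  apply: integrable_mul_bounded (tensor_sum_measurable tT) hC _.
  exact: integrable_L2M.
rewrite (eq_bigr (fun k => (2 * pi) ^- 3 * \int[leb3 R]_eta B k eta)); last first.
  by move=> k _; have [] := hB k.
rewrite -mulr_sumr -(Rintegral_fun_sum _ (h := B)); last by move=> k _; have [] := hB k.
rewrite (_ : Rintegral _ _ _ = \int[leb3 R]_eta \sum_(k < 3) B' k eta); last first.
  have IB k : (leb3 R).-integrable setT (EFin \o B k) by have [] := hB k.
  apply: Rintegral_ae_eq BB'; apply: integrable_measurable.
    by apply: integrable_fun_sum => k _; exact: IB.
  by apply: integrable_fun_sum => k _; exact: IB'.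
rewrite (Rintegral_fun_sum _ (h := B')); last by move=> k _; exact: IB'.
have IWb k : (leb3 R).-integrable setT (EFin \o (fun x => W k x * b_ k x)).
  by have := (tempered_L1 (IW k)).2 _ (tb_ k).
rewrite (eq_bigr (fun k => \int[leb3 R]_x (W k x * b_ k x))); last first.
  move=> k _; have [_ _ hWk] := hW k; have [C hC] := tensor_sum_bounded (tb_ k).
  by rewrite (hWk _ C (tensor_sum_measurable (tb_ k)) hC) -Rfubini6_2.
rewrite -(Rintegral_fun_sum _ (h := fun k (x : mR3 R) => W k x * b_ k x)); last by move=> k _; exact: IWb.
rewrite -(RintegralZl _ measurableT (integrable_fun_sum _ (fun k _ => IWb k))).
apply: eq_Rintegral => x _; rewrite -mulrA mulr_suml; congr (_ * _).
by apply: eq_bigr => k _; rewrite /b_; ring.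
Qed.

End Convection.

(** * Transforms of vector fields and of their derivatives *)

Section Spectrum.
Context {R : realType}.
Implicit Types f g : field3 R.

Definition fre f (i : 'I_3) (xi : mR3 R) : R := complex.Re (fourier (cpt f i) xi).
Definition fim f (i : 'I_3) (xi : mR3 R) : R := complex.Im (fourier (cpt f i) xi).

Lemma fourier_abs_sqr f xi :
  fourier_abs f xi ^+ 2 = \sum_(i < 3) (fre f i xi ^+ 2 + fim f i xi ^+ 2).
Proof.
rewrite sqr_sqrtr; last by apply: sumr_ge0 => i _; exact: sqr_ge0.
apply: eq_bigr => i _; rewrite /fre /fim.
case: (fourier (cpt f i) xi) => x y /=.
by rewrite sqr_sqrtr// addr_ge0// sqr_ge0.
Qed.

Lemma fourier_abs_ge0 f xi : 0 <= fourier_abs f xi. Proof. exact: sqrtr_ge0. Qed.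

Lemma fourier_abs_le f xi (y : R) : 0 <= y ->
  \sum_(i < 3) (fre f i xi ^+ 2 + fim f i xi ^+ 2) <= y ^+ 2 -> fourier_abs f xi <= y.
Proof.
move=> y0; rewrite -fourier_abs_sqr => h.
by rewrite -(ler_pXn2r (n := 2))// ?nnegrE// fourier_abs_ge0.
Qed.

Let le_sqr_sum (a b : 'I_3 -> R) i : a i ^+ 2 + b i ^+ 2 <= \sum_(i < 3) (a i ^+ 2 + b i ^+ 2).
Proof.
rewrite (bigD1 i)//= lerDl; apply: sumr_ge0 => j _.
by rewrite addr_ge0// sqr_ge0.
Qed.

Let sum_sqr_le (a b : 'I_3 -> R) : (forall i, 0 <= a i) -> (forall i, 0 <= b i) ->
  \sum_(i < 3) (a i ^+ 2 + b i ^+ 2) <= (\sum_(i < 3) (a i + b i)) ^+ 2.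
Proof.
move=> a0 b0; rewrite !sum3E.
have := a0 0; have := b0 0; have := a0 1; have := b0 1; have := a0 2; have := b0 2.
move: (a 0) (b 0) (a 1) (b 1) (a 2) (b 2) => {a0 b0} c d e h k l.
move=> l0 k0 h0 e0 d0 c0.
rewrite -subr_ge0 (_ : _ - _ = 2 * (c * (d + e + h + k + l) + d * (e + h + k + l) +
  e * (h + k + l) + h * (k + l) + k * l)); last by ring.
by rewrite !(mulr_ge0, addr_ge0).
Qed.

Lemma fre_le f i xi : `|fre f i xi| <= fourier_abs f xi.
Proof.
rewrite -(ler_pXn2r (n := 2))// ?nnegrE ?fourier_abs_ge0// real_normK ?num_real//.
rewrite fourier_abs_sqr; apply: le_trans (le_sqr_sum (fre f ^~ xi) (fim f ^~ xi) i).
by rewrite lerDl sqr_ge0.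
Qed.

Lemma fim_le f i xi : `|fim f i xi| <= fourier_abs f xi.
Proof.
rewrite -(ler_pXn2r (n := 2))// ?nnegrE ?fourier_abs_ge0// real_normK ?num_real//.
rewrite fourier_abs_sqr; apply: le_trans (le_sqr_sum (fre f ^~ xi) (fim f ^~ xi) i).
by rewrite lerDr sqr_ge0.
Qed.

Lemma fourier_abs_le_sum f xi :
  fourier_abs f xi <= \sum_(i < 3) (`|fre f i xi| + `|fim f i xi|).
Proof.
apply: fourier_abs_le; first by apply: sumr_ge0 => i _; rewrite addr_ge0.
have := sum_sqr_le (fun i => normr_ge0 (fre f i xi)) (fun i => normr_ge0 (fim f i xi)).
apply: le_trans; apply: ler_sum => i _.
by rewrite !real_normK ?num_real.
Qed.

Lemma has_fourierP f i : has_fourier f -> [/\ cpt f i \in Lfun (leb3 R) 2%:E,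
  fre f i \in Lfun (leb3 R) 2%:E, fim f i \in Lfun (leb3 R) 2%:E &
  weakF (cpt f i) (fre f i) (fim f i)].
Proof. by move=> /(_ i) F; have [h1 h2 h3 _] := F; split => //; exact: is_fourier_weakF. Qed.

Lemma measurable_fre f i : has_fourier f -> measurable_fun setT (fre f i).
Proof. by move=> /(has_fourierP i)[_ /Lfun_measurable]. Qed.

Lemma measurable_fim f i : has_fourier f -> measurable_fun setT (fim f i).
Proof. by move=> /(has_fourierP i)[_ _ /Lfun_measurable]. Qed.

Lemma measurable_sqrtR : measurable_fun setT (@Num.sqrt R).
Proof. apply: measurable_cont; exact: sqrt_continuous. Qed.

Lemma measurable_fourier_abs f : has_fourier f ->
  measurable_fun setT (fourier_abs f : mR3 R -> R).
Proof.
move=> Ff; rewrite (_ : fourier_abs f = fun xi => Num.sqrt (\sum_(i < 3)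
    (fre f i xi ^+ 2 + fim f i xi ^+ 2))).
  apply: (measurableT_comp measurable_sqrtR).
  apply: measurable_sum => i; apply: measurable_funD; apply: measurable_funX.
    exact: measurable_fre.
  exact: measurable_fim.
apply/funext => xi; rewrite -fourier_abs_sqr sqrtr_sqr ger0_norm//.
exact: fourier_abs_ge0.
Qed.

Lemma measurable_len3 : measurable_fun setT (len3 : mR3 R -> R).
Proof.
apply: (measurableT_comp measurable_sqrtR).
by apply: measurable_sum => i; apply: measurable_funM; exact: measurable_coord3.
Qed.

Lemma measurable_len3_powR (m : R) : measurable_fun setT (fun x : mR3 R => len3 x `^ m).
Proof.
by apply: (measurableT_comp (f := (@powR R)^~ m)) measurable_len3; exact: measurable_powR.
Qed.

Lemma coord3_le (xi : R3 R) k : `|coord3 xi k| <= len3 xi.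
Proof.
rewrite -(ler_pXn2r (n := 2))// ?nnegrE ?len3_ge0// real_normK ?num_real//.
rewrite len3_sqr /dot3 (bigD1 k)//= expr2 lerDl.
by apply: sumr_ge0 => j _; rewrite -expr2 sqr_ge0.
Qed.

Lemma tempered0 : tempered (fun _ : mR3 R => 0 : R).
Proof. by apply: (tempered_bounded (C := 0)) => // x; rewrite normr0. Qed.

(** [weakF_div] provides a transform of the distributional divergence, which is 0; uniqueness
    compares it with the transform 0. *)
Lemma div_free_fourier f : has_fourier f -> div_free f ->
  {ae leb3 R, forall x : mR3 R, \sum_(k < 3) coord3 x k * fre f k x = 0} /\
  {ae leb3 R, forall x : mR3 R, \sum_(k < 3) coord3 x k * fim f k x = 0}.
Proof.
move=> Ff df.
have f2 k : cpt f k \in Lfun (leb3 R) 2%:E by have [] := has_fourierP k Ff.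
have tp k : tempered (fre f k) by have [_ ? _ _] := has_fourierP k Ff; exact: tempered_L2.
have tq k : tempered (fim f k) by have [_ _ ? _] := has_fourierP k Ff; exact: tempered_L2.
have w k : weakF (cpt f k) (fre f k) (fim f k) by have [] := has_fourierP k Ff.
have : weakF (fun _ : mR3 R => 0 : R) (fun x => \sum_(k < 3) - (coord3 x k * fim f k x))
    (fun x => \sum_(k < 3) coord3 x k * fre f k x).
  apply: (weakF_div f2 tp tq w) => phi tphi.
  transitivity (0 : R); first by under eq_Rintegral do rewrite mul0r; rewrite /Rintegral integral0.
  rewrite -(Rintegral_fun_sum _ (h := fun k (x : mR3 R) => cpt f k x * 'D_(dir3 k) phi x)).
    by have := df _ (tensor_sum_schwartz tphi) => /= ->; rewrite oppr0.
  move=> k _; apply: integrable_L2M => //.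
  exact/tensor_sum_L2/tensor_sum_derive.
have w0 : weakF (fun _ : mR3 R => 0 : R) (fun _ : mR3 R => 0) (fun _ : mR3 R => 0).
  by move=> phi _; split; under eq_Rintegral do rewrite mul0r;
    under [in RHS]eq_Rintegral do rewrite mul0r; rewrite /Rintegral integral0 ?oppr0.
move=> w'.
have h : {ae leb3 R, forall x : mR3 R, \sum_(k < 3) - (coord3 x k * fim f k x) = 0 /\
    \sum_(k < 3) coord3 x k * fre f k x = 0}.
  apply: (weakF_unique _ _ tempered0 tempered0 w' w0).
    by apply: tempered_sum3 => k; exact/temperedN/temperedX.
  by apply: tempered_sum3 => k; exact/temperedX.
by split; apply: filterS h => x []// /eqP; rewrite sumrN oppr_eq0 => /eqP.
Qed.

Lemma partial_weakF f g (k i : 'I_3) : has_fourier f -> is_partial k f g ->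
  cpt g i \in Lfun (leb3 R) 2%:E /\
  weakF (cpt g i) (fun x => - (coord3 x k * fim f i x)) (fun x => coord3 x k * fre f i x).
Proof.
move=> Ff /(_ i)[_ [g2 fg]]; split => //.
have [f2 p2 q2 w] := has_fourierP i Ff.
(* A single partial derivative is the divergence of the field whose k-th component alone is nonzero,
   so [weakF_div] applies. *)
pose F l := if l == k then cpt f i else fun=> 0 : R.
pose p l := if l == k then fre f i else fun=> 0 : R.
pose q l := if l == k then fim f i else fun=> 0 : R.
have z2 : (fun _ : mR3 R => 0 : R) \in Lfun (leb3 R) 2%:E 
  by apply: fun_L2 => //; apply: (eq_integrable _ (cst 0%E)) => //;
    [move=> x _; rewrite /= expr0n|exact: integrable0].
have w0 : weakF (fun _ : mR3 R => 0 : R) (fun _ : mR3 R => 0) (fun _ : mR3 R => 0).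
  by move=> phi _; split; under eq_Rintegral do rewrite mul0r;
    under [in RHS]eq_Rintegral do rewrite mul0r; rewrite /Rintegral integral0 ?oppr0.
have F2 l : F l \in Lfun (leb3 R) 2%:E by rewrite /F; case: eqP.
have tp l : tempered (p l) by rewrite /p; case: eqP => _; exact: tempered_L2.
have tq l : tempered (q l) by rewrite /q; case: eqP => _; exact: tempered_L2.
have wl l : weakF (F l) (p l) (q l) by rewrite /F /p /q; case: eqP.
have := weakF_div F2 tp tq wl.
move=> /(_ (cpt g i)) H phi tphi; have [|<- <-] := H _ phi tphi.
  move=> psi tpsi; rewrite (fg _ (tensor_sum_schwartz tpsi)) (bigD1 k)//= big1.
    by rewrite addr0 /F eqxx.
  move=> l /negPf lk; rewrite /F lk.
  by under eq_Rintegral do rewrite mul0r; rewrite /Rintegral integral0.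
split; apply: eq_Rintegral => x _; congr (_ * _).
  rewrite (bigD1 k)//= big1 ?addr0 /q ?eqxx// => l /negPf lk.
  by rewrite lk mulr0 oppr0.
rewrite (bigD1 k)//= big1 ?addr0 /p ?eqxx// => l /negPf lk.
by rewrite lk mulr0.
Qed.

End Spectrum.

Section ConvectionBound.
Context {R : realType}.
Notation mu := (@lebesgue_measure R).
Implicit Types f g : field3 R.

Lemma Rintegral_EFin d (T : measurableType d) (m : {measure set T -> \bar R}) (f : T -> R) :
  m.-integrable setT (EFin \o f) -> (\int[m]_x (f x)%:E)%E = (\int[m]_x f x)%:E.
Proof. by move=> If; rewrite /Rintegral fineK//; exact: integrable_fin_num. Qed.

Lemma Rintegral_le_EFin d (T : measurableType d) (m : {measure set T -> \bar R}) (f : T -> R) (c : R) :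
  m.-integrable setT (EFin \o f) ->
  ((\int[m]_x (f x)%:E <= c%:E)%E = (\int[m]_x f x <= c)).
Proof. by move=> If; rewrite (Rintegral_EFin If) lee_fin. Qed.

Lemma integrable_ae_le d (T : measurableType d) (m : {measure set T -> \bar R}) (f g : T -> R) :
  measurable_fun setT f -> m.-integrable setT (EFin \o g) ->
  {ae m, forall x, `|f x| <= g x} -> m.-integrable setT (EFin \o f).
Proof.
move=> mf Ig fg; have mg := integrable_measurable Ig.
apply/integrableP; split; first exact/measurable_EFinP.
have /integrableP[_] := integrable_funn Ig; apply: le_lt_trans.
apply: ae_ge0_le_integral => //.
- by apply/measurable_EFinP; exact: measurableT_comp.
- by apply/measurable_EFinP; do 2 apply: measurableT_comp => //.
- apply: filterS fg => x fgx _ /=; rewrite lee_fin normr_id.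
  exact: le_trans fgx (ler_norm _).
Qed.

Lemma Rintegral_ae_le d (T : measurableType d) (m : {measure set T -> \bar R}) (f g : T -> R) :
  m.-integrable setT (EFin \o f) -> m.-integrable setT (EFin \o g) ->
  (forall x, 0 <= f x) -> (forall x, 0 <= g x) ->
  {ae m, forall x, f x <= g x} -> \int[m]_x f x <= \int[m]_x g x.
Proof.
move=> If Ig f0 g0 fg; rewrite -(Rintegral_le_EFin _ If) -(Rintegral_EFin Ig).
apply: ae_ge0_le_integral => //.
- by move=> x _; rewrite lee_fin.
- exact: measurable_int If.
- by move=> x _; rewrite lee_fin.
- exact: measurable_int Ig.
- by apply: filterS fg => x fgx _; rewrite lee_fin.
Qed.

Variables f adv : field3 R.
Hypotheses (Ff : has_fourier f) (df : div_free f) (Fadv : has_fourier adv).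
Hypothesis fadv : is_advection f adv.
Hypothesis IN : (leb3 R).-integrable setT (EFin \o (fourier_abs f : mR3 R -> R)).
Let N := \int[leb3 R]_xi fourier_abs f xi.

Let Iabs (r : mR3 R -> R) : measurable_fun setT r -> (forall xi, `|r xi| <= fourier_abs f xi) ->
  (leb3 R).-integrable setT (EFin \o r).
Proof. by move=> mr; exact: integrable_dom mr IN. Qed.

Let Ire k : (leb3 R).-integrable setT (EFin \o fre f k).
Proof. by apply: Iabs (measurable_fre k Ff) _ => xi; exact: fre_le. Qed.

Let Iim k : (leb3 R).-integrable setT (EFin \o fim f k).
Proof. by apply: Iabs (measurable_fim k Ff) _ => xi; exact: fim_le. Qed.

(** [al] and [be] select the real or the imaginary part. In [convection_repr] each factor xi_k is at
    most |xi|, which cancels the inverse, and the modulus of each [A k] is at most twice the product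
    of the two values of [fourier_abs f]. Hence each of the three [W k] has L1 norm at most 2 N^2,
    and 6 = 3 . 2. *)
Let component (al be : R) j : `|al| + `|be| <= 1 ->
  let v xi := (len3 xi)^-1 * `|al * fre adv j xi + be * fim adv j xi| in
  (leb3 R).-integrable setT (EFin \o (v : mR3 R -> R)) /\
  \int[leb3 R]_xi v xi <= 6 * (2 * pi) ^- 3 * N ^+ 2.
Proof.
move=> albe v; have [D hD advE] := fadv.
have [a2 ra2 ia2 wa] := has_fourierP j Fadv.
have u2 k : cpt f k \in Lfun (leb3 R) 2%:E by have [] := has_fourierP k Ff.
have wu k : weakF (cpt f k) (fre f k) (fim f k) by have [] := has_fourierP k Ff.
have g2 k : cpt (D k) j \in Lfun (leb3 R) 2%:E by have [] := partial_weakF j Ff (hD k).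
have wg k : weakF (cpt (D k) j) (fun x => - (coord3 x k * fim f j x))
    (fun x => coord3 x k * fre f j x) by have [] := partial_weakF j Ff (hD k).
have [d1 d2] := div_free_fourier Ff df.
have wE x : cpt adv j x = \sum_(k < 3) cpt f k x * cpt (D k) j x.
  by rewrite /cpt advE summxE; apply: eq_bigr => k _; rewrite mxE.
have [W [hW WE]] := convection_repr al be u2 g2 Ire Iim (Ire j) (Iim j) wu wg d1 d2
  (tempered_L2 ra2) (tempered_L2 ia2) a2 wa wE.
have IW k : (leb3 R).-integrable setT (EFin \o W k) by have [] := hW k.
have IAW k : (leb3 R).-integrable setT (EFin \o (fun x => `|W k x|)) := integrable_funn (IW k).
have WN k : \int[leb3 R]_x `|W k x| <= 2 * N ^+ 2.
  rewrite -Rintegral_le_EFin//; have [_ /le_trans] := hW k; apply.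
  have IFF := integrable_funZ 2 (integrable_tensor6 IN IN).
  apply: (@le_trans _ _ (\int[leb6]_z (2 * (fourier_abs f z.1 * fourier_abs f z.2))%:E)%E).
    apply: ge0_le_integral => //.
    - apply/measurable_EFinP; apply: measurableT_comp => //.
      have m1 (r : mR3 R -> R) : measurable_fun setT r -> measurable_fun setT (r \o fst : mR3 R * mR3 R -> R).
        by move=> mr; exact: (measurableT_comp mr measurable_fst).
      have m2 (r : mR3 R -> R) : measurable_fun setT r -> measurable_fun setT (r \o snd : mR3 R * mR3 R -> R).
        by move=> mr; exact: (measurableT_comp mr measurable_snd).
      have [m1r m1i] := (m1 _ (measurable_fre j Ff), m1 _ (measurable_fim j Ff)).
      have [m2r m2i] := (m2 _ (measurable_fre k Ff), m2 _ (measurable_fim k Ff)).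
      apply: measurable_funB; apply: measurable_funM => //.
        by apply: measurable_funB; exact: measurable_funM.
      by apply: measurable_funD; exact: measurable_funM.
    - exact: measurable_int IFF.
    - move=> [x y] _ /=; rewrite lee_fin.
      have [r1 i1] := (fre_le f j x, fim_le f j x); have [r2 i2] := (fre_le f k y, fim_le f k y).
      have h (c d s t : R) : `|c| + `|d| <= 1 -> `|s| <= fourier_abs f x -> `|t| <= fourier_abs f x ->
          `|c * s + d * t| <= fourier_abs f x.
        move=> cd sx tx; apply: le_trans (ler_normD _ _) _; rewrite !normrM.
        apply: (@le_trans _ _ ((`|c| + `|d|) * fourier_abs f x)).
          by rewrite mulrDl lerD// ler_wpM2l.
        by rewrite ler_piMl// fourier_abs_ge0.
      apply: le_trans (ler_normB _ _) _; rewrite !normrM mulr2n mulrDl !mul1r lerD// ler_pM//.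
        by rewrite -mulrN; apply: h; rewrite ?normrN// addrC.
      exact: h.
  rewrite (_ : (\int[leb6]_z _)%E = (2 * N ^+ 2)%:E)//.
  rewrite (Rintegral_EFin IFF) (RintegralZl _ measurableT (integrable_tensor6 IN IN)).
  congr (_%:E); congr (_ * _); rewrite Rfubini6_1; last exact: integrable_tensor6.
  rewrite /= expr2 {1}/N -(RintegralZr N measurableT IN).
  by apply: eq_Rintegral => x _; rewrite /= (RintegralZl _ measurableT IN).
pose V x := (2 * pi) ^- 3 * \sum_(k < 3) `|W k x|.
have IV : (leb3 R).-integrable setT (EFin \o V).
  by apply: integrable_funZ; apply: integrable_fun_sum.
have pi0 : 0 <= (2 * pi) ^- 3 :> R by rewrite invr_ge0 exprn_ge0// mulr_ge0// pi_ge0.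
have vV : {ae leb3 R, forall x : mR3 R, v x <= V x}.
  apply: filterS WE => x; rewrite /v /V => ->.
  rewrite normrM ger0_norm// mulrCA ler_wpM2l//.
  (* At the origin the inverse of 0 is 0, so the left-hand side vanishes. *)
  have [x0|x0] := eqVneq (len3 x) 0; first by rewrite x0 invr0 mul0r sumr_ge0.
  have {}x0 : 0 < len3 x by rewrite lt_neqAle eq_sym x0 len3_ge0.
  rewrite ler_pdivrMl//; apply: le_trans (ler_norm_sum _ _ _) _.
  by rewrite mulr_sumr; apply: ler_sum => k _; rewrite normrM ler_wpM2r// coord3_le.
have mv : measurable_fun setT (v : mR3 R -> R).
  apply: measurable_funM.
    rewrite (_ : (fun x : mR3 R => (len3 x)^-1) = (fun x : mR3 R => len3 x `^ (- 1))).
      exact: measurable_len3_powR.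
    by apply/funext => x; rewrite powR_inv1// len3_ge0.
  apply: measurableT_comp => //; apply: measurable_funD; apply: measurable_funM => //.
    exact: measurable_fre.
  exact: measurable_fim.
have v0 x : 0 <= v x by rewrite mulr_ge0// invr_ge0 len3_ge0.
have V0 x : 0 <= V x by rewrite mulr_ge0// sumr_ge0.
have Iv : (leb3 R).-integrable setT (EFin \o (v : mR3 R -> R)).
  apply: integrable_ae_le mv IV _; apply: filterS vV => x.
  by rewrite ger0_norm.
split => //; apply: le_trans (Rintegral_ae_le Iv IV v0 V0 vV) _.
rewrite (RintegralZl _ measurableT); last exact: integrable_fun_sum.
rewrite (Rintegral_fun_sum _ (h := fun k x => `|W k x|)) => [|k _]; last exact: IAW.
rewrite (mulrC 6) -mulrA ler_wpM2l// sum3E.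
have := WN 0; have := WN 1; have := WN 2; lra.
Qed.

(** The three real and three imaginary parts are each bounded by 6 (2 pi)^-3 N^2, whence 36. *)
Lemma convection_le :
  let V xi := (len3 xi)^-1 * fourier_abs adv xi in
  (leb3 R).-integrable setT (EFin \o (V : mR3 R -> R)) /\
  \int[leb3 R]_xi V xi <= 36 * (2 * pi) ^- 3 * N ^+ 2.
Proof.
move=> V.
pose r j (xi : mR3 R) := (len3 xi)^-1 * `|1 * fre adv j xi + 0 * fim adv j xi|.
pose i j (xi : mR3 R) := (len3 xi)^-1 * `|0 * fre adv j xi + 1 * fim adv j xi|.
have hr j : (leb3 R).-integrable setT (EFin \o r j) /\
    \int[leb3 R]_xi r j xi <= 6 * (2 * pi) ^- 3 * N ^+ 2.
  by apply: component; rewrite normr1 normr0 addr0.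
have hi j : (leb3 R).-integrable setT (EFin \o i j) /\
    \int[leb3 R]_xi i j xi <= 6 * (2 * pi) ^- 3 * N ^+ 2.
  by apply: component; rewrite normr1 normr0 add0r.
have Iri j : (leb3 R).-integrable setT (EFin \o (fun xi => r j xi + i j xi)).
  by apply: integrable_funD; [exact: (hr j).1|exact: (hi j).1].
have V0 xi : 0 <= V xi by rewrite mulr_ge0 ?fourier_abs_ge0// invr_ge0 len3_ge0.
have VS xi : V xi <= \sum_(j < 3) (r j xi + i j xi).
  rewrite (eq_bigr (fun j => (len3 xi)^-1 * (`|fre adv j xi| + `|fim adv j xi|))).
    by rewrite -mulr_sumr ler_wpM2l ?invr_ge0 ?len3_ge0// fourier_abs_le_sum.
  by move=> j _; rewrite /r /i !mul1r !mul0r addr0 add0r mulrDr.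
have mV : measurable_fun setT (V : mR3 R -> R).
  apply: measurable_funM; last exact: measurable_fourier_abs.
  rewrite (_ : (fun x : mR3 R => (len3 x)^-1) = (fun x : mR3 R => len3 x `^ (- 1))).
    exact: measurable_len3_powR.
  by apply/funext => x; rewrite powR_inv1// len3_ge0.
have IS : (leb3 R).-integrable setT (EFin \o (fun xi => \sum_(j < 3) (r j xi + i j xi))).
  exact: integrable_fun_sum.
have IV : (leb3 R).-integrable setT (EFin \o (V : mR3 R -> R)).
  by apply: integrable_dom mV IS _ => xi; rewrite ger0_norm.
split => //; apply: le_trans (le_Rintegral measurableT IV IS (fun xi _ => VS xi)) _.
rewrite (Rintegral_fun_sum _ (h := fun j xi => r j xi + i j xi)) => [|j _]; last exact: Iri.
rewrite (eq_bigr (fun j => \int[leb3 R]_xi r j xi + \int[leb3 R]_xi i j xi)); last first.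
  by move=> j _; exact: (RintegralD measurableT (hr j).1 (hi j).1).
apply: le_trans (ler_sum _ _) _ => [j _|].
  exact: lerD (hr j).2 (hi j).2.
by rewrite sum3E; apply: eq_ler; ring.
Qed.

End ConvectionBound.

(** * Integrability of arbitrary Schwartz functions *)

Section SchwartzSquareIntegrable.
Context {R : realType}.

(** Continuity refers to the product topology and measurability to the product sigma-algebra. They
    are linked by writing an open set as a countable union of small boxes with rational centres. *)
Lemma measurable_cont3 (phi : mR3 R -> R) : continuous (phi : R3 R -> R) ->
  measurable_fun setT phi.
Proof.
move=> cphi mD; apply: (measurability _ (RGenOInfty.measurableE R)) => //.
move=> _ [_ [a ->] <-]; rewrite setTI.
pose box (n : nat) (q1 q2 q3 : rat) : set (mR3 R) :=
  [set x : mR3 R | `|ratr q1 - x.1.1| < n.+1%:R^-1 /\ `|ratr q2 - x.1.2| < n.+1%:R^-1 /\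
    `|ratr q3 - x.2| < n.+1%:R^-1].
have mbox n q1 q2 q3 : measurable (box n q1 q2 q3).
  have h (c : R) (k : 'I_3) : measurable [set x : mR3 R | `|c - coord3 x k| < n.+1%:R^-1].
    rewrite -[X in measurable X]setTI.
    apply: (measurable_fun_ltr (f := fun x : mR3 R => `|c - coord3 x k|)) => //.
    by apply: measurableT_comp => //; apply: measurable_funB => //; exact: measurable_coord3.
  exact: (measurableI _ _ (h (ratr q1) 0) (measurableI _ _ (h (ratr q2) 1) (h (ratr q3) 2))).
pose O := phi @^-1` `]a, +oo[.
have oO : open (O : set (R3 R)).
  by apply: open_comp (rray_open a) => x _; exact: cphi.
rewrite (_ : phi @^-1` _ = \bigcup_n \bigcup_q1 \bigcup_q2 \bigcup_q3
  (if `[< box n q1 q2 q3 `<=` O >] then box n q1 q2 q3 else set0)).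
  apply: bigcupT_measurable => n; do 3 apply: bigcupT_measurable_rat => ?.
  by case: ifP.
apply/seteqP; split => [x Ox|x [n _ [q1 _ [q2 _ [q3 _]]]]]; last first.
  by case: ifP => // /asboolP; exact.
have /nbhs_ballP[e /= e0 eO] : nbhs (x : R3 R) O by exact: open_nbhs_nbhs.
have [n ne] : exists n : nat, n.+1%:R^-1 < e / 2.
  exists (Num.truncn (2 / e)); rewrite -[ltRHS]invf_div ltf_pV2 ?posrE ?divr_gt0//.
  exact: truncnS_gt.
have n0 : 0 < n.+1%:R^-1 :> R by rewrite invr_gt0.
have Q (t : R) : exists q : rat, `|ratr q - t| < n.+1%:R^-1.
  have /rat_in_itvoo[q] : t - n.+1%:R^-1 < t + n.+1%:R^-1 by rewrite ltrBlDr -addrA ltrDl addr_gt0.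
  by rewrite in_itv/= => h; exists q; rewrite ltr_distl.
have [[[q1 h1] [q2 h2]] [q3 h3]] := (Q x.1.1, Q x.1.2, Q x.2).
exists n => //; exists q1 => //; exists q2 => //; exists q3 => //.
have D (c s r : R) : `|c - s| < n.+1%:R^-1 -> `|c - r| < n.+1%:R^-1 -> ball s e r.
  move=> cs cr; rewrite /ball/= (_ : s - r = (c - r) - (c - s)); last by ring.
  by apply: le_lt_trans (ler_normB _ _) _; rewrite [e]splitr ltrD// (lt_trans _ ne).
have -> : `[< box n q1 q2 q3 `<=` O >] by apply/asboolP => y [y1 [y2 y3]];
  apply: eO; split; [split|]; apply: D; eassumption.
by split.
Qed.

Lemma schwartz_dominated (phi : R3 R -> R) : schwartz phi -> exists C : R,
  forall x, `|phi x| <= C * ((1 + x.1.1 ^+ 2)^-1 * (1 + x.1.2 ^+ 2)^-1 * (1 + x.2 ^+ 2)^-1).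
Proof.
(* Decay of order 6 = 2 + 2 + 2, because each of the three factors 1 + x_k^2 is at most (1 +
   |x|)^2. *)
move=> /(_ [::])[_ _ /(_ 6%N)[C hC]]; exists C => x.
have h (k : 'I_3) : 1 + coord3 x k ^+ 2 <= (1 + len3 x) ^+ 2.
  have := len3_ge0 x; have := coord3_le x k; rewrite ler_norml => /andP[? ?] ?.
  by rewrite sqrrD expr1n mul1r; nra.
have p (k : 'I_3) : 0 < 1 + coord3 x k ^+ 2 by rewrite ltr_pwDl// sqr_ge0.
have := p 0; have := p 1; have := p 2; have := h 0; have := h 1; have := h 2.
rewrite coord30 coord31 coord32 => h3 h2 h1 p3 p2 p1.
rewrite -!invfM ler_pdivlMr ?mulr_gt0//; apply: le_trans (hC x).
rewrite mulrC ler_wpM2r// (_ : 6%N = (2 + 2 + 2)%N)// !exprD.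
by rewrite !ler_pM ?mulr_ge0 ?(ltW p1) ?(ltW p2) ?(ltW p3).
Qed.

Lemma schwartz_measurable (phi : R3 R -> R) : schwartz phi ->
  measurable_fun setT (phi : mR3 R -> R).
Proof. by move=> /(_ [::])[c _ _]; exact: measurable_cont3. Qed.

Lemma schwartz_integrable (phi : R3 R -> R) : schwartz phi ->
  (leb3 R).-integrable setT (EFin \o (phi : mR3 R -> R)).
Proof.
move=> sphi; have [C hC] := schwartz_dominated sphi.
have I := @integrable_oneDsqrV R.
have IB := integrable_funZ C (integrable_tensor3 I I I).
exact: integrable_dom (schwartz_measurable sphi) IB hC.
Qed.

Lemma integrable_bounded_L2 (phi : mR3 R -> R) (C : R) :
  (leb3 R).-integrable setT (EFin \o phi) -> (forall x, `|phi x| <= C) ->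
  phi \in Lfun (leb3 R) 2%:E.
Proof.
move=> Iphi hC; apply: fun_L2; first exact: integrable_measurable Iphi.
by have := integrable_mul_bounded (integrable_measurable Iphi) hC Iphi.
Qed.

Lemma schwartz_L2 (phi : R3 R -> R) : schwartz phi -> (phi : mR3 R -> R) \in Lfun (leb3 R) 2%:E.
Proof.
move=> sphi; have [C hC] : exists C : R, forall x, `|phi x| <= C.
  by have [_ _ /(_ 0%N)[C hC]] := sphi [::]; exists C => x; have := hC x; rewrite mul1r.
exact: integrable_bounded_L2 (schwartz_integrable sphi) hC.
Qed.

End SchwartzSquareIntegrable.

(** * Square integrability of Fourier transforms *)

Section Bessel.
Context {R : realType}.
Notation mu := (@lebesgue_measure R).
Implicit Types p q : mR3 R -> R.

Lemma integral_nondecreasing_le d (T : measurableType d) (m : {measure set T -> \bar R})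
    (g : nat -> T -> \bar R) (g' : T -> \bar R) (C : \bar R) :
  (forall n, measurable_fun setT (g n)) -> (forall n x, (0 <= g n x)%E) ->
  (forall x, {homo (g ^~ x) : a b / (a <= b)%N >-> (a <= b)%E}) ->
  (forall x, g n x @[n --> \oo] --> g' x) ->
  (forall n, (\int[m]_x g n x <= C)%E) -> (\int[m]_x g' x <= C)%E.
Proof.
move=> mg g0 ndg gg' gC.
have := @cvg_monotone_convergence _ _ _ m setT measurableT g mg
  (fun n x _ => g0 n x) (fun x _ => ndg x).
rewrite (_ : (fun x => limn _) = g'); last by apply/funext => x; exact: cvg_lim (gg' x).
by apply: cvge_le; exact: nearW.
Qed.

Lemma gauss3_le1 (a c x : R3 R) : pos3 a -> gauss3 a c x <= 1.
Proof.
move=> [a1 a2 a3]; have g0 (b e y : R) := ltW (gauss_gt0 b e y).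
by rewrite /gauss3 !mulr_ile1 ?mulr_ge0 ?g0 ?gauss_le1// ltW.
Qed.

Lemma gauss3_ge0 (a c x : R3 R) : 0 <= gauss3 a c x.
Proof. by rewrite /gauss3 !mulr_ge0// expR_ge0. Qed.

Lemma Rintegral_gauss3 (a c : R3 R) : pos3 a -> \int[leb3 R]_x gauss3 a c x = gauss_mass3 a.
Proof.
move=> [a1 a2 a3]; have I (b e : R) : 0 < b -> mu.-integrable setT (EFin \o gauss b e).
  by move=> b0; exact/schwartz1_integrable/schwartz1_gauss.
rewrite (Rintegral_tensor3 (I _ _ a1) (I _ _ a2) (I _ _ a3)).
by rewrite !Rintegral_gauss.
Qed.

Lemma mul_le_half_sqr (b c : R) : b * c <= 2^-1 * (b ^+ 2 + c ^+ 2).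
Proof. by have := sqr_ge0 (b - c); rewrite sqrrB; lra. Qed.

Section Energy.
Variable p : mR3 R -> R.
Hypotheses (Ip : (leb3 R).-integrable setT (EFin \o p))
  (p2 : (leb3 R).-integrable setT (EFin \o (fun x => p x ^+ 2))).
Variable a : R3 R.
Hypothesis a0 : pos3 a.
Let G := gauss3 a 0 : mR3 R -> R.
Let Gm (w : R3 R) := gauss_mass3 a * gauss3 (dual3 a) 0 w.

Let IG : (leb3 R).-integrable setT (EFin \o G).
Proof. exact/tensor_sum_integrable/tensor_sum_gauss3. Qed.

Let M0 : 0 <= gauss_mass3 a.
Proof. by rewrite !mulr_ge0// sqrtr_ge0. Qed.

Let Gm_ge0 w : 0 <= Gm w. Proof. by rewrite mulr_ge0// gauss3_ge0. Qed.

Let IGm : (leb3 R).-integrable setT (EFin \o (Gm : mR3 R -> R)).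
Proof. by apply: integrable_funZ; exact/tensor_sum_integrable/tensor_sum_gauss3/dual3_pos. Qed.

Let Gm_int : \int[leb3 R]_w Gm w = (2 * pi) ^+ 3.
Proof.
rewrite RintegralZl//; last exact/tensor_sum_integrable/tensor_sum_gauss3/dual3_pos.
by rewrite Rintegral_gauss3 ?gauss_mass3_dual//; exact: dual3_pos.
Qed.

Let GmN w : Gm (- w) = Gm w.
Proof. by rewrite /Gm /gauss3 /gauss /=; congr (_ * (expR _ * expR _ * expR _)); ring. Qed.

Let Gm_cos w : cosT3 G w = Gm w.
Proof.
have [-> _] := trigT3_gauss3 0 w a0.
by rewrite (_ : dot3 0 w = 0) ?cos0 ?mulr1// /dot3 big1// => i _; case: i => -[|[|[|]]]//= ?; rewrite mul0r.
Qed.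

Let mGm2 : measurable_fun setT (fun z : mR3 R * mR3 R => Gm ((z.1 : R3 R) - z.2)).
Proof.
apply: (measurableT_comp (f := Gm : mR3 R -> R)); first exact: integrable_measurable IGm.
have := measurableT_comp measurable_add3 (measurable_fun_pair
  (@measurable_fst _ _ (mR3 R) (mR3 R)) (measurableT_comp measurable_opp3
  (@measurable_snd _ _ (mR3 R) (mR3 R)))).
exact.
Qed.

Let half (z : mR3 R * mR3 R) := p z.1 ^+ 2 * Gm ((z.1 : R3 R) - z.2).

Let mp : measurable_fun setT p := integrable_measurable Ip.

Let Gm_shift (y : R3 R) : (\int[leb3 R]_z (Gm (y - z))%:E = ((2 * pi) ^+ 3)%:E)%E.
Proof.
rewrite (eq_integral (fun z => (Gm (shift3 (- y) z))%:E)); last first.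
  by move=> z _; rewrite -GmN opprB.
rewrite (ge0_integral_shift3 (- y) (f := fun z => (Gm z)%:E)).
- by rewrite (Rintegral_EFin IGm) Gm_int.
- exact: measurable_int IGm.
- by move=> x; rewrite lee_fin.
Qed.

Let half_int : leb6.-integrable setT (EFin \o half) /\
  \int[leb6]_z half z = (2 * pi) ^+ 3 * \int[leb3 R]_x p x ^+ 2.
Proof.
have mh : measurable_fun setT half.
  apply: measurable_funM => //; apply: measurable_funX.
  exact: (measurableT_comp mp measurable_fst).
have h0 z : 0 <= half z by rewrite mulr_ge0// sqr_ge0.
have E : (\int[leb6]_z (half z)%:E = ((2 * pi) ^+ 3 * \int[leb3 R]_x p x ^+ 2)%:E)%E.
  rewrite tonelli6_1//; last exact/measurable_EFinP.
  rewrite mulrC EFinM -(Rintegral_EFin p2).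
  rewrite -ge0_integralZr//; [|exact: measurable_int p2
    |by move=> x _; rewrite lee_fin sqr_ge0|by rewrite lee_fin exprn_ge0// mulr_ge0// pi_ge0].
  apply: eq_integral => x _; rewrite /half /=.
  under eq_integral do rewrite EFinM.
  rewrite ge0_integralZl//; [by rewrite Gm_shift| |by move=> z _; rewrite lee_fin|by rewrite lee_fin sqr_ge0].
  by have /measurable_EFinP := measurable_fun_pair2 x mGm2.
have Ih : leb6.-integrable setT (EFin \o half).
  apply/integrableP; split; first exact/measurable_EFinP.
  rewrite (eq_integral (fun z => (half z)%:E)); first by rewrite E ltry.
  by move=> z _; rewrite /= ger0_norm.
by split => //; apply: EFin_inj; rewrite -(Rintegral_EFin Ih).
Qed.

Let half' (z : mR3 R * mR3 R) := p z.2 ^+ 2 * Gm ((z.1 : R3 R) - z.2).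

Let half'_int : leb6.-integrable setT (EFin \o half') /\
  \int[leb6]_z half' z = (2 * pi) ^+ 3 * \int[leb3 R]_x p x ^+ 2.
Proof.
have [Ih hE] := half_int.
have mh : measurable_fun setT half'.
  apply: measurable_funM => //; apply: measurable_funX.
  exact: (measurableT_comp mp measurable_snd).
have h0 z : 0 <= half' z by rewrite mulr_ge0// sqr_ge0.
have E : (\int[leb6]_z (half' z)%:E = \int[leb6]_z (half z)%:E)%E.
  have half0 z : (0 <= (half z)%:E)%E by rewrite lee_fin mulr_ge0// sqr_ge0.
  rewrite tonelli6_2//; last exact/measurable_EFinP.
  rewrite (tonelli6_1 (measurable_int _ Ih) half0).
  apply: eq_integral => y _; apply: eq_integral => x _.
  by rewrite /half /half' /= -GmN opprB.
have Ih' : leb6.-integrable setT (EFin \o half').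
  apply/integrableP; split; first exact/measurable_EFinP.
  rewrite (eq_integral (fun z => (half' z)%:E)).
    by rewrite E (Rintegral_EFin Ih) ltry.
  by move=> z _; rewrite /= ger0_norm.
by split => //; apply: EFin_inj; rewrite -(Rintegral_EFin Ih') E (Rintegral_EFin Ih) hE.
Qed.

(** Half of Plancherel with a Gaussian regularisation. The left-hand side equals the double integral
    of p y p z Gm (y - z), where Gm is the transform of G and has total mass (2 pi)^3. Bounding p y
    p z by the mean of the squares splits it into [half] and [half'], which have the same
    integral. *)
Lemma trigT3_energy : \int[leb3 R]_x ((cosT3 p x ^+ 2 + sinT3 p x ^+ 2) * G x) <=
  (2 * pi) ^+ 3 * \int[leb3 R]_x p x ^+ 2.
Proof.
have I3 (r : mR3 R -> R) : tempered r -> (leb3 R).-integrable setT (EFin \o (fun x => r x * G x)).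
  by move=> tr; exact: tr.2 _ (tensor_sum_gauss3 0 a0).
have [tc ts] := (tempered_cosT3 Ip, tempered_sinT3 Ip).
have Icc : (leb3 R).-integrable setT (EFin \o (fun x => cosT3 p x * G x)) := I3 _ tc.
have Iss : (leb3 R).-integrable setT (EFin \o (fun x => sinT3 p x * G x)) := I3 _ ts.
pose A y := \int[leb3 R]_z (p z * Gm (y - z)).
have IGc (y : R3 R) := integrable_cosM3 y IG.
have IGs (y : R3 R) := integrable_sinM3 y IG.
have key y : cosT3 (fun x => cosT3 p x * G x) y + sinT3 (fun x => sinT3 p x * G x) y = A y.
  transitivity (\int[leb3 R]_z (p z * cosT3 (fun x => G x * cos (dot3 x y)) z) +
      \int[leb3 R]_z (p z * sinT3 (fun x => G x * sin (dot3 x y)) z)).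
    congr (_ + _).
      rewrite -(trigT3_dual measurable_cos_dot3 (@cos_max R) Ip (IGc y)).
      by apply: eq_Rintegral => x _; exact/esym/mulrA.
    rewrite -(trigT3_dual measurable_sin_dot3 (@sin_max R) Ip (IGs y)).
    by apply: eq_Rintegral => x _; exact/esym/mulrA.
  have J1 : (leb3 R).-integrable setT (EFin \o (fun z => p z * cosT3 (fun x => G x * cos (dot3 x y)) z)).
    have tcy := tempered_cosT3 (IGc y).
    apply: integrable_mul_bounded Ip; first exact: tcy.1.
    move=> z; apply: (trigT3_bounded (h := cos)); [|exact: cos_max|exact: IGc].
    exact: (measurableT_comp measurable_cosR (measurable_dot3l z)).
  have J2 : (leb3 R).-integrable setT (EFin \o (fun z => p z * sinT3 (fun x => G x * sin (dot3 x y)) z)).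
    have tcy := tempered_sinT3 (IGs y).
    apply: integrable_mul_bounded Ip; first exact: tcy.1.
    move=> z; apply: (trigT3_bounded (h := sin)); [|exact: sin_max|exact: IGs].
    exact: (measurableT_comp measurable_sinR (measurable_dot3l z)).
  rewrite -(RintegralD measurableT J1 J2); apply: eq_Rintegral => z _.
  rewrite -mulrDr -Gm_cos; congr (_ * _).
  rewrite -(RintegralD measurableT (integrable_cosM3 z (IGc y)) (integrable_sinM3 z (IGs y))).
  apply: eq_Rintegral => x _.
  by rewrite (dot3C x (y - z)) dot3Bl cosB !(dot3C x) mulrDr !mulrA.
have Ipc : (leb3 R).-integrable setT (EFin \o (fun y => p y * cosT3 (fun x => cosT3 p x * G x) y)).
  apply: integrable_mul_bounded Ip; first exact: (tempered_cosT3 Icc).1.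
  move=> z; apply: (trigT3_bounded (h := cos)); [|exact: cos_max|exact: Icc].
  exact: (measurableT_comp measurable_cosR (measurable_dot3l z)).
have Ips : (leb3 R).-integrable setT (EFin \o (fun y => p y * sinT3 (fun x => sinT3 p x * G x) y)).
  apply: integrable_mul_bounded Ip; first exact: (tempered_sinT3 Iss).1.
  move=> z; apply: (trigT3_bounded (h := sin)); [|exact: sin_max|exact: Iss].
  exact: (measurableT_comp measurable_sinR (measurable_dot3l z)).
have Ic2 : (leb3 R).-integrable setT (EFin \o (fun x => cosT3 p x * (cosT3 p x * G x))).
  have [C hC] : exists C, forall x, `|cosT3 p x| <= C.
    exists (\int[leb3 R]_y `|p y|) => x; apply: (trigT3_bounded (h := cos)) => //; last exact: cos_max.
    exact: (measurableT_comp measurable_cosR (measurable_dot3l x)).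
  have := integrable_mul_bounded tc.1 hC Icc.
  by apply: eq_integrable => // x _ /=; rewrite mulrC.
have Is2 : (leb3 R).-integrable setT (EFin \o (fun x => sinT3 p x * (sinT3 p x * G x))).
  have [C hC] : exists C, forall x, `|sinT3 p x| <= C.
    exists (\int[leb3 R]_y `|p y|) => x; apply: (trigT3_bounded (h := sin)) => //; last exact: sin_max.
    exact: (measurableT_comp measurable_sinR (measurable_dot3l x)).
  have := integrable_mul_bounded ts.1 hC Iss.
  by apply: eq_integrable => // x _ /=; rewrite mulrC.
have -> : \int[leb3 R]_x ((cosT3 p x ^+ 2 + sinT3 p x ^+ 2) * G x) = \int[leb3 R]_y (p y * A y).
  transitivity (\int[leb3 R]_x (cosT3 p x * (cosT3 p x * G x)) +
      \int[leb3 R]_x (sinT3 p x * (sinT3 p x * G x))).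
    by rewrite -(RintegralD measurableT Ic2 Is2); apply: eq_Rintegral => x _; ring.
  transitivity (\int[leb3 R]_y (p y * cosT3 (fun x => cosT3 p x * G x) y) +
      \int[leb3 R]_y (p y * sinT3 (fun x => sinT3 p x * G x) y)); last first.
    by rewrite -(RintegralD measurableT Ipc Ips); apply: eq_Rintegral => y _; rewrite -key mulrDr.
  congr (_ + _).
    exact: (trigT3_dual measurable_cos_dot3 (@cos_max R) Ip Icc).
  exact: (trigT3_dual measurable_sin_dot3 (@sin_max R) Ip Iss).
have [[Ih hE] [Ih' h'E]] := (half_int, half'_int).
have [C hC] : exists C, forall w : R3 R, `|Gm w| <= C.
  exists (gauss_mass3 a) => w; rewrite normrM (ger0_norm M0) ler_piMr//.
  by rewrite ger0_norm ?gauss3_ge0// gauss3_le1//; exact: dual3_pos.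
have I6 : leb6.-integrable setT (EFin \o (fun z => p z.1 * p z.2 * Gm ((z.1 : R3 R) - z.2))).
  apply: integrable_mul_bounded mGm2 _ (integrable_tensor6 Ip Ip) => z.
  exact: hC.
have -> : \int[leb3 R]_y (p y * A y) = \int[leb6]_z (p z.1 * p z.2 * Gm ((z.1 : R3 R) - z.2)).
  rewrite Rfubini6_1//; apply: eq_Rintegral => y _ /=.
  have Iy : (leb3 R).-integrable setT (EFin \o (fun z => p z * Gm (y - z))).
    apply: integrable_mul_bounded (measurable_fun_pair2 y mGm2) _ Ip => z.
    exact: hC.
  by rewrite /A -(RintegralZl _ measurableT Iy); apply: eq_Rintegral => z _; rewrite mulrA.
have Im := integrable_funZ (2^-1) (integrable_funD Ih Ih').
apply: le_trans (le_Rintegral measurableT I6 Im _) _ => [z _|].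
  rewrite /half /half' -mulrDl mulrA ler_wpM2r//.
  exact: mul_le_half_sqr.
rewrite (RintegralZl _ measurableT (integrable_funD Ih Ih')) (RintegralD measurableT Ih Ih').
have half_double (x : R) : 2^-1 * (x + x) = x by field.
by rewrite hE h'E half_double.
Qed.

End Energy.

(** The Gaussians exp (- |x|^2 / (n + 1)) increase to 1, so monotone convergence removes the
    regularisation from [trigT3_energy]. With this, the pairing of an L2 function with the transform
    of any Schwartz function converges absolutely, which linearity of [is_fourier] requires. *)
Lemma trigT3_L2 p : (leb3 R).-integrable setT (EFin \o p) -> p \in Lfun (leb3 R) 2%:E ->
  (cosT3 p : mR3 R -> R) \in Lfun (leb3 R) 2%:E /\
  (sinT3 p : mR3 R -> R) \in Lfun (leb3 R) 2%:E.
Proof.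
move=> Ip pL2; have p2 : (leb3 R).-integrable setT (EFin \o (fun x => p x ^+ 2)).
  by have := integrable_L2M pL2 pL2.
pose F (x : mR3 R) := cosT3 p x ^+ 2 + sinT3 p x ^+ 2.
have F0 x : 0 <= F x by rewrite addr_ge0// sqr_ge0.
have [[mc _] [ms _]] := (tempered_cosT3 Ip, tempered_sinT3 Ip).
have mF : measurable_fun setT F.
  by apply: measurable_funD; exact: measurable_funX.
pose e (n : nat) : R3 R := (n.+1%:R^-1, n.+1%:R^-1, n.+1%:R^-1).
have e0 n : pos3 (e n) by split; rewrite /= invr_gt0.
have gE n x : gauss3 (e n) 0 x = expR (- (n.+1%:R^-1 * dot3 x x)).
  by rewrite /gauss3 /gauss /e -!expRD dot3E; congr expR; rewrite /=; ring.
have mg n : measurable_fun setT (gauss3 (e n) 0 : mR3 R -> R).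
  exact: tensor_sum_measurable (tensor_sum_gauss3 0 (e0 n)).
have IFg n : (leb3 R).-integrable setT (EFin \o (fun x => F x * gauss3 (e n) 0 x)).
  have [C hC] : exists C, forall x, `|F x| <= C.
    exists ((\int[leb3 R]_y `|p y|) ^+ 2 + (\int[leb3 R]_y `|p y|) ^+ 2) => x.
    have N0 : 0 <= \int[leb3 R]_y `|p y| by exact: Rintegral_ge0.
    rewrite ger0_norm// lerD// -[leLHS]real_normK ?num_real// ler_pXn2r ?nnegrE//.
      apply: (trigT3_bounded (h := cos)) => //; last exact: cos_max.
      exact: (measurableT_comp measurable_cosR (measurable_dot3l x)).
    apply: (trigT3_bounded (h := sin)) => //; last exact: sin_max.
    exact: (measurableT_comp measurable_sinR (measurable_dot3l x)).
  have := integrable_mul_bounded mF hC (tensor_sum_integrable (tensor_sum_gauss3 0 (e0 n))).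
  by apply: eq_integrable => // x _ /=; rewrite mulrC.
have : (\int[leb3 R]_x (F x)%:E <= ((2 * pi) ^+ 3 * \int[leb3 R]_x p x ^+ 2)%:E)%E.
  apply: (integral_nondecreasing_le (g := fun n x => (F x * gauss3 (e n) 0 x)%:E)).
  - move=> n; exact: measurable_int (IFg n).
  - by move=> n x; rewrite lee_fin mulr_ge0// gauss3_ge0.
  - move=> x m n mn; rewrite lee_fin ler_wpM2l// !gE ler_expR lerN2 ler_wpM2r//.
      by rewrite -len3_sqr sqr_ge0.
    by rewrite lef_pV2 ?posrE// ler_nat.
  - move=> x; apply: cvg_EFin; first exact: nearW.
    rewrite -[X in _ --> X]mulr1; apply: cvgM; first exact: cvg_cst.
    under eq_fun do rewrite gE.
    have h : - (n.+1%:R^-1 * dot3 x x) @[n --> \oo] --> (0 : R).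
      rewrite -[X in _ --> X]oppr0; apply: cvgN; rewrite -[X in _ --> X](mul0r (dot3 x x)).
      by apply: cvgM; [exact: cvg_harmonic|exact: cvg_cst].
    by have := cvg_comp _ _ h (@continuous_expR R 0); rewrite expR0; exact.
  - move=> n; rewrite (Rintegral_EFin (IFg n)) lee_fin.
    exact: trigT3_energy.
move=> hF; have IF : (leb3 R).-integrable setT (EFin \o F).
  apply/integrableP; split; first exact/measurable_EFinP.
  rewrite (eq_integral (fun z => (F z)%:E)); first exact: le_lt_trans hF (ltry _).
  by move=> z _; rewrite /= ger0_norm.
split; apply: fun_L2 => //; (apply: integrable_dom IF _; first exact: measurable_funX).
  by move=> x; rewrite ger0_norm ?sqr_ge0// lerDl sqr_ge0.
by move=> x; rewrite ger0_norm ?sqr_ge0// lerDr sqr_ge0.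
Qed.

End Bessel.

(** * Linearity of the transform *)

Section FourierLinear.
Context {R : realType}.

Lemma fourier_integralE (phi : mR3 R -> R) : (leb3 R).-integrable setT (EFin \o phi) ->
  fourier_integral phi = fun x => Complex (cosT3 phi x) (- sinT3 phi x).
Proof.
move=> Iphi; apply/funext => x; rewrite /fourier_integral /cintegral; congr Complex.
  rewrite /cosT3; apply: eq_Rintegral => y _ /=.
  by rewrite cosN mulr0 subr0 mulrC.
rewrite -(Rintegral_funN (integrable_sinM3 x Iphi)).
by apply: eq_Rintegral => y _ /=; rewrite sinN mulr0 add0r; ring.
Qed.

Lemma is_fourierP (f : mR3 R -> R) (g : mR3 R -> R[i]) : is_fourier f g <->
  [/\ L2 f, L2 (fun y => complex.Re (g y)), L2 (fun y => complex.Im (g y)) &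
    forall phi, schwartz phi ->
      \int[leb3 R]_y (complex.Re (g y) * phi y) = \int[leb3 R]_x (f x * cosT3 phi x) /\
      \int[leb3 R]_y (complex.Im (g y) * phi y) = - \int[leb3 R]_x (f x * sinT3 phi x)].
Proof.
have E phi : L2 f -> schwartz phi ->
    cintegral (fun y => g y * (phi y)%:C%C) =
      Complex (\int[leb3 R]_y (complex.Re (g y) * phi y))
        (\int[leb3 R]_y (complex.Im (g y) * phi y)) /\
    cintegral (fun x => (f x)%:C%C * fourier_integral phi x) =
      Complex (\int[leb3 R]_x (f x * cosT3 phi x)) (- \int[leb3 R]_x (f x * sinT3 phi x)).
  move=> f2 sphi; have Iphi := schwartz_integrable sphi.
  rewrite (fourier_integralE Iphi) /cintegral; split; congr Complex.
  - by apply: eq_Rintegral => y _; case: (g y) => a b /=; rewrite mulr0 subr0.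
  - by apply: eq_Rintegral => y _; case: (g y) => a b /=; rewrite mulr0 add0r.
  - by apply: eq_Rintegral => x _ /=; rewrite mul0r subr0.
  - have I : (leb3 R).-integrable setT (EFin \o (fun x : mR3 R => f x * sinT3 phi x)).
      by apply: integrable_L2M f2 _; exact: (trigT3_L2 Iphi (schwartz_L2 sphi)).2.
    rewrite -(Rintegral_funN I).
    by apply: eq_Rintegral => x _ /=; rewrite mul0r addr0; ring.
split=> -[h1 h2 h3 h4]; split => // phi sphi; have [E1 E2] := E phi h1 sphi.
  by have := h4 _ sphi; rewrite E1 E2 => -[].
by rewrite E1 E2; have [-> ->] := h4 _ sphi.
Qed.

Lemma Lfun2_lin (f f' : mR3 R -> R) (a b : R) :
  f \in Lfun (leb3 R) 2%:E -> f' \in Lfun (leb3 R) 2%:E ->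
  (fun x => a * f x + b * f' x) \in Lfun (leb3 R) 2%:E.
Proof.
move=> f2 f'2; have [[If If'] Iff'] := (integrable_L2M f2 f2, integrable_L2M f'2 f'2, integrable_L2M f2 f'2).
apply: fun_L2.
  by apply: measurable_funD; apply: measurable_funM => //;
    [exact: Lfun_measurable f2|exact: Lfun_measurable f'2].
have := integrable_funD (integrable_funD (integrable_funZ (a ^+ 2) If)
  (integrable_funZ (2 * a * b) Iff')) (integrable_funZ (b ^+ 2) If').
by apply: eq_integrable => // x _ /=; congr EFin; ring.
Qed.

Lemma Rintegral_lin (f f' g : mR3 R -> R) (a b : R) :
  (leb3 R).-integrable setT (EFin \o (fun x => f x * g x)) ->
  (leb3 R).-integrable setT (EFin \o (fun x => f' x * g x)) ->
  \int[leb3 R]_x ((a * f x + b * f' x) * g x) =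
  a * \int[leb3 R]_x (f x * g x) + b * \int[leb3 R]_x (f' x * g x).
Proof.
move=> I1 I2; rewrite -(RintegralZl a measurableT I1) -(RintegralZl b measurableT I2).
rewrite -(RintegralD measurableT (integrable_funZ a I1) (integrable_funZ b I2)).
by apply: eq_Rintegral => x _; ring.
Qed.

Lemma is_fourier_lin (f f' : mR3 R -> R) (g g' : mR3 R -> R[i]) (a b : R) :
  is_fourier f g -> is_fourier f' g' ->
  is_fourier (fun x => a * f x + b * f' x) (fun x => a%:C%C * g x + b%:C%C * g' x).
Proof.
move=> /is_fourierP[f2 r2 i2 H] /is_fourierP[f'2 r'2 i'2 H']; apply/is_fourierP.
have ReE x : complex.Re (a%:C%C * g x + b%:C%C * g' x) =
    a * complex.Re (g x) + b * complex.Re (g' x).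
  by case: (g x) (g' x) => c d [c' d'] /=; rewrite !mul0r !subr0.
have ImE x : complex.Im (a%:C%C * g x + b%:C%C * g' x) =
    a * complex.Im (g x) + b * complex.Im (g' x).
  by case: (g x) (g' x) => c d [c' d'] /=; rewrite !mul0r !addr0.
split.
- exact: Lfun2_lin.
- by rewrite /L2 (funext ReE); exact: Lfun2_lin.
- by rewrite /L2 (funext ImE); exact: Lfun2_lin.
move=> phi sphi; have Iphi := schwartz_integrable sphi.
have [c2 s2] := trigT3_L2 Iphi (schwartz_L2 sphi).
have phi2 := schwartz_L2 sphi.
rewrite (Rintegral_lin a b (integrable_L2M f2 c2) (integrable_L2M f'2 c2)).
rewrite (Rintegral_lin a b (integrable_L2M f2 s2) (integrable_L2M f'2 s2)).
have [<- hs] := H _ sphi; have [<- hs'] := H' _ sphi.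
rewrite opprD -!mulrN -hs -hs'; split.
  rewrite -(Rintegral_lin a b (integrable_L2M r2 phi2) (integrable_L2M r'2 phi2)).
  by apply: eq_Rintegral => y _; rewrite ReE.
rewrite -(Rintegral_lin a b (integrable_L2M i2 phi2) (integrable_L2M i'2 phi2)).
by apply: eq_Rintegral => y _; rewrite ImE.
Qed.

Lemma is_fourier_exists (f : R3 R -> R) g : is_fourier f g -> is_fourier f (fourier f).
Proof. by move=> fg; rewrite /fourier; apply: xgetPex; exists g. Qed.

(** The representative [fourier] is chosen separately for each function, so linearity can hold only
    almost everywhere and comes from [weakF_unique]. That the combination has a transform at all is
    [is_fourier_lin], tested on all Schwartz functions as the definition demands. *)
Lemma spectrum_lin (f f' h : field3 R) (a b : R) : has_fourier f -> has_fourier f' ->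
  (forall i x, cpt h i x = a * cpt f i x + b * cpt f' i x) ->
  has_fourier h /\ {ae leb3 R, forall xi : mR3 R, forall i,
    fre h i xi = a * fre f i xi + b * fre f' i xi /\
    fim h i xi = a * fim f i xi + b * fim f' i xi}.
Proof.
move=> Ff Ff' hE.
have Fh : has_fourier h.
  move=> i; rewrite (funext (hE i)).
  exact: is_fourier_exists (is_fourier_lin a b (Ff i) (Ff' i)).
split => //; apply: filter_forall => i.
have [h2 hr hi wh] := has_fourierP i Fh; have [f2 fr fi wf] := has_fourierP i Ff.
have [f'2 f'r f'i wf'] := has_fourierP i Ff'.
have T := @tempered_L2 R.
apply: (weakF_unique (T _ hr) (T _ hi) _ _ wh).
- exact: temperedD (temperedZ a (T _ fr)) (temperedZ b (T _ f'r)).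
- exact: temperedD (temperedZ a (T _ fi)) (temperedZ b (T _ f'i)).
rewrite (funext (hE i)).
exact: weakF_lin (T _ fr) (T _ f'r) (T _ fi) (T _ f'i) wf wf'.
Qed.

End FourierLinear.

(** * Weighted L1 norms of the transform *)

Section WeightedSpectrum.
Context {R : realType}.
Local Opaque fre fim fourier fourier_abs.
Implicit Types f g h : field3 R.

(** Allows Cauchy-Schwarz to be proved by integrating a pointwise inequality with a free parameter.
    The optimal choice is l = N / X; for X = 0 the large value l = (Y + 1) / N gives a
    contradiction. *)
Lemma sqr_le_of_amgm (N X Y : R) : 0 <= N -> 0 <= X -> 0 <= Y ->
  (forall l : R, 0 < l -> 2 * N <= l * X + l^-1 * Y) -> N ^+ 2 <= X * Y.
Proof.
move=> N0 X0 Y0 H; have [->|Nn0] := eqVneq N 0; first by rewrite expr0n mulr_ge0.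
have {Nn0}N0 : 0 < N by rewrite lt_neqAle eq_sym Nn0.
have [X00|Xn0] := eqVneq X 0.
  have Y1 : 0 < Y + 1 by rewrite ltr_pwDr.
  have := H ((Y + 1) / N) (divr_gt0 Y1 N0); rewrite X00 mulr0 add0r invf_div.
  have : N / (Y + 1) * Y <= N by rewrite mulrAC ler_pdivrMr// ler_wpM2l ?(ltW N0)// lerDl.
  by move=> h1 h2; exfalso; lra.
have {Xn0}X0 : 0 < X by rewrite lt_neqAle eq_sym Xn0.
have := H (N / X) (divr_gt0 N0 X0); rewrite divfK ?gt_eqF// invf_div => h.
have {}h : N <= X / N * Y by lra.
have := ler_wpM2l (ltW N0) h; rewrite -expr2 => /le_trans; apply.
by apply: eq_ler; field; rewrite gt_eqF.
Qed.

Lemma sum6_cauchy_schwarz (a b c d : 'I_3 -> R) :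
  (\sum_(i < 3) (a i * c i + b i * d i)) ^+ 2 <=
  (\sum_(i < 3) (a i ^+ 2 + b i ^+ 2)) * \sum_(i < 3) (c i ^+ 2 + d i ^+ 2).
Proof.
set D := \sum_(i < 3) (a i * c i + b i * d i).
have S0 (x y : 'I_3 -> R) : 0 <= \sum_(i < 3) (x i ^+ 2 + y i ^+ 2).
  by apply: sumr_ge0 => i _; rewrite addr_ge0// sqr_ge0.
rewrite -[leLHS]real_normK ?num_real//; apply: sqr_le_of_amgm => // l l0.
have [e e1 ->] : exists2 e : R, e ^+ 2 = 1 & `|D| = e * D.
  have [d0|d0] := leP 0 D; first by exists 1; rewrite ?expr1n ?mul1r ?ger0_norm.
  by exists (-1); rewrite ?sqrrN ?expr1n ?mulN1r ?ltr0_norm.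
have := S0 (fun i => l * a i - e * c i) (fun i => l * b i - e * d i).
have -> : \sum_(i < 3) ((l * a i - e * c i) ^+ 2 + (l * b i - e * d i) ^+ 2) =
    l * (l * \sum_(i < 3) (a i ^+ 2 + b i ^+ 2) + l^-1 * \sum_(i < 3) (c i ^+ 2 + d i ^+ 2) -
    2 * (e * D)).
  rewrite mulrBr mulrDr (mulrA l l^-1) divff ?gt_eqF// mul1r /D !mulr_sumr -big_split/= -sumrB.
  apply: eq_bigr => i _; have -> : c i ^+ 2 + d i ^+ 2 = e ^+ 2 * (c i ^+ 2 + d i ^+ 2).
    by rewrite e1 mul1r.
  by ring.
by rewrite pmulr_rge0// subr_ge0.
Qed.

(** Re (f^ . conj g^), the Euclidean inner product of the transforms seen as vectors with six real
    components. *)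
Definition fourier_dot f g (xi : mR3 R) : R :=
  \sum_(i < 3) (fre f i xi * fre g i xi + fim f i xi * fim g i xi).

Lemma fourier_dot_sqr f xi : fourier_dot f f xi = fourier_abs f xi ^+ 2.
Proof. by rewrite fourier_abs_sqr; apply: eq_bigr => i _; rewrite !expr2. Qed.

Lemma fourier_dot_le f g xi : `|fourier_dot f g xi| <= fourier_abs f xi * fourier_abs g xi.
Proof.
have p0 := mulr_ge0 (fourier_abs_ge0 f xi) (fourier_abs_ge0 g xi).
rewrite -(ler_pXn2r (n := 2))// exprMn (real_normK (num_real _)).
have := sum6_cauchy_schwarz (fre f ^~ xi) (fim f ^~ xi) (fre g ^~ xi) (fim g ^~ xi).
move=> /le_trans; apply; apply: eq_ler; congr (_ * _); exact/esym/fourier_abs_sqr.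
Qed.

Lemma fourier_abs_lip f g h xi :
  (forall i, fre f i xi = fre g i xi + fre h i xi /\ fim f i xi = fim g i xi + fim h i xi) ->
  fourier_abs f xi <= fourier_abs g xi + fourier_abs h xi.
Proof.
move=> H; apply: fourier_abs_le; first by rewrite addr_ge0 ?fourier_abs_ge0.
have -> : \sum_(i < 3) (fre f i xi ^+ 2 + fim f i xi ^+ 2) =
    fourier_dot g g xi + 2 * fourier_dot g h xi + fourier_dot h h xi.
  rewrite /fourier_dot mulr_sumr -!big_split/=; apply: eq_bigr => i _.
  have [-> ->] := H i.
  move: (fre g i xi) (fim g i xi) (fre h i xi) (fim h i xi) => a b c d.
  by ring.
rewrite sqrrD; apply: lerD; last exact: eq_ler (fourier_dot_sqr h xi).
apply: lerD; first exact: eq_ler (fourier_dot_sqr g xi).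
rewrite -[leRHS]mulr_natl ler_pM2l//.
exact: le_trans (ler_norm _) (fourier_dot_le _ _ _).
Qed.

Lemma fourier_abs_sqr_integrable f : has_fourier f ->
  (leb3 R).-integrable setT (EFin \o (fun xi : mR3 R => fourier_abs f xi ^+ 2)).
Proof.
move=> Ff; rewrite (_ : (fun xi => _) =
    fun xi : mR3 R => \sum_(i < 3) (fre f i xi ^+ 2 + fim f i xi ^+ 2)).
  apply: integrable_fun_sum => i _; have [_ r2 i2 _] := has_fourierP i Ff.
  by apply: integrable_funD; [have := integrable_L2M r2 r2|have := integrable_L2M i2 i2].
by apply/funext => xi; rewrite fourier_abs_sqr.
Qed.

Lemma fourier_abs_L2 f : has_fourier f ->
  (fourier_abs f : mR3 R -> R) \in Lfun (leb3 R) 2%:E.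
Proof.
by move=> Ff; apply: fun_L2 (measurable_fourier_abs Ff) (fourier_abs_sqr_integrable Ff).
Qed.

Variable w : mR3 R -> R.
Hypotheses (w2 : w \in Lfun (leb3 R) 2%:E) (w0 : forall xi, 0 <= w xi).

Definition wnorm f : R := \int[leb3 R]_xi (w xi * fourier_abs f xi).

Lemma wnorm_integrable f : has_fourier f ->
  (leb3 R).-integrable setT (EFin \o (fun xi => w xi * fourier_abs f xi)).
Proof. by move=> Ff; exact: integrable_L2M w2 (fourier_abs_L2 Ff). Qed.

Lemma wnorm_ge0 f : 0 <= wnorm f.
Proof. by apply: Rintegral_ge0 => xi _; rewrite mulr_ge0// fourier_abs_ge0. Qed.

Lemma wnorm_le_L2 f : has_fourier f ->
  wnorm f ^+ 2 <= \int[leb3 R]_xi w xi ^+ 2 * \int[leb3 R]_xi fourier_abs f xi ^+ 2.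
Proof.
move=> Ff; have Iw : (leb3 R).-integrable setT (EFin \o (fun xi => w xi ^+ 2)).
  by have := integrable_L2M w2 w2.
have IF := fourier_abs_sqr_integrable Ff.
apply: sqr_le_of_amgm; first exact: wnorm_ge0.
- by apply: Rintegral_ge0 => xi _; exact: sqr_ge0.
- by apply: Rintegral_ge0 => xi _; exact: sqr_ge0.
move=> l l0.
rewrite -(RintegralZl _ measurableT (wnorm_integrable Ff)).
rewrite -(RintegralZl _ measurableT Iw) -(RintegralZl _ measurableT IF).
rewrite -(RintegralD measurableT (integrable_funZ _ Iw) (integrable_funZ _ IF)).
apply: (le_Rintegral measurableT (integrable_funZ _ (wnorm_integrable Ff))
  (integrable_funD (integrable_funZ _ Iw) (integrable_funZ _ IF))) => xi _.
rewrite -(ler_pM2l l0) mulrDr [_ * (l^-1 * _)]mulrA divff ?gt_eqF// mul1r.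
have := sqr_ge0 (l * w xi - fourier_abs f xi); rewrite sqrrB.
by move: (w xi) (fourier_abs f xi) => a b; rewrite exprMn; lra.
Qed.

Lemma Hs_norm_L2 (s : R) f (e : R) : 0 <= s -> has_fourier f -> 0 <= e ->
  (Hs_norm s f <= e%:E)%E -> \int[leb3 R]_xi fourier_abs f xi ^+ 2 <= e ^+ 2.
Proof.
move=> s0 Ff e0 He; have IF := fourier_abs_sqr_integrable Ff.
rewrite -(Rintegral_le_EFin _ IF).
apply: (@le_trans _ _ (\int[leb3 R]_xi ((1 + len3 xi ^+ 2) `^ s * fourier_abs f xi ^+ 2)%:E)%E).
  apply: ge0_le_integral => //.
  - by move=> xi _; rewrite lee_fin sqr_ge0.
  - exact: measurable_int IF.
  - apply/measurable_EFinP; apply: measurable_funM; last exact: integrable_measurable IF.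
    apply: (measurableT_comp (f := (@powR R)^~ s)); first exact: measurable_powR.
    by apply: measurable_funD => //; apply: measurable_funX; exact: measurable_len3.
  - move=> xi _; rewrite lee_fin ler_peMl ?sqr_ge0//.
    rewrite -[leLHS](powRr0 (1 + len3 xi ^+ 2)); apply: ler_powR s0.
    by rewrite lerDl sqr_ge0.
move: He; rewrite /Hs_norm; set X := integral _ _ _.
have X0 : (0 <= X)%E.
  by apply: integral_ge0 => xi _; rewrite lee_fin mulr_ge0 ?powR_ge0// sqr_ge0.
case: X X0 => [x| |]//= x0; rewrite lee_fin => h; rewrite lee_fin.
by rewrite -(sqr_sqrtr (a := x))// ler_pXn2r ?nnegrE// sqrtr_ge0.
Qed.

(** The reason for demanding weights in L2: a weighted norm is then continuous on every H^s with s
    >= 0, by Cauchy-Schwarz. *)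
Lemma wnorm_le_Hs (s : R) f (e : R) : 0 <= s -> has_fourier f -> 0 <= e ->
  (Hs_norm s f <= e%:E)%E -> wnorm f <= Num.sqrt (\int[leb3 R]_xi w xi ^+ 2) * e.
Proof.
move=> s0 Ff e0 He.
have W0 : 0 <= \int[leb3 R]_xi w xi ^+ 2.
  by apply: Rintegral_ge0 => xi _; exact: sqr_ge0.
rewrite -(ler_pXn2r (n := 2))// ?nnegrE ?wnorm_ge0 ?mulr_ge0 ?sqrtr_ge0//.
rewrite exprMn sqr_sqrtr//; apply: le_trans (wnorm_le_L2 Ff) _.
by rewrite ler_wpM2l//; exact: Hs_norm_L2 s0 Ff e0 He.
Qed.

Lemma wnorm_triangle f g h : has_fourier f -> has_fourier g -> has_fourier h ->
  {ae leb3 R, forall xi : mR3 R, forall i, fre f i xi = fre g i xi + fre h i xi /\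
    fim f i xi = fim g i xi + fim h i xi} ->
  wnorm f <= wnorm g + wnorm h.
Proof.
move=> Ff Fg Fh H; have [[If Ig] Ih] := (wnorm_integrable Ff, wnorm_integrable Fg, wnorm_integrable Fh).
rewrite /wnorm -(RintegralD measurableT Ig Ih).
apply: (Rintegral_ae_le If (integrable_funD Ig Ih)).
- by move=> xi; rewrite mulr_ge0// fourier_abs_ge0.
- by move=> xi; rewrite addr_ge0// mulr_ge0// fourier_abs_ge0.
- apply: filterS H => xi H; rewrite -mulrDr ler_wpM2l//.
  exact: fourier_abs_lip.
Qed.

End WeightedSpectrum.

(** * Growth of weighted norms *)

Section Rates.
Context {R : realType}.
Implicit Types f g h : field3 R.

Lemma laplacian_weakF f lap (i : 'I_3) : has_fourier f -> is_laplacian f lap ->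
  cpt lap i \in Lfun (leb3 R) 2%:E /\
  weakF (cpt lap i) (fun x => - len3 x ^+ 2 * fre f i x) (fun x => - len3 x ^+ 2 * fim f i x).
Proof.
move=> Ff /(_ i)[f2 [lap2 H]]; split => // phi tphi.
have [_ r2 i2 w] := has_fourierP i Ff.
have tXX k : tensor_sum (fun x => coord3 x k * (coord3 x k * phi x)).
  exact/tensor_sumX/tensor_sumX.
have c2 k x : partials [:: k; k] (cosT3 phi) x = - cosT3 (fun x => coord3 x k * (coord3 x k * phi x)) x.
  rewrite /= (_ : 'D_(dir3 k) (cosT3 phi) = fun x => - sinT3 (fun y => coord3 y k * phi y) x).
    have := der_sinT3 k x (tensor_sumX k tphi) => h.
    by rewrite (@derive_val _ _ _ _ _ _ _ (is_deriveN h)).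
  by apply/funext => y; rewrite (@derive_val _ _ _ _ _ _ _ (der_cosT3 k y tphi)).
have s2 k x : partials [:: k; k] (sinT3 phi) x = - sinT3 (fun x => coord3 x k * (coord3 x k * phi x)) x.
  rewrite /= (_ : 'D_(dir3 k) (sinT3 phi) = cosT3 (fun y => coord3 y k * phi y)).
    by rewrite (@derive_val _ _ _ _ _ _ _ (der_cosT3 k x (tensor_sumX k tphi))).
  by apply/funext => y; rewrite (@derive_val _ _ _ _ _ _ _ (der_sinT3 k y tphi)).
have If psi : tensor_sum psi -> (leb3 R).-integrable setT (EFin \o (fun x : mR3 R => cpt f i x * psi x)).
  by move=> tpsi; apply: integrable_L2M f2 _; exact: tensor_sum_L2.
have Ir (r : mR3 R -> R) psi : r \in Lfun (leb3 R) 2%:E -> tensor_sum psi ->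
    (leb3 R).-integrable setT (EFin \o (fun x : mR3 R => r x * psi x)).
  by move=> r2' tpsi; apply: integrable_L2M r2' _; exact: tensor_sum_L2.
have sum_out (r : mR3 R -> R) (psi : 'I_3 -> R3 R -> R) : r \in Lfun (leb3 R) 2%:E ->
    (forall k, tensor_sum (psi k)) -> \int[leb3 R]_x (r x * \sum_(k < 3) - psi k x) =
    - \sum_(k < 3) \int[leb3 R]_x (r x * psi k x).
  move=> r2' tpsi; rewrite -(Rintegral_fun_sum _ (h := fun k (x : mR3 R) => r x * psi k x)).
    rewrite -Rintegral_funN; last by apply: integrable_fun_sum => k _; exact: Ir.
    by apply: eq_Rintegral => x _; rewrite sumrN mulrN mulr_sumr.
  by move=> k _; exact: Ir.
have len_out (r : mR3 R -> R) : r \in Lfun (leb3 R) 2%:E ->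
    \int[leb3 R]_y (- len3 y ^+ 2 * r y * phi y) =
    - \sum_(k < 3) \int[leb3 R]_y (r y * (coord3 y k * (coord3 y k * phi y))).
  move=> r2'; rewrite -sum_out//; apply: eq_Rintegral => y _.
  by rewrite len3_sqr /dot3 !sum3E; ring.
split.
- rewrite len_out// (H _ (tensor_sum_schwartz (tensor_sum_cosT3 tphi))).
  under [RHS]eq_Rintegral => x _ do under eq_bigr => k _ do rewrite c2.
  rewrite sum_out//; last by move=> k; exact: tensor_sum_cosT3.
  by congr (- _); apply: eq_bigr => k _; exact: (w _ (tXX k)).1.
- rewrite len_out// (H _ (tensor_sum_schwartz (tensor_sum_sinT3 tphi))).
  under [in RHS]eq_Rintegral => x _ do under eq_bigr => k _ do rewrite s2.
  rewrite sum_out//; last by move=> k; exact: tensor_sum_sinT3.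
  by rewrite -!sumrN; apply: eq_bigr => k _; rewrite (w _ (tXX k)).2 opprK.
Qed.

Lemma helmholtz_weakF f g i : is_helmholtz f g ->
  [/\ cpt g i \in Lfun (leb3 R) 2%:E,
    tempered (fun xi => \sum_(j < 3) helmholtz_symbol xi i j * fre f j xi),
    tempered (fun xi => \sum_(j < 3) helmholtz_symbol xi i j * fim f j xi) &
    weakF (cpt g i) (fun xi => \sum_(j < 3) helmholtz_symbol xi i j * fre f j xi)
      (fun xi => \sum_(j < 3) helmholtz_symbol xi i j * fim f j xi)].
Proof.
move=> [Ff /(_ i) gi]; have [g2 r2 i2 _] := gi.
have re_sum (F : 'I_3 -> R[i]) : complex.Re (\sum_(j < 3) F j) = \sum_(j < 3) complex.Re (F j).
  by rewrite !sum3E; case: (F 0) (F 1) (F 2) => ? ? [? ?] [? ?].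
have im_sum (F : 'I_3 -> R[i]) : complex.Im (\sum_(j < 3) F j) = \sum_(j < 3) complex.Im (F j).
  by rewrite !sum3E; case: (F 0) (F 1) (F 2) => ? ? [? ?] [? ?].
have ReE : (fun xi => complex.Re (\sum_(j < 3) (helmholtz_symbol xi i j)%:C%C * fourier (cpt f j) xi)) =
    (fun xi => \sum_(j < 3) helmholtz_symbol xi i j * fre f j xi).
  apply/funext => xi; rewrite re_sum; apply: eq_bigr => j _; rewrite /fre.
  by case: (fourier _ _) => a b /=; rewrite mul0r subr0.
have ImE : (fun xi => complex.Im (\sum_(j < 3) (helmholtz_symbol xi i j)%:C%C * fourier (cpt f j) xi)) =
    (fun xi => \sum_(j < 3) helmholtz_symbol xi i j * fim f j xi).
  apply/funext => xi; rewrite im_sum; apply: eq_bigr => j _; rewrite /fim.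
  by case: (fourier _ _) => a b /=; rewrite mul0r addr0.
have := is_fourier_weakF gi; rewrite ReE ImE => w.
move: r2 i2; rewrite ReE ImE => r2 i2.
by split => //; exact: tempered_L2.
Qed.

(** The symbol differs from the identity by a multiple of xi_i xi_j, and summation over i brings out
    the factor xi . p, which is 0. *)
Lemma helmholtz_orthogonal (xi : R3 R) (p y : 'I_3 -> R) :
  \sum_(i < 3) coord3 xi i * p i = 0 ->
  \sum_(i < 3) p i * (\sum_(j < 3) helmholtz_symbol xi i j * y j) = \sum_(i < 3) p i * y i.
Proof.
move=> p0.
transitivity (\sum_(i < 3) p i * y i -
    (\sum_(i < 3) coord3 xi i * p i) * ((\sum_(j < 3) coord3 xi j * y j) / len3 xi ^+ 2)).
  rewrite mulr_suml -sumrB; apply: eq_bigr => i _.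
  rewrite (_ : \sum_(j < 3) _ = y i - coord3 xi i * ((\sum_(j < 3) coord3 xi j * y j) / len3 xi ^+ 2)).
    by ring.
  rewrite mulr_suml mulr_sumr (eq_bigr (fun j => (i == j)%:R * y j -
    coord3 xi i * (coord3 xi j * y j / len3 xi ^+ 2))).
    by rewrite sumrB; congr (_ - _); rewrite (bigD1 i)//= eqxx mul1r big1 ?addr0// => j /negPf ji; rewrite eq_sym ji mul0r.
  by move=> j _; rewrite /helmholtz_symbol; ring.
by rewrite p0 mul0r subr0.
Qed.

(** In the application a + i b, x + i y, c + i d and p + i q are the transforms of the velocity, of
    its cross product with e3, of the convection term and of the time derivative. *)
Lemma rate_sum (xi : R3 R) (nu Omega : R) (a b x y c d p q : 'I_3 -> R) :
  \sum_(i < 3) coord3 xi i * a i = 0 -> \sum_(i < 3) coord3 xi i * b i = 0 ->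
  \sum_(i < 3) (a i * x i + b i * y i) = 0 ->
  (forall i, p i = nu * (- len3 xi ^+ 2 * a i) -
    Omega * (\sum_(j < 3) helmholtz_symbol xi i j * x j) -
    \sum_(j < 3) helmholtz_symbol xi i j * c j) ->
  (forall i, q i = nu * (- len3 xi ^+ 2 * b i) -
    Omega * (\sum_(j < 3) helmholtz_symbol xi i j * y j) -
    \sum_(j < 3) helmholtz_symbol xi i j * d j) ->
  \sum_(i < 3) (a i * p i + b i * q i) =
  - nu * len3 xi ^+ 2 * (\sum_(i < 3) (a i ^+ 2 + b i ^+ 2)) - \sum_(i < 3) (a i * c i + b i * d i).
Proof.
move=> a0 b0 skew pE qE.
have lin (e x' y' : 'I_3 -> R) :
    \sum_(i < 3) e i * (nu * (- len3 xi ^+ 2 * e i) - Omega * x' i - y' i) =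
    - nu * len3 xi ^+ 2 * (\sum_(i < 3) e i ^+ 2) - Omega * (\sum_(i < 3) e i * x' i) -
    \sum_(i < 3) e i * y' i.
  by rewrite !sum3E; ring.
rewrite (eq_bigr (fun i => _) (fun i _ => congr2 +%R (congr1 ( *%R (a i)) (pE i)) (congr1 ( *%R (b i)) (qE i)))).
rewrite big_split/= !lin !helmholtz_orthogonal// !big_split/=.
move: skew; rewrite big_split/=.
move: (\sum_(i < 3) a i * x i) (\sum_(i < 3) b i * y i) => A B /eqP; rewrite addr_eq0 => /eqP ->.
by ring.
Qed.

Lemma cross_e3 f x : [/\ cpt (fun x => cross e3 (f x)) 0 x = - cpt f 1 x,
  cpt (fun x => cross e3 (f x)) 1 x = cpt f 0 x & cpt (fun x => cross e3 (f x)) 2 x = 0].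
Proof.
have E (i j k : 'I_3) : i + 1 = j -> i + 2 = k -> cpt (fun x => cross e3 (f x)) i x =
    (j == 2)%:R * f x 0 k - (k == 2)%:R * f x 0 j.
  by move=> ij ik; rewrite /cpt /cross /e3 !mxE ij ik !eqxx /=.
have n12 : ((1 : 'I_3) == 2) = false by [].
have n02 : ((0 : 'I_3) == 2) = false by [].
split; [rewrite (E 0 1 2)|rewrite (E 1 2 0)|rewrite (E 2 0 1)]; try exact: val_inj.
- by rewrite n12 eqxx mul0r mul1r sub0r.
- by rewrite n02 eqxx mul0r mul1r subr0.
- by rewrite n12 n02 !mul0r subr0.
Qed.

Lemma weakF_ext (f f' p q : mR3 R -> R) : f =1 f' -> weakF f p q -> weakF f' p q.
Proof. by move=> /funext ->. Qed.

(* [Re (f^ . conj v^)] for the rate of change [v] of a solution [f]: the Coriolis term is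
   skew-symmetric, and the projection disappears because [f^] is divergence free. *)
Lemma fourier_dot_rate (nu Omega : R) f lap cor adv padv v : has_fourier f -> div_free f ->
  is_laplacian f lap -> is_helmholtz (fun x => cross e3 (f x)) cor -> is_helmholtz adv padv ->
  has_fourier v -> v = nu *: lap - Omega *: cor - padv ->
  {ae leb3 R, forall xi : mR3 R, fourier_dot f v xi =
    - nu * len3 xi ^+ 2 * fourier_abs f xi ^+ 2 - fourier_dot f adv xi}.
Proof.
move=> Ff df Hlap Hcor Hadv Fv vE; set X := (fun x => cross e3 (f x)) in Hcor.
have T := @tempered_L2 R.
have FX : has_fourier X by have [] := Hcor.
have Fadv : has_fourier adv by have [] := Hadv.
have [d1 d2] := div_free_fourier Ff df.
have vi i : {ae leb3 R, forall xi : mR3 R,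
    fre v i xi = nu * (- len3 xi ^+ 2 * fre f i xi) -
      Omega * (\sum_(j < 3) helmholtz_symbol xi i j * fre X j xi) -
      \sum_(j < 3) helmholtz_symbol xi i j * fre adv j xi /\
    fim v i xi = nu * (- len3 xi ^+ 2 * fim f i xi) -
      Omega * (\sum_(j < 3) helmholtz_symbol xi i j * fim X j xi) -
      \sum_(j < 3) helmholtz_symbol xi i j * fim adv j xi}.
  have [v2 vr vim wv] := has_fourierP i Fv; have [f2 fr fi _] := has_fourierP i Ff.
  have [l2 wl] := laplacian_weakF i Ff Hlap.
  have [c2 tcr tci wc] := helmholtz_weakF i Hcor.
  have [p2 tpr tpi wp] := helmholtz_weakF i Hadv.
  have tl (r : mR3 R -> R) : r \in Lfun (leb3 R) 2%:E ->
      tempered (fun x => - len3 x ^+ 2 * r x).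
    move=> r2; rewrite (_ : (fun x => _) = fun x => \sum_(k < 3) - (coord3 x k * (coord3 x k * r x))).
      by apply: tempered_sum3 => k; exact/temperedN/temperedX/temperedX/T.
    by apply/funext => x; rewrite len3_sqr /dot3 !sum3E; ring.
  have w1 := weakF_lin nu (- Omega) l2 c2 (tl _ fr) tcr (tl _ fi) tci wl wc.
  have w2 := weakF_lin 1 (-1) (Lfun2_lin nu (- Omega) l2 c2) p2
    (temperedD (temperedZ nu (tl _ fr)) (temperedZ (- Omega) tcr)) tpr
    (temperedD (temperedZ nu (tl _ fi)) (temperedZ (- Omega) tci)) tpi w1 wp.
  have w3 : weakF (cpt v i) _ _ := weakF_ext _ w2.
  have := weakF_unique (T _ vr) (T _ vim) _ _ wv (w3 _).
  move=> h; have {}h := h (temperedD (temperedZ 1 (temperedD (temperedZ nu (tl _ fr))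
    (temperedZ (- Omega) tcr))) (temperedZ (-1) tpr))
    (temperedD (temperedZ 1 (temperedD (temperedZ nu (tl _ fi))
    (temperedZ (- Omega) tci))) (temperedZ (-1) tpi)).
  apply: filterS (h _) => [xi [-> ->]|x].
    by rewrite !mul1r !mulN1r !mulNr.
  by rewrite /cpt vE !mxE; ring.
have Xi (i k : 'I_3) (c : R) : (forall x, cpt X i x = c * cpt f k x) ->
    {ae leb3 R, forall xi : mR3 R, fre X i xi = c * fre f k xi /\ fim X i xi = c * fim f k xi}.
  move=> XE; have [X2 Xr Xim wX] := has_fourierP i FX; have [f2 fr fi wf] := has_fourierP k Ff.
  have w1 := weakF_lin c 0 f2 f2 (T _ fr) (T _ fr) (T _ fi) (T _ fi) wf wf.
  have w3 : weakF (cpt X i) _ _ := weakF_ext _ w1.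
  have := weakF_unique (T _ Xr) (T _ Xim) _ _ wX (w3 _).
  move=> h; have {}h := h (temperedD (temperedZ c (T _ fr)) (temperedZ 0 (T _ fr)))
    (temperedD (temperedZ c (T _ fi)) (temperedZ 0 (T _ fi))).
  apply: filterS (h _) => [xi [-> ->]|x]; first by rewrite !mul0r !addr0.
  by rewrite mul0r addr0 XE.
have X0 := Xi 0 1 (-1) _; have X1 := Xi 1 0 1 _; have X2 := Xi 2 0 0 _.
have {}X0 := X0 (fun x => etrans (let: And3 h _ _ := cross_e3 f x in h) (esym (mulN1r _))).
have {}X1 := X1 (fun x => etrans (let: And3 _ h _ := cross_e3 f x in h) (esym (mul1r _))).
have {}X2 := X2 (fun x => etrans (let: And3 _ _ h := cross_e3 f x in h) (esym (mul0r _))).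
have {}vi := filter_forall (ae_filter_ringOfSetsType _) vi.
have aeI (P Q : mR3 R -> Prop) : {ae leb3 R, forall x, P x} -> {ae leb3 R, forall x, Q x} ->
    {ae leb3 R, forall x, P x /\ Q x} by apply: filterS2.
have := aeI _ _ (aeI _ _ d1 d2) (aeI _ _ (aeI _ _ X0 X1) (aeI _ _ X2 vi)).
apply: filterS => xi [[p0 q0] [[[x0 y0] [x1 y1]] [[x2 y2] {}vi]]].
have skew : fourier_dot f X xi = 0.
  have skew3 (a b x y : 'I_3 -> R) : x 0 = -1 * a 1 -> y 0 = -1 * b 1 -> x 1 = 1 * a 0 ->
      y 1 = 1 * b 0 -> x 2 = 0 * a 0 -> y 2 = 0 * b 0 -> \sum_(i < 3) (a i * x i + b i * y i) = 0.
    by rewrite sum3E => -> -> -> -> -> ->; ring.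
  exact: (skew3 (fre f ^~ xi) (fim f ^~ xi) (fre X ^~ xi) (fim X ^~ xi)
    x0 y0 x1 y1 x2 y2).
exact: (etrans (rate_sum p0 q0 skew (fun i => (vi i).1) (fun i => (vi i).2))
  (congr1 (fun S => - nu * len3 xi ^+ 2 * S - fourier_dot f adv xi) (esym (fourier_abs_sqr f xi)))).
Qed.

End Rates.

(** * One backward time step of the heat-weighted norm *)

Section LeftRate.
Context {R : realType}.
Implicit Types f g h : field3 R.

(** F and G are the moduli at times t and t - k, and dg is the inner product of the two transforms.
    Since dg <= F G, division by F yields (1 + x) F - k (A + r) <= G. Multiplying by exp (- x) >= 1
    - x leaves the second-order error x^2 F, because (1 - x) (1 + x) = 1 - x^2. *)
Lemma step_scalar (F G k x y A r dv dr dg : R) : 0 <= F -> 0 <= G -> 0 <= k -> 0 <= x ->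
  0 <= A -> 0 <= r -> dg <= F * G -> dg = F ^+ 2 - k * (dv + dr) ->
  dv <= - y * F ^+ 2 + F * A -> dr <= F * r -> x = k * y ->
  F - expR (- x) * G <= x ^+ 2 * F + k * (A + r).
Proof.
move=> F0 G0 k0 x0 A0 r0 FG dgE dvE drE xE.
have e0 : 0 <= expR (- x) := expR_ge0 _.
have e1 : expR (- x) <= 1 by rewrite expR_le1 oppr_le0.
have ex : 1 - x <= expR (- x) := expR_ge1Dx (- x).
have [F00|Fn0] := eqVneq F 0.
  rewrite F00 mulr0 add0r add0r; apply: (@le_trans _ _ 0).
    by rewrite oppr_le0 mulr_ge0.
  by rewrite mulr_ge0// addr_ge0.
have {Fn0}F0 : 0 < F by rewrite lt_neqAle eq_sym Fn0.
have h : (1 + x) * F - k * (A + r) <= G.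
  rewrite -(ler_pM2l F0); apply: le_trans FG; rewrite dgE xE.
  have : k * (dv + dr) <= k * (- y * F ^+ 2 + F * A + F * r) by rewrite ler_wpM2l ?lerD.
  by rewrite -subr_ge0 => h; rewrite -subr_ge0; apply: le_trans h (eq_ler _); ring.
have hB : 0 <= k * (A + r) by rewrite mulr_ge0// addr_ge0.
have h1 : expR (- x) * ((1 + x) * F - k * (A + r)) <= expR (- x) * G by rewrite ler_wpM2l.
have h2 : (1 - x) * ((1 + x) * F) <= expR (- x) * ((1 + x) * F).
  by rewrite ler_wpM2r// mulr_ge0 ?addr_ge0// ltW.
have h3 : expR (- x) * (k * (A + r)) <= k * (A + r) by rewrite ler_piMl.
have -> : x ^+ 2 * F = F - (1 - x) * ((1 + x) * F) by ring.
rewrite -subr_ge0; rewrite -subr_ge0 in h1; rewrite -subr_ge0 in h2; rewrite -subr_ge0 in h3.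
by apply: le_trans (addr_ge0 (addr_ge0 h1 h2) h3) (eq_ler _); ring.
Qed.

(** The error x^2 F can be controlled only where frequencies are bounded, that is on the support of
    the weight W; off it every weighted term is harmless. *)
Lemma step_weighted (W e li k C E F G A r x : R) : 0 <= W -> 0 <= e -> e <= 1 -> W <= li ->
  0 <= k -> 0 <= F -> 0 <= A -> 0 <= r -> (W != 0 -> x ^+ 2 <= k * C) ->
  F - E * G <= x ^+ 2 * F + k * (A + r) ->
  W * e * F <= k * (C * (W * F) + (li * A + W * r)) + W * e * E * G.
Proof.
move=> W0 e0 e1 Wl k0 F0 A0 r0 xC H.
have [->|Wn0] := eqVneq W 0.
  by rewrite !mul0r !mulr0 add0r !addr0 mulr_ge0// mulr_ge0// (le_trans W0).
have {}xC := xC Wn0; have We : W * e <= W by rewrite ler_piMr.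
have We0 : 0 <= W * e by rewrite mulr_ge0.
have h1 : W * e * (F - E * G) <= W * e * (x ^+ 2 * F + k * (A + r)) by rewrite ler_wpM2l.
have h2 : W * e * (x ^+ 2 * F) <= W * (k * C * F).
  by apply: ler_pM => //; [rewrite mulr_ge0 ?sqr_ge0|rewrite ler_wpM2r].
have h3 : W * e * (k * r) <= W * (k * r) by rewrite ler_wpM2r ?mulr_ge0.
have h4 : W * e * (k * A) <= li * (k * A) by rewrite ler_wpM2r ?mulr_ge0// (le_trans We).
rewrite -subr_ge0; rewrite -subr_ge0 in h1; rewrite -subr_ge0 in h2.
rewrite -subr_ge0 in h3; rewrite -subr_ge0 in h4.
by apply: le_trans (addr_ge0 (addr_ge0 h1 h2) (addr_ge0 h3 h4)) (eq_ler _); ring.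
Qed.

Lemma fourier_dot_lin f g v r (k : R) xi :
  (forall i, fre g i xi = fre f i xi - k * (fre v i xi + fre r i xi) /\
    fim g i xi = fim f i xi - k * (fim v i xi + fim r i xi)) ->
  fourier_dot f g xi = fourier_dot f f xi - k * (fourier_dot f v xi + fourier_dot f r xi).
Proof.
have lin (a b c d p q m n : 'I_3 -> R) : (forall i, c i = a i - k * (p i + m i) /\
      d i = b i - k * (q i + n i)) ->
    \sum_(i < 3) (a i * c i + b i * d i) = \sum_(i < 3) (a i * a i + b i * b i) -
    k * (\sum_(i < 3) (a i * p i + b i * q i) + \sum_(i < 3) (a i * m i + b i * n i)).
  move=> H; rewrite -big_split/= mulr_sumr -sumrB; apply: eq_bigr => i _.
  by have [-> ->] := H i; ring.
exact: (lin (fre f ^~ xi) (fim f ^~ xi)).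
Qed.

Variables (w : mR3 R -> R) (M : R).
Hypotheses (w2 : w \in Lfun (leb3 R) 2%:E) (w0 : forall xi, 0 <= w xi).
Hypothesis wlen : forall xi, w xi <= (len3 xi)^-1.
Hypothesis wM : forall xi, w xi != 0 -> len3 xi <= M.

(** Used with th = nu (T - t): the factor then grows in t at the rate nu |xi|^2, which compensates
    the viscous damping of |u^|. *)
Definition heat_weight (th : R) (xi : mR3 R) : R := w xi * expR (- (th * len3 xi ^+ 2)).

Lemma heat_weight_ge0 th xi : 0 <= heat_weight th xi.
Proof. by rewrite mulr_ge0// expR_ge0. Qed.

Lemma heat_weight_le th xi : 0 <= th -> heat_weight th xi <= w xi.
Proof. by move=> th0; rewrite ler_piMr// expR_le1 oppr_le0 mulr_ge0// sqr_ge0. Qed.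

Lemma measurable_heat_weight th : measurable_fun setT (heat_weight th).
Proof.
apply: measurable_funM; first exact: Lfun_measurable w2.
apply: (measurableT_comp (f := expR)); first exact: measurable_expR.
apply: measurableT_comp => //; apply: measurable_funM => //.
by apply: measurable_funX; exact: measurable_len3.
Qed.

Lemma heat_weight_L2 th : 0 <= th -> heat_weight th \in Lfun (leb3 R) 2%:E.
Proof.
move=> th0; apply: fun_L2; first exact: measurable_heat_weight.
have Iw : (leb3 R).-integrable setT (EFin \o (fun xi => w xi ^+ 2)).
  by have := integrable_L2M w2 w2.
apply: integrable_dom Iw _; first exact: measurable_funX (measurable_heat_weight th).
move=> xi; rewrite ger0_norm ?sqr_ge0// ler_pXn2r ?nnegrE ?heat_weight_ge0//.
exact: heat_weight_le.
Qed.

(** Here f = u t, g = u (t - k), v is the time derivative at t and r the remainder, so that g = f -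
    k (v + r). Going back by k in time raises th by nu k. The term with [M ^+ 4] carries a further
    factor k and disappears in the limit. *)
Lemma heat_weight_step (nu th k : R) f g v r adv : 0 < nu -> 0 <= th -> 0 < k ->
  has_fourier f -> has_fourier g -> has_fourier r -> has_fourier adv ->
  {ae leb3 R, forall xi : mR3 R, fourier_dot f v xi =
    - nu * len3 xi ^+ 2 * fourier_abs f xi ^+ 2 - fourier_dot f adv xi} ->
  {ae leb3 R, forall xi : mR3 R, forall i,
    fre g i xi = fre f i xi - k * (fre v i xi + fre r i xi) /\
    fim g i xi = fim f i xi - k * (fim v i xi + fim r i xi)} ->
  (leb3 R).-integrable setT (EFin \o (fun xi : mR3 R => (len3 xi)^-1 * fourier_abs adv xi)) ->
  wnorm (heat_weight th) f - wnorm (heat_weight (th + nu * k)) g <=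
  k * (k * (nu ^+ 2 * M ^+ 4) * wnorm w f +
    (\int[leb3 R]_xi ((len3 xi)^-1 * fourier_abs adv xi) + wnorm w r)).
Proof.
move=> nu0 th0 k0 Ff Fg Fr Fadv Hv Hg Iadv.
have thk0 : 0 <= th + nu * k by rewrite addr_ge0// mulr_ge0// ltW.
have If := wnorm_integrable (heat_weight_L2 th0) Ff.
have Ig := wnorm_integrable (heat_weight_L2 thk0) Fg.
have Iwf := wnorm_integrable w2 Ff; have Iwr := wnorm_integrable w2 Fr.
rewrite lerBlDr /wnorm -(RintegralZl _ measurableT Iwf) -(RintegralD measurableT Iadv Iwr).
have IS := integrable_funD Iadv Iwr.
have IZ := integrable_funZ (k * (nu ^+ 2 * M ^+ 4)) Iwf.
rewrite -(RintegralD measurableT IZ IS) -(RintegralZl _ measurableT (integrable_funD IZ IS)).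
have IK := integrable_funZ k (integrable_funD IZ IS).
rewrite -(RintegralD measurableT IK Ig).
have F0 h xi := fourier_abs_ge0 h xi.
apply: (Rintegral_ae_le If (integrable_funD IK Ig)).
- by move=> xi; rewrite mulr_ge0 ?heat_weight_ge0.
- move=> xi; rewrite addr_ge0//; last by rewrite mulr_ge0 ?heat_weight_ge0.
  rewrite mulr_ge0 ?(ltW k0)// addr_ge0//.
    apply: mulr_ge0; last exact: mulr_ge0.
    by apply: mulr_ge0 (ltW k0) _; apply: mulr_ge0 (sqr_ge0 _) _; exact: exprn_even_ge0.
  by rewrite addr_ge0 ?mulr_ge0 ?invr_ge0 ?len3_ge0.
have aeI (P Q : mR3 R -> Prop) : {ae leb3 R, forall x, P x} -> {ae leb3 R, forall x, Q x} ->
    {ae leb3 R, forall x, P x /\ Q x} by apply: filterS2.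
apply: filterS (aeI _ _ Hv Hg) => xi [{}Hv {}Hg].
have := fourier_dot_lin Hg; rewrite fourier_dot_sqr => dE.
pose x := nu * k * len3 xi ^+ 2.
have x0 : 0 <= x := mulr_ge0 (mulr_ge0 (ltW nu0) (ltW k0)) (sqr_ge0 _).
have H := @step_scalar (fourier_abs f xi) (fourier_abs g xi) k x (nu * len3 xi ^+ 2)
  (fourier_abs adv xi) (fourier_abs r xi) (fourier_dot f v xi) (fourier_dot f r xi) (fourier_dot f g xi)
  (F0 f xi) (F0 g xi) (ltW k0) x0 (F0 adv xi) (F0 r xi)
  (le_trans (ler_norm _) (fourier_dot_le f g xi)) dE _
  (le_trans (ler_norm _) (fourier_dot_le f r xi)).
have {}H : fourier_abs f xi - expR (- x) * fourier_abs g xi <=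
    x ^+ 2 * fourier_abs f xi + k * (fourier_abs adv xi + fourier_abs r xi).
  apply: H; last by rewrite /x; ring.
  rewrite Hv mulNr lerD2l; apply: le_trans (ler_norm _) _; rewrite normrN.
  exact: fourier_dot_le.
have wE : heat_weight (th + nu * k) xi = heat_weight th xi * expR (- x).
  by rewrite /heat_weight /x -mulrA -expRD; congr (_ * expR _); ring.
rewrite wE.
have xM : w xi != 0 -> x ^+ 2 <= k * (k * (nu ^+ 2 * M ^+ 4)).
  move=> wn0; have l4 : len3 xi ^+ 4 <= M ^+ 4.
    have lM := wM wn0; rewrite ler_pXn2r// nnegrE ?len3_ge0//.
    exact: le_trans (len3_ge0 _) lM.
  have -> : x ^+ 2 = (nu * k) ^+ 2 * len3 xi ^+ 4.
    by rewrite /x exprMn -exprM.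
  apply: le_trans (ler_wpM2l (sqr_ge0 _) l4) (eq_ler _); ring.
have e1 : expR (- (th * len3 xi ^+ 2)) <= 1 by rewrite expR_le1 oppr_le0 mulr_ge0// sqr_ge0.
exact: (step_weighted (w0 xi) (expR_ge0 _) e1 (wlen xi) (ltW k0) (F0 f xi) (F0 adv xi) (F0 r xi) xM H).
Qed.

End LeftRate.

(** * Growth bounds from one-sided rates *)

Section Creeping.
Context {R : realType}.
Notation mu := (@lebesgue_measure R).
Implicit Types (t T : R) (l : seq (R * R)) (G h : R -> R).

(** An ordered list of intervals starting to the right of [t]. It can be extended at its left end,
    which suits an argument that moves down from T, and the order keeps the interiors disjoint. *)
Fixpoint chain (O : set R) t l : Prop :=
  if l is (a, b) :: l' then [/\ t <= a, a <= b, `[a, b]%classic `<=` O & chain O b l']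
  else True.

Definition increment G l : R := \sum_(i <- l) (G i.2 - G i.1).

Lemma chain_weak O t t' l : t' <= t -> chain O t l -> chain O t' l.
Proof. by case: l => // -[a b] l t't [ta ab abO c]; split => //; exact: le_trans ta. Qed.

Lemma chain_length O t l : open O -> chain O t l ->
  ((increment id l)%:E <= mu (O `&` `]t, +oo[))%E.
Proof.
move=> oO; have mO : measurable (O : set (measurableTypeR R)) := open_measurable oO.
elim: l t => [|[a b] l IH] t /=; first by rewrite /increment big_nil.
move=> [ta ab abO /IH h]; rewrite /increment big_cons EFinD.
(* The left endpoint is dropped so that this interval is disjoint from the half-line where the rest
   of the chain lives. *)
have <- : mu `]a, b]%classic = (b - a)%:E.
  by rewrite lebesgue_measure_itv/= lte_fin; case: ltgtP ab => // ->; rewrite subrr.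
apply: le_trans (leeD2l _ h) _; rewrite -measureU//.
- apply: le_measure; rewrite ?inE//.
  + by apply: measurableU => //; exact: measurableI.
  + exact: measurableI.
  + move=> x [/=|[/= Ox]]; rewrite !in_itv/= ?andbT.
      move=> /andP[ax xb]; split; last exact: le_lt_trans ax.
      by apply: abO; rewrite /= in_itv/= (ltW ax).
    by move=> bx; split => //; apply: le_lt_trans bx; exact: le_trans ab.
- exact: measurableI.
- apply/seteqP; split => x //= [] /=; rewrite !in_itv/= andbT => /andP[_ xb] [_].
  by rewrite ltNge xb.
Qed.

(** Only growth is bounded, not variation, so the property survives the subtraction of a
    nondecreasing function. *)
Definition upper_AC G t0 T := forall eps : R, 0 < eps -> exists2 delta : R, 0 < delta &
  forall l, chain `[t0, T] t0 l -> increment id l < delta -> increment G l <= eps.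

(* A chain in an open set [O] is no longer than [O]: upper absolute continuity bounds the
   growth of [G] over the exceptional null set, the rate bound controls it elsewhere, and a
   supremum argument exhausts [t0, T]. *)
Lemma creeping0 G t0 T : t0 <= T -> upper_AC G t0 T ->
  {ae mu, forall t, t0 < t <= T -> forall eps : R, 0 < eps ->
    exists2 delta : R, 0 < delta & forall k, 0 < k < delta -> G t - G (t - k) <= eps * k} ->
  G T <= G t0.
Proof.
move=> t0T GAC [E [mE E0 GE]].
have main eps : 0 < eps -> G T - G t0 <= eps * (T - t0) + eps.
  move=> e0; have [delta d0 Gd] := GAC _ e0.
  have Efin : (mu E < +oo)%E by rewrite E0 ltry.
  have [ O [oO EO OE]] := lebesgue_regularity_outer mE Efin d0.
  have muO : (mu O < delta%:E)%E.
    have mO : measurable (O : set (measurableTypeR R)) := open_measurable oO.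
    rewrite -(setDUK EO) measureU//; last first.
      by apply/seteqP; split => x // [Ex []].
      exact: measurableD.
    by move: OE; rewrite -[X in (X < _)%E -> _]add0e -E0.
  pose A := O `&` `[t0, T]%classic.
  (* P t: from t to T the function grows by at most eps per unit of time, apart from its increments
     over a chain inside O. The slack eta allows P to pass to the infimum. *)
  pose P t := t0 <= t <= T /\ forall eta : R, 0 < eta -> exists l, chain A t l /\
    G T - G t <= eps * (T - t) + increment G l + eta.
  have PT : P T.
    split; first by rewrite t0T lexx.
    by move=> eta eta0; exists [::]; rewrite /increment big_nil !subrr mulr0 !add0r ltW.
  have hS : has_inf P by split; [exists T|exists t0 => t [/andP[]]].
  set s := inf P.
  have t0s : t0 <= s by apply: lb_le_inf; [exists T|move=> t [/andP[]]].
  have lbs t : P t -> s <= t by move=> Pt; apply: inf_lbound => //; case: hS.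
  have sT : s <= T by exact: lbs.
  (* The infimum belongs to P: the increment of G from s to a nearby t1 in P is at most eta / 2 by
     upper absolute continuity, and the other half of eta is spent at t1. *)
  have Ps : P s.
    split; first by rewrite t0s.
    move=> eta eta0; have eta2 : 0 < eta / 2 by rewrite divr_gt0.
    have [d' d'0 Gd'] := GAC _ eta2.
    have [t1 Pt1 t1s] := inf_adherent d'0 hS.
    have [/andP[t0t1 t1T] Q1] := Pt1; have [l [cl hl]] := Q1 _ eta2.
    have st1 := lbs _ Pt1.
    exists l; split; first exact: chain_weak cl.
    have : increment G [:: (s, t1)] <= eta / 2.
      apply: Gd' => /=; last by rewrite /increment big_cons big_nil addr0/=; rewrite ltrBlDl.
      split => // x /=; rewrite !in_itv/= => /andP[sx xt].
      by rewrite (le_trans t0s sx) (le_trans xt t1T).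
    rewrite /increment big_cons big_nil addr0 /= => h.
    have : eps * (T - t1) <= eps * (T - s) by rewrite ler_pM2l// lerD2l lerN2.
    by move: hl h; rewrite /increment; lra.
  have [t0s'|st0] := ltP t0 s.
    exfalso; have [_ Qs] := Ps.
    (* Inside the open set an interval to the left of s joins the chain; outside it s is not
       exceptional and the rate bound gives a step to the left. Either way P holds below its
       infimum. *)
    have [Os|nOs] := pselect (O s).
      have /nbhs_ballP[r /= r0 rO] : nbhs s O by exact: open_nbhs_nbhs.
      pose t' := Num.max t0 (s - r / 2).
      have t's : t' < s by rewrite gt_max t0s' ltrBlDr ltrDl divr_gt0.
      have t0t' : t0 <= t' by rewrite le_max lexx.
      suff /lbs : P t' by rewrite leNgt t's.
      split; first by rewrite t0t' (le_trans (ltW t's)).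
      move=> eta eta0; have [l [cl hl]] := Qs _ eta0.
      exists ((t', s) :: l); split.
        split=> //; first exact: ltW.
        move=> x /=; rewrite in_itv/= => /andP[t'x xs]; split.
          apply: rO; rewrite /ball/= ger0_norm ?subr_ge0//.
          have : s - r / 2 <= x by apply: le_trans t'x; rewrite le_max lexx orbT.
          by move=> h; lra.
        by rewrite /= in_itv/= (le_trans t0t' t'x) (le_trans xs sT).
      rewrite /increment big_cons/=.
      have : eps * (T - s) <= eps * (T - t') by rewrite ler_pM2l// lerD2l lerN2 ltW.
      by move: hl; rewrite /increment; lra.
    have nEs : ~ E s by move=> /EO.
    have := contra_not (GE s) nEs.
    move=> /contrapT/(_ _ _ e0) [|d1 d10 hd]; first by rewrite t0s' sT.
    pose k := Num.min (d1 / 2) (s - t0).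
    have k0 : 0 < k by rewrite lt_min divr_gt0//= subr_gt0.
    have kd : k < d1.
      by rewrite gt_min; apply/orP; left; rewrite ltr_pdivrMr// ltr_pMr// ltr1n.
    have ks : k <= s - t0 by rewrite ge_min lexx orbT.
    have hk : G s - G (s - k) <= eps * k by apply: hd; rewrite k0.
    suff /lbs : P (s - k) by rewrite leNgt ltrBlDr ltrDl k0.
    split; first by rewrite lerBrDr -lerBrDl ks lerBlDr (le_trans sT)// lerDl ltW.
    move=> eta eta0; have [l [cl hl]] := Qs _ eta0.
    exists l; split; first by apply: chain_weak cl; rewrite lerBlDr lerDl ltW.
    have -> : eps * (T - (s - k)) = eps * (T - s) + eps * k by ring.
    by move: hl hk; lra.
  have {st0}st0 : s = t0 by apply/le_anti; rewrite st0.
  move: Ps; rewrite st0 => -[_ Q0].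
  apply/ler_addgt0Pr => eta /Q0[l [cl hl]].
  have chain_sub B C t k : B `<=` C -> chain B t k -> chain C t k.
    move=> BC; elim: k t => [//|[c d] k IH] t /= [tc cd cdB /IH h]; split => //.
    exact: subset_trans BC.
  apply: le_trans hl _; rewrite lerD2r lerD2l.
  apply: Gd; first by apply: chain_sub cl => x [].
  have cO : chain O t0 l by apply: chain_sub cl => x [].
  rewrite -lte_fin; apply: le_lt_trans (chain_length oO cO) _.
  apply: le_lt_trans muO; apply: le_measure; rewrite ?inE//.
  - by apply: measurableI => //; exact: open_measurable.
  - exact: open_measurable.
apply/ler_addgt0Pr => e e0.
have d0 : 0 < T - t0 + 1 by rewrite ltr_pwDr// subr_ge0.
have := main (e / (T - t0 + 1)) (divr_gt0 e0 d0).
have -> : e / (T - t0 + 1) * (T - t0) + e / (T - t0 + 1) = e by field; rewrite gt_eqF.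
by rewrite lerBlDl.
Qed.

Definition primitive h (x : R) : R := \int[mu]_(t in `]-oo, x]) h t.

Lemma primitive_nondecreasing h x y : mu.-integrable setT (EFin \o h) ->
  (forall t, 0 <= h t) -> x <= y -> primitive h x <= primitive h y.
Proof.
move=> Ih h0 xy; have mh := integrable_measurable Ih.
have If z : mu.-integrable `]-oo, z] (EFin \o h) by apply: integrableS Ih.
rewrite /primitive /Rintegral fine_le//; [exact: integrable_fin_num|exact: integrable_fin_num|].
apply: ge0_subset_integral => //.
- by apply: measurable_funTS; exact/measurable_EFinP.
- by move=> t _; rewrite lee_fin.
- by move=> t /=; rewrite !in_itv/= => /le_trans; apply.
Qed.

Lemma upper_AC_sub G F t0 T : {homo F : x y / x <= y} -> upper_AC G t0 T ->
  upper_AC (fun t => G t - F t) t0 T.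
Proof.
move=> ndF GAC eps e0; have [d d0 Gd] := GAC _ e0; exists d => // l cl /(Gd _ cl).
apply: le_trans; have : forall s, chain `[t0, T] s l ->
    increment (fun t => G t - F t) l <= increment G l.
  rewrite /increment; elim: l {cl} => [|[a b] l IH] s /=; first by rewrite !big_nil.
  move=> [_ ab _ /IH]; rewrite !big_cons/=; have := ndF _ _ ab; lra.
by apply; exact: cl.
Qed.

(** [creeping0] for G minus the primitive of h, whose derivative is h almost everywhere by Lebesgue
    differentiation. The two errors eps / 2 come from the rate of G and from the difference quotient
    of the primitive. *)
Lemma creeping G h t0 T : t0 <= T -> upper_AC G t0 T ->
  mu.-integrable setT (EFin \o h) -> (forall t, 0 <= h t) ->
  {ae mu, forall t, t0 < t <= T -> forall eps : R, 0 < eps ->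
    exists2 delta : R, 0 < delta & forall k, 0 < k < delta ->
      G t - G (t - k) <= (h t + eps) * k} ->
  G T - G t0 <= primitive h T - primitive h t0.
Proof.
move=> t0T GAC Ih h0 HG.
have ndF := fun x y => @primitive_nondecreasing h x y Ih h0.
suff : G T - primitive h T <= G t0 - primitive h t0 by lra.
apply: (@creeping0 (fun t => G t - primitive h t)) => //; first exact: upper_AC_sub.
have D : {ae mu, forall x, derivable (primitive h) x 1 /\ derive1 (primitive h) x = h x}.
  apply: FTC1Ny; first by move=> y; apply: integrableS Ih.
  exact: (open_integrable_locally openT Ih).
have FF := ae_filter_ringOfSetsType mu.
apply: (@filterS2 _ _ FF _ _ _ _ HG D) => t {}HG [dF Fh] t0t eps e0.
have e2 : 0 < eps / 2 by rewrite divr_gt0.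
have [d1 d10 Gd] := HG t0t _ e2.
move/cvg_ex: dF => [l Fl].
have lE : l = h t by rewrite -Fh derive1E; apply/esym/cvg_lim.
move: Fl => /cvgrPdist_le/(_ _ e2) /nbhs_ballP[d2 /= d20 Fd].
exists (Num.min d1 d2); first by rewrite lt_min d10.
move=> k /andP[k0]; rewrite lt_min => /andP[kd1 kd2].
have {}Gd : G t - G (t - k) <= (h t + eps / 2) * k by apply: Gd; rewrite k0.
have {Fd} : `|l - (- k)^-1 *: ((primitive h \o shift t) (- k *: 1) - primitive h t)| <= eps / 2.
  apply: Fd; first by rewrite /ball/= sub0r opprK gtr0_norm.
  by rewrite oppr_eq0 gt_eqF.
rewrite lE /= scaler1 /shift [_ + t]addrC ler_distlC => /andP[h1 _].
move: h1; rewrite /GRing.scale/= invrN mulNr => h1.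
have {}h1 : (h t - eps / 2) * k <= primitive h t - primitive h (t - k).
  have -> : primitive h t - primitive h (t - k) =
      - (k^-1 * (primitive h (t - k) - primitive h t)) * k.
    by field; rewrite gt_eqF.
  by rewrite ler_wpM2r// ltW.
have -> : G t - primitive h t - (G (t - k) - primitive h (t - k)) =
  (G t - G (t - k)) - (primitive h t - primitive h (t - k)) by ring.
by apply: le_trans (lerB Gd h1) (eq_ler _); field.
Qed.

End Creeping.

(** * Truncated weights and interpolation *)

Section Weights.
Context {R : realType}.
Implicit Types f : field3 R.

Lemma cutoff_L2 (w : mR3 R -> R) (C M : R) : measurable_fun setT w ->
  (forall xi, `|w xi| <= C) -> (forall xi, w xi != 0 -> len3 xi <= M) ->
  w \in Lfun (leb3 R) 2%:E.
Proof.
move=> mw wC wM.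
(* A multiple of a Gaussian that is at least C on the ball |xi| <= M, hence an integrable majorant
   of the weight. *)
pose g : mR3 R -> R := fun xi => C * expR (M ^+ 2) * gauss3 (1, 1, 1) 0 xi.
have Ig : (leb3 R).-integrable setT (EFin \o g).
  by apply: integrable_funZ; apply/tensor_sum_integrable/tensor_sum_gauss3; split => /=.
have C0 : 0 <= C := le_trans (normr_ge0 _) (wC (0 : R3 R)).
apply: (@integrable_bounded_L2 _ _ C) => //; apply: integrable_dom mw Ig _ => xi.
have [->|w0] := eqVneq (w xi) 0; first by rewrite normr0 !mulr_ge0 ?expR_ge0 ?gauss3_ge0.
apply: le_trans (wC xi) _; rewrite /g -mulrA ler_peMr//.
have -> : gauss3 (1, 1, 1) 0 xi = expR (- len3 xi ^+ 2).
  by rewrite len3_sqr dot3E /gauss3 /gauss -!expRD /=; congr expR; ring.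
rewrite -expRD -[leLHS]expR0 ler_expR subr_ge0 ler_pXn2r ?nnegrE ?len3_ge0 ?wM//.
exact: le_trans (len3_ge0 xi) (wM _ w0).
Qed.

(** The inner radius keeps |xi|^-1 bounded, the outer one makes the support bounded; the weight is
    then in L2 and increases with n to the weight of chi^-1. *)
Definition annulus_weight (n : nat) (xi : mR3 R) : R :=
  (len3 xi)^-1 * \1_(`[(n.+1%:R)^-1, n.+1%:R]%classic) (len3 xi).

(** Truncation of the weight of chi^1, through which the chi^1 norm of u t becomes a limit of
    continuous functions of t and thus measurable. *)
Definition ball_weight (n : nat) (xi : mR3 R) : R :=
  len3 xi * \1_(`]-oo, n.+1%:R]%classic) (len3 xi).

Let measurable_len3_indic (A : set R) : measurable (A : set (mR R)) ->
  measurable_fun setT (fun xi : mR3 R => \1_A (len3 xi) : R).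
Proof. by move=> mA; exact: (measurableT_comp (measurable_indic mA) measurable_len3). Qed.

Lemma measurable_len3V : measurable_fun setT (fun xi : mR3 R => (len3 xi)^-1).
Proof.
rewrite (_ : (fun xi : mR3 R => (len3 xi)^-1) = (fun xi : mR3 R => len3 xi `^ (- 1))).
  exact: measurable_len3_powR.
by apply/funext => xi; rewrite powR_inv1// len3_ge0.
Qed.

Lemma measurable_annulus_weight n : measurable_fun setT (annulus_weight n).
Proof. by apply: measurable_funM measurable_len3V _; exact: measurable_len3_indic. Qed.

Lemma measurable_ball_weight n : measurable_fun setT (ball_weight n).
Proof. by apply: measurable_funM measurable_len3 _; exact: measurable_len3_indic. Qed.

Lemma annulus_weight_ge0 n xi : 0 <= annulus_weight n xi.
Proof. by rewrite mulr_ge0 ?invr_ge0 ?len3_ge0. Qed.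

Lemma ball_weight_ge0 n xi : 0 <= ball_weight n xi.
Proof. by rewrite mulr_ge0 ?len3_ge0. Qed.

Lemma annulus_weight_le n xi : annulus_weight n xi <= (len3 xi)^-1.
Proof. by rewrite ler_piMr ?invr_ge0 ?len3_ge0// indic_le1. Qed.

Lemma annulus_weight_neq0 n xi : annulus_weight n xi != 0 -> (n.+1%:R)^-1 <= len3 xi <= n.+1%:R.
Proof.
rewrite /annulus_weight indicE; case: (boolP (_ \in _)) => [|_]; last by rewrite mulr0 eqxx.
by rewrite inE/= in_itv.
Qed.

Lemma annulus_weight_neq0_le n xi : annulus_weight n xi != 0 -> len3 xi <= n.+1%:R.
Proof. by move=> /annulus_weight_neq0/andP[]. Qed.

Lemma ball_weight_neq0 n xi : ball_weight n xi != 0 -> len3 xi <= n.+1%:R.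
Proof.
rewrite /ball_weight indicE; case: (boolP (_ \in _)) => [|_]; last by rewrite mulr0 eqxx.
by rewrite inE/= in_itv.
Qed.

Lemma annulus_weight_L2 n : annulus_weight n \in Lfun (leb3 R) 2%:E.
Proof.
apply: (@cutoff_L2 _ n.+1%:R n.+1%:R (measurable_annulus_weight n)) => [xi|xi]; last exact: annulus_weight_neq0_le.
rewrite ger0_norm ?annulus_weight_ge0//; have [->//|/annulus_weight_neq0/andP[h _]] := eqVneq (annulus_weight n xi) 0.
apply: le_trans (annulus_weight_le n xi) _; rewrite -[leRHS]invrK lef_pV2 ?posrE ?invr_gt0//.
by apply: lt_le_trans h; rewrite invr_gt0.
Qed.

Lemma ball_weight_L2 n : ball_weight n \in Lfun (leb3 R) 2%:E.
Proof.
apply: (@cutoff_L2 _ n.+1%:R n.+1%:R (measurable_ball_weight n)) => [xi|xi]; last exact: ball_weight_neq0.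
rewrite ger0_norm ?ball_weight_ge0//; have [->//|/ball_weight_neq0 h] := eqVneq (ball_weight n xi) 0.
by apply: le_trans h; rewrite ler_piMr ?len3_ge0// indic_le1.
Qed.

Let indic_le (A B : set R) (x : R) : (A x -> B x) -> \1_A x <= \1_B x :> R.
Proof.
rewrite !indicE => AB; case: (boolP (x \in A)) => [|_]; last by rewrite ler0n.
by rewrite inE => /AB Bx; rewrite mem_set.
Qed.

Lemma annulus_weight_nd xi : {homo (annulus_weight ^~ xi) : m n / (m <= n)%N >-> m <= n}.
Proof.
move=> m n mn; rewrite ler_wpM2l ?invr_ge0 ?len3_ge0//; apply: indic_le => /=.
rewrite !in_itv/= => /andP[h1 h2]; apply/andP; split.
  by apply: le_trans h1; rewrite lef_pV2 ?posrE// ler_nat.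
by apply: le_trans h2 _; rewrite ler_nat.
Qed.

Lemma ball_weight_nd xi : {homo (ball_weight ^~ xi) : m n / (m <= n)%N >-> m <= n}.
Proof.
move=> m n mn; rewrite ler_wpM2l ?len3_ge0//; apply: indic_le => /=.
by rewrite !in_itv/= => /le_trans; apply; rewrite ler_nat.
Qed.

Let le_truncnS (x : R) n : ((Num.truncn x) <= n)%N -> x <= n.+1%:R.
Proof.
by move=> xn; apply: le_trans (ltW (truncnS_gt x)) _; rewrite ler_nat.
Qed.

Lemma annulus_weight_cvg xi : annulus_weight n xi @[n --> \oo] --> len3 xi `^ (- 1).
Proof.
rewrite powR_inv1 ?len3_ge0//.
(* At the origin both sides are 0, the inverse of 0 being 0. *)
have [x0|x0] := eqVneq (len3 xi) 0.
  rewrite (_ : annulus_weight ^~ xi = cst (len3 xi)^-1); first exact: cvg_cst.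
  by apply/funext => n; rewrite /annulus_weight x0 invr0 mul0r.
have {}x0 : 0 < len3 xi by rewrite lt_neqAle eq_sym x0 len3_ge0.
apply: cvg_near_cst.
exists (maxn (Num.truncn (len3 xi)) (Num.truncn (len3 xi)^-1)) => // n /=.
rewrite geq_max => /andP[n1 n2]; rewrite /annulus_weight indicE mem_set ?mulr1//=.
rewrite in_itv/= le_truncnS// andbT -[leRHS]invrK lef_pV2 ?posrE ?invr_gt0//.
exact: le_truncnS.
Qed.

Lemma ball_weight_cvg xi : ball_weight n xi @[n --> \oo] --> len3 xi `^ 1.
Proof.
rewrite powRr1 ?len3_ge0//; apply: cvg_near_cst.
exists (Num.truncn (len3 xi)) => // n /= n1.
by rewrite /ball_weight indicE mem_set ?mulr1//= in_itv/= le_truncnS.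
Qed.

Lemma wnorm_lim (w : nat -> mR3 R -> R) (w' : mR3 R -> R) f : has_fourier f ->
  (forall n, w n \in Lfun (leb3 R) 2%:E) -> (forall n xi, 0 <= w n xi) ->
  (forall xi, {homo (w ^~ xi) : m n / (m <= n)%N >-> m <= n}) ->
  (forall xi, w n xi @[n --> \oo] --> w' xi) ->
  (wnorm (w n) f)%:E @[n --> \oo] -->
    (\int[leb3 R]_xi (w' xi * fourier_abs f xi)%:E)%E.
Proof.
move=> Ff w2 w0 wnd wc.
rewrite (_ : (fun n => _) = fun n => (\int[leb3 R]_xi (w n xi * fourier_abs f xi)%:E)%E); last first.
  by apply/funext => n; rewrite (Rintegral_EFin (wnorm_integrable (w2 n) Ff)).
have := @cvg_monotone_convergence _ _ _ (leb3 R) setT measurableT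
  (fun n xi => (w n xi * fourier_abs f xi)%:E) _ _ _.
rewrite (_ : (fun x => limn _) = fun xi => (w' xi * fourier_abs f xi)%:E); last first.
  apply/funext => xi; apply: cvg_lim => //; apply: cvg_EFin; first exact: nearW.
  by apply: cvgM; [exact: wc|exact: cvg_cst].
apply.
- by move=> n; exact: measurable_int (wnorm_integrable (w2 n) Ff).
- by move=> n xi _; rewrite lee_fin mulr_ge0// fourier_abs_ge0.
- by move=> xi _ m n mn; rewrite lee_fin ler_wpM2r ?fourier_abs_ge0// wnd.
Qed.

Lemma chi_integrable (m : R) f : has_fourier f -> (chi_norm m f < +oo)%E ->
  (leb3 R).-integrable setT (EFin \o (fun xi : mR3 R => len3 xi `^ m * fourier_abs f xi)).
Proof.
move=> Ff h; apply/integrableP; split.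
  apply/measurable_EFinP; apply: measurable_funM; first exact: measurable_len3_powR.
  exact: measurable_fourier_abs.
apply: le_lt_trans h; apply: eq_ereal_le; apply: eq_integral => xi _.
by rewrite /= ger0_norm// mulr_ge0 ?powR_ge0// fourier_abs_ge0.
Qed.

Lemma fourier_abs_interpolation f : has_fourier f ->
  (chi_norm (- 1) f < +oo)%E -> (chi_norm 1 f < +oo)%E ->
  (leb3 R).-integrable setT (EFin \o (fourier_abs f : mR3 R -> R)) /\
  (\int[leb3 R]_xi fourier_abs f xi) ^+ 2 <=
    fine (chi_norm 1 f) * fine (chi_norm (- 1) f).
Proof.
(* At the origin both weights are 0 by convention and the pointwise bound fails there. The origin is
   enclosed in the null plane where the third coordinate vanishes. *)
move=> Ff hm h1; have Im := chi_integrable Ff hm; have I1 := chi_integrable Ff h1.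
have Ne0 : {ae leb3 R, forall xi : mR3 R, len3 xi != 0}.
  exists (setT `*` [set (0 : R)]); split.
  - by apply: measurableX => //; exact: measurable_set1.
  - by rewrite product_measure1E//= lebesgue_measure_set1 mule0.
  - move=> xi /= /negP; rewrite negbK => /eqP x0; split => //=.
    by have := coord3_le xi 2; rewrite x0 coord32 normr_le0 => /eqP.
have H (l : R) : 0 < l -> {ae leb3 R, forall xi : mR3 R, 2 * fourier_abs f xi <=
    l * (len3 xi `^ 1 * fourier_abs f xi) + l^-1 * (len3 xi `^ (- 1) * fourier_abs f xi)}.
  move=> l0; apply: filterS Ne0 => xi x0.
  have {}x0 : 0 < len3 xi by rewrite lt_neqAle eq_sym x0 len3_ge0.
  rewrite powRr1 ?len3_ge0// powR_inv1 ?len3_ge0// !mulrA -mulrDl ler_wpM2r ?fourier_abs_ge0//.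
  rewrite -subr_ge0 (_ : _ - _ = (l * len3 xi - 1) ^+ 2 / (l * len3 xi)).
    by rewrite divr_ge0 ?sqr_ge0// mulr_ge0 ?ltW.
  by field; rewrite !gt_eqF.
have IF : (leb3 R).-integrable setT (EFin \o (fourier_abs f : mR3 R -> R)).
  apply: integrable_ae_le (measurable_fourier_abs Ff) (integrable_funD I1 Im) _.
  apply: filterS (H 1 ltr01) => xi; rewrite invr1 !mul1r => h.
  rewrite ger0_norm ?fourier_abs_ge0//; apply: le_trans h.
  by rewrite ler_peMl ?fourier_abs_ge0// ler1n.
split => //; apply: sqr_le_of_amgm.
- by apply: Rintegral_ge0 => xi _; exact: fourier_abs_ge0.
- by apply: fine_ge0; apply: integral_ge0 => xi _; rewrite lee_fin mulr_ge0 ?powR_ge0 ?fourier_abs_ge0.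
- by apply: fine_ge0; apply: integral_ge0 => xi _; rewrite lee_fin mulr_ge0 ?powR_ge0 ?fourier_abs_ge0.
move=> l l0; rewrite /chi_norm -/(Rintegral _ _ _) -/(Rintegral _ _ _).
rewrite -(RintegralZl _ measurableT IF) -(RintegralZl l measurableT I1) -(RintegralZl _ measurableT Im).
rewrite -(RintegralD measurableT (integrable_funZ _ I1) (integrable_funZ _ Im)).
apply: (Rintegral_ae_le (integrable_funZ _ IF) (integrable_funD (integrable_funZ _ I1) (integrable_funZ _ Im))).
- by move=> xi; rewrite mulr_ge0 ?fourier_abs_ge0.
- by move=> xi; rewrite addr_ge0// mulr_ge0 ?invr_ge0 ?(ltW l0)// mulr_ge0 ?powR_ge0 ?fourier_abs_ge0.
- exact: H.
Qed.

End Weights.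

(** * Decay along the flow *)

Section Dynamics.
Context {R : realType}.
Implicit Types f g h : field3 R.

Lemma fourier_abs_opp f g xi :
  (forall i, fre f i xi = - fre g i xi /\ fim f i xi = - fim g i xi) ->
  fourier_abs f xi <= fourier_abs g xi.
Proof.
move=> H; apply: fourier_abs_le (fourier_abs_ge0 _ _) _; rewrite -fourier_dot_sqr.
apply: eq_ler; apply: eq_bigr => i _; have [-> ->] := H i.
by rewrite !sqrrN !expr2.
Qed.

Let add_sub_cancel (a b : R) : b + (1 * a + -1 * b) = a.
Proof. by ring. Qed.

Let opp_of_add (a b c d : R) : a = b + c -> b = a + d -> d = - c.
Proof. by lra. Qed.

Section Distance.
Variable w : mR3 R -> R.
Hypotheses (w2 : w \in Lfun (leb3 R) 2%:E) (w0 : forall xi, 0 <= w xi).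

Lemma wnorm_le_ae f g : has_fourier f -> has_fourier g ->
  {ae leb3 R, forall xi : mR3 R, fourier_abs f xi <= fourier_abs g xi} ->
  wnorm w f <= wnorm w g.
Proof.
move=> Ff Fg H.
apply: (Rintegral_ae_le (wnorm_integrable w2 Ff) (wnorm_integrable w2 Fg)).
- by move=> xi; rewrite mulr_ge0// fourier_abs_ge0.
- by move=> xi; rewrite mulr_ge0// fourier_abs_ge0.
- by apply: filterS H => xi h; rewrite ler_wpM2l.
Qed.

Lemma has_fourierB f g : has_fourier f -> has_fourier g ->
  has_fourier (f - g) /\ {ae leb3 R, forall xi : mR3 R, forall i,
    fre f i xi = fre g i xi + fre (f - g) i xi /\ fim f i xi = fim g i xi + fim (f - g) i xi}.
Proof.
move=> Ff Fg; have [Fh H] : has_fourier (f - g) /\ _ := spectrum_lin (a := 1) (b := -1)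
  (h := f - g) Ff Fg (fun i x => ltac:(by rewrite /cpt !mxE mul1r mulN1r)).
split => //; apply: filterS H => xi H i; have [-> ->] := H i.
by rewrite !add_sub_cancel.
Qed.

Lemma wnormB f g : has_fourier f -> has_fourier g -> wnorm w f - wnorm w g <= wnorm w (f - g).
Proof.
move=> Ff Fg; have [Fh H] := has_fourierB Ff Fg; rewrite lerBlDl.
exact: wnorm_triangle H.
Qed.

Lemma wnorm_dist f g : has_fourier f -> has_fourier g ->
  `|wnorm w f - wnorm w g| <= wnorm w (f - g).
Proof.
move=> Ff Fg; rewrite ler_norml wnormB// andbT lerNl opprB.
apply: le_trans (wnormB Fg Ff) _.
have [Fh H] := has_fourierB Ff Fg; have [Fh' H'] := has_fourierB Fg Ff.
apply: wnorm_le_ae => //; apply: filterS2 H H' => xi H H'; apply: fourier_abs_opp => i.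
have [h1 h2] := H i; have [h3 h4] := H' i.
by split; [exact: opp_of_add h1 h3|exact: opp_of_add h2 h4].
Qed.

(** Times are clipped at 0 because continuity of [u] is known on [0, oo) alone, whereas continuity
    on the whole line gives measurability directly. *)
Lemma wnorm_continuous (s : R) (u : R -> field3 R) : 0 <= s -> continuous_Hs s u ->
  continuous (fun t : R => wnorm w (u (Num.max 0 t))).
Proof.
move=> s0 [Hu cu] t1; set W := Num.sqrt (\int[leb3 R]_xi w xi ^+ 2).
have W0 : 0 <= W := sqrtr_ge0 _.
have max0 (t : R) : 0 <= Num.max 0 t by rewrite le_max lexx.
have Fu (t : R) : has_fourier (u (Num.max 0 t)) by have [] := Hu _ (max0 t).
apply/cvgrPdist_le => e e0.
have eW : 0 < e / (W + 1) by rewrite divr_gt0// ltr_pwDr.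
have : \forall t \near Num.max 0 t1, 0 <= t ->
    (Hs_norm s (u t - u (Num.max 0 t1))%R < (e / (W + 1))%:E)%E.
  by have := cu _ (max0 t1) _ (open_ereal_lt' (x := 0%E) (y := (e / (W + 1))%:E) _); apply; rewrite lte_fin.
have cmax : Num.max 0 t @[t --> t1] --> Num.max 0 t1.
  by apply: (@continuous_max _ _ (cst 0) id); [exact: cvg_cst|exact: cvg_id].
move=> /cmax H; apply: (@filterS _ (nbhs t1) _ _ _ _ H) => t /(_ (max0 t)) h.
rewrite distrC; apply: le_trans (wnorm_dist (Fu t) (Fu t1)) _.
have [Fh _] := has_fourierB (Fu t) (Fu t1).
apply: le_trans (wnorm_le_Hs w2 w0 s0 Fh (ltW eW) (ltW h)) _.
rewrite -/W mulrA ler_pdivrMr ?ltr_pwDr// mulrC ler_wpM2l ?(ltW e0)//.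
by rewrite lerDl.
Qed.

Variable M : R.
Hypothesis wM : forall xi, w xi != 0 -> len3 xi <= M.

Let heat_increment (W e x y F G H : R) : 0 <= W -> 0 <= e -> e <= 1 -> 0 <= F -> 0 <= H ->
  (W != 0 -> x <= y) -> 0 <= y -> G <= F + H ->
  W * e * G <= W * (e * expR (- x)) * F + (W * H + y * (W * F)).
Proof.
move=> W0 e0 e1 F0 H0 xy y0 GFH.
have ex : 1 - x <= expR (- x) := expR_ge1Dx (- x).
have [->|/xy {}xy] := eqVneq W 0; first by rewrite !mul0r mulr0 !addr0.
have We0 : 0 <= W * e by rewrite mulr_ge0.
have h1 : W * e * G <= W * e * (F + H) by rewrite ler_wpM2l.
have h2 : W * e * H <= W * H by rewrite ler_wpM2r// ler_piMr.
have h3 : W * e * F * (1 - x) <= W * e * F * expR (- x) by rewrite ler_wpM2l// mulr_ge0.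
have h4 : W * e * F * x <= W * e * F * y by rewrite ler_wpM2l// mulr_ge0.
have h5 : W * e * F * y <= W * F * y by rewrite ler_wpM2r// ler_wpM2r// ler_piMr.
rewrite -subr_ge0 in h1; rewrite -subr_ge0 in h2; rewrite -subr_ge0 in h3.
rewrite -subr_ge0 in h4; rewrite -subr_ge0 in h5; rewrite -subr_ge0.
apply: le_trans (addr_ge0 (addr_ge0 h1 h2) (addr_ge0 h3 (addr_ge0 h4 h5))) (eq_ler _).
by ring.
Qed.

(** Between a and b the Gaussian factor changes by exp (- x) with x = nu (b - a) |xi|^2, at most nu
    (b - a) M^2 on the support of [w], and 1 - x <= exp (- x). The growth is thus bounded by a
    distance in H^s and a multiple of b - a, which suits absolute continuity. *)
Lemma heat_weight_increment (nu T a b : R) f g : 0 <= nu -> a <= b -> b <= T ->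
  has_fourier f -> has_fourier g ->
  wnorm (heat_weight w (nu * (T - b))) g - wnorm (heat_weight w (nu * (T - a))) f <=
  wnorm w (g - f) + nu * (b - a) * M ^+ 2 * wnorm w f.
Proof.
move=> nu0 ab bT Ff Fg; have [Fh H] := has_fourierB Fg Ff.
have th0 : 0 <= nu * (T - b) by rewrite mulr_ge0// subr_ge0.
have tha0 : 0 <= nu * (T - a) by rewrite mulr_ge0// subr_ge0 (le_trans ab).
have Ig := wnorm_integrable (heat_weight_L2 w2 w0 th0) Fg.
have If := wnorm_integrable (heat_weight_L2 w2 w0 tha0) Ff.
have Iwh := wnorm_integrable w2 Fh; have Iwf := wnorm_integrable w2 Ff.
have y0 : 0 <= nu * (b - a) * M ^+ 2 by rewrite mulr_ge0 ?sqr_ge0// mulr_ge0// subr_ge0.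
have IZ := integrable_funZ (nu * (b - a) * M ^+ 2) Iwf.
have IS := integrable_funD Iwh IZ.
have := RintegralD measurableT If IS; rewrite (RintegralD measurableT Iwh IZ).
rewrite (RintegralZl _ measurableT Iwf) => E; rewrite lerBlDl; apply: le_trans (eq_ler E).
apply: (Rintegral_ae_le Ig (integrable_funD If IS)).
- by move=> xi; rewrite mulr_ge0 ?fourier_abs_ge0// heat_weight_ge0.
- move=> xi; rewrite addr_ge0//; first by rewrite mulr_ge0 ?fourier_abs_ge0// heat_weight_ge0.
  apply: addr_ge0; first exact: mulr_ge0 (w0 xi) (fourier_abs_ge0 _ _).
  exact: mulr_ge0 y0 (mulr_ge0 (w0 xi) (fourier_abs_ge0 _ _)).
apply: filterS H => xi H; have GFH := fourier_abs_lip H.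
pose x := nu * (b - a) * len3 xi ^+ 2.
have -> : heat_weight w (nu * (T - a)) xi = w xi * (expR (- (nu * (T - b) * len3 xi ^+ 2)) * expR (- x)).
  by rewrite /heat_weight -expRD; congr (_ * expR _); rewrite /x; ring.
apply: heat_increment => //; rewrite ?expR_ge0 ?fourier_abs_ge0//.
  by rewrite expR_le1 oppr_le0 mulr_ge0// sqr_ge0.
move=> /wM lM; rewrite ler_wpM2l//; first by rewrite mulr_ge0// subr_ge0.
by rewrite ler_pXn2r ?nnegrE ?len3_ge0// (le_trans (len3_ge0 xi)).
Qed.

Let chain_mem (A : set R) (t : R) (l : seq (R * R)) x : chain A t l -> x \in l -> [/\ t <= x.1, x.1 <= x.2, A x.1 & A x.2].
Proof.
elim: l t => //= -[a b] l IH t [ta ab abA cl]; rewrite inE => /predU1P[->/=|/(IH _ cl)].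
  by split => //; apply: abA; rewrite /= in_itv/= lexx ab.
by move=> [bx x12 Ax1 Ax2]; split => //; apply: le_trans bx; exact: le_trans ab.
Qed.

Let chain_ordered (A : set R) (t : R) (l : seq (R * R)) i j : chain A t l -> (i < j)%N -> (j < size l)%N ->
  (nth (0, 0) l i).2 <= (nth (0, 0) l j).1.
Proof.
elim: l t i j => //= -[a b] l IH t [|i] [|j] //= [ta ab abA cl] ij jl.
  by have [] := chain_mem cl (mem_nth (0, 0) jl).
by apply: (IH b i j cl).
Qed.

Lemma upper_AC_heat_weight (s nu t0 T K : R) (u : R -> field3 R) : 0 <= s -> 0 <= nu -> 0 < t0 ->
  t0 <= T -> AC_Hs s u -> (forall t, 0 < t -> wnorm w (u t) <= K) ->
  upper_AC (fun t => wnorm (heat_weight w (nu * (T - t))) (u t)) t0 T.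
Proof.
move=> s0 nu0 t00 t0T [Hu ACu] uK eps eps0; have T0 : 0 < T := lt_le_trans t00 t0T.
set W := Num.sqrt (\int[leb3 R]_xi w xi ^+ 2); have W0 : 0 <= W := sqrtr_ge0 _.
have K0 : 0 <= K := le_trans (wnorm_ge0 w0 _) (uK _ t00).
pose L := nu * M ^+ 2 * K; have L0 : 0 <= L := mulr_ge0 (mulr_ge0 nu0 (sqr_ge0 _)) K0.
(* Half of eps goes to the H^s increments, weighted by W, and half to the total length, weighted by
   L; adding 1 avoids division by 0 as W and L may vanish. *)
have eW : 0 < eps / 2 / (W + 1) by rewrite !divr_gt0// ltr_pwDr.
have [d d0 hd] := ACu T T0 _ eW.
exists (Num.min d (eps / 2 / (L + 1))); first by rewrite lt_min d0 !divr_gt0// ltr_pwDr.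
move=> l cl; rewrite lt_min => /andP[ld lL].
pose a (i : 'I_(size l)) := (nth (0, 0) l i).1; pose b (i : 'I_(size l)) := (nth (0, 0) l i).2.
have ab i : [/\ t0 <= a i, a i <= b i & b i <= T].
  have [h1 h2 _] := chain_mem cl (mem_nth (0, 0) (ltn_ord i)).
  by rewrite /= in_itv/= => /andP[_ h3]; split.
have sumE (F : R -> R) : increment F l = \sum_(i < size l) (F (b i) - F (a i)).
  by rewrite /increment (big_nth (0, 0)) big_mkord.
have Fu (t : R) : 0 < t -> has_fourier (u t) by move=> /ltW/Hu[].
have a0 i : 0 < a i by have [h _ _] := ab i; exact: lt_le_trans h.
have b0 i : 0 < b i by have [_ h _] := ab i; exact: lt_le_trans h.
have := hd (size l) a b.
have -> : \sum_(i < size l) (b i - a i) = increment id l by rewrite sumE.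
move=> {}hd; have {hd} hs : (\sum_(i < size l) Hs_norm s (u (b i) - u (a i))%R <
    (eps / 2 / (W + 1))%:E)%E.
  apply: hd => //; first by move=> i; have [h1 h2 h3] := ab i; split; [exact: ltW|split].
  apply/trivIsetP => i j _ _ ij; apply/seteqP; split => x //= [].
  rewrite !in_itv/= => /andP[h1 h2] /andP[h3 h4].
  have [ij'|ji|/val_inj eij] := ltngtP i j; last by rewrite eij eqxx in ij.
    have := chain_ordered cl ij' (ltn_ord j); rewrite leNgt => /negP; apply.
    exact: lt_trans h3 h2.
  have := chain_ordered cl ji (ltn_ord i); rewrite leNgt => /negP; apply.
  exact: lt_trans h1 h4.
have H0 i : (0 <= Hs_norm s (u (b i) - u (a i))%R)%E.
  by rewrite /Hs_norm; exact: sqrte_ge0.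
have Hfin i : Hs_norm s (u (b i) - u (a i))%R \is a fin_num.
  rewrite ge0_fin_numE//; apply: le_lt_trans (lt_trans hs (ltry _)).
  by rewrite (bigD1 i)//= leeDl// sume_ge0.
pose e i := fine (Hs_norm s (u (b i) - u (a i))%R).
have es : \sum_(i < size l) e i < eps / 2 / (W + 1).
  rewrite -lte_fin -sumEFin [X in (X < _)%E](_ : _ = (\sum_(i < size l) Hs_norm s (u (b i) - u (a i))%R)%E)//.
  by apply: eq_bigr => i _; rewrite fineK.
rewrite sumE; apply: (@le_trans _ _ (\sum_(i < size l) (W * e i + L * (b i - a i)))).
  apply: ler_sum => i _; have [h1 h2 h3] := ab i.
  apply: le_trans (heat_weight_increment nu0 h2 h3 (Fu _ (a0 i)) (Fu _ (b0 i))) _.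
  have [Fh _] := has_fourierB (Fu _ (b0 i)) (Fu _ (a0 i)).
  apply: lerD.
    have He : (Hs_norm s (u (b i) - u (a i))%R <= (e i)%:E)%E by rewrite fineK.
    exact: (wnorm_le_Hs w2 w0 s0 Fh (fine_ge0 (H0 i)) He).
  have -> : L * (b i - a i) = nu * (b i - a i) * M ^+ 2 * K by rewrite /L; ring.
  by rewrite ler_wpM2l ?uK// mulr_ge0 ?sqr_ge0// mulr_ge0// subr_ge0.
rewrite big_split/= -!mulr_sumr -(sumE id).
have small (x y : R) : 0 <= x -> y < eps / 2 / (x + 1) -> x * y <= eps / 2.
  move=> x0; rewrite ltr_pdivlMr ?ltr_pwDr// => h.
  have [y0|y0] := leP y 0; first by rewrite (le_trans (mulr_ge0_le0 x0 y0))// divr_ge0// ltW.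
  by apply: le_trans (ltW h); rewrite mulrC ler_wpM2l ?(ltW y0)// lerDl.
by rewrite [leRHS]splitr lerD ?small// L0.
Qed.

End Distance.
End Dynamics.

(** * The left rate along a solution *)

Section LeftRateInTime.
Context {R : realType}.
Variables (w : mR3 R -> R) (M : R).
Hypotheses (w2 : w \in Lfun (leb3 R) 2%:E) (w0 : forall xi, 0 <= w xi).
Hypothesis wlen : forall xi, w xi <= (len3 xi)^-1.
Hypothesis wM : forall xi, w xi != 0 -> len3 xi <= M.

Let remainder_cancel (k a b d r v : R) : k != 0 -> b = a + d -> r = (- k)^-1 * d + -1 * v ->
  b = a - k * (v + r).
Proof. by move=> k0 -> ->; field. Qed.

(** [heat_weight_step] with the remainder r of the difference quotient at -k. The convection term is
    bounded by N^2, and interpolation replaces N^2 by the product of the two chi norms, of which the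
    chi^-1 norm is at most c. Here [s] is the exponent in which u is differentiable, s - 1 in the
    application. *)
Lemma heat_weight_left_rate (nu Omega s T t c : R) (u : R -> field3 R) (lap cor adv padv : field3 R) :
  0 < nu -> 0 <= s -> 0 < t -> t <= T -> (forall t', 0 <= t' -> has_fourier (u t')) ->
  div_free (u t) -> is_laplacian (u t) lap ->
  is_helmholtz (fun x => cross e3 (u t x)) cor -> is_advection (u t) adv ->
  is_helmholtz adv padv ->
  has_derivative_Hs s u t (nu *: lap - Omega *: cor - padv) ->
  (chi_norm (- 1) (u t) <= c%:E)%E -> (chi_norm 1 (u t) < +oo)%E ->
  forall eps, 0 < eps -> exists2 delta : R, 0 < delta & forall k, 0 < k < delta ->
    wnorm (heat_weight w (nu * (T - t))) (u t) - wnorm (heat_weight w (nu * (T - (t - k)))) (u (t - k)) <=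
    (36 * (2 * pi) ^- 3 * c * fine (chi_norm 1 (u t)) + eps) * k.
Proof.
move=> nu0 s0 t0 tT Fu df Hlap Hcor fadv Hadv [[Fv _] dv] chim chi1 eps eps0.
set v := nu *: lap - Omega *: cor - padv in Fv dv.
have Ff : has_fourier (u t) by exact/Fu/ltW.
have Fadv : has_fourier adv by have [] := Hadv.
have chimfin : (chi_norm (- 1) (u t) < +oo)%E := le_lt_trans chim (ltry _).
have [IF NF] := fourier_abs_interpolation Ff chimfin chi1.
have [IV VN] := convection_le Ff df Fadv fadv IF.
have Hv := fourier_dot_rate Ff df Hlap Hcor Hadv Fv erefl.
set W := Num.sqrt (\int[leb3 R]_xi w xi ^+ 2); have W0 : 0 <= W := sqrtr_ge0 _.
set L := nu ^+ 2 * M ^+ 4 * wnorm w (u t).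
have L0 : 0 <= L.
  apply: mulr_ge0; last exact: wnorm_ge0.
  by apply: mulr_ge0 (sqr_ge0 _) _; exact: exprn_even_ge0.
have eW : 0 < eps / 2 / (W + 1) by rewrite !divr_gt0// ltr_pwDr.
have : \forall h \near 0^', (Hs_norm s (h^-1 *: (u (t + h)%R - u t) - v)%R < (eps / 2 / (W + 1))%:E)%E.
  by apply: (dv _ (open_ereal_lt' (x := 0%E) _)); rewrite lte_fin.
move=> /nbhs_ballP[d /= d0 hd].
(* The bound d makes the remainder small in H^s, t keeps t - k positive, and the last one makes the
   second-order error k L at most eps / 2. *)
exists (Num.min d (Num.min t (eps / 2 / (L + 1)))).
  by rewrite !lt_min d0 t0 !divr_gt0// ltr_pwDr.
move=> k /andP[k0]; rewrite !lt_min => /and3P[kd kt kL].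
have Fg : has_fourier (u (t - k)) by apply: Fu; rewrite subr_ge0 ltW.
pose r := (- k)^-1 *: (u (t - k) - u t) - v.
have hr : (Hs_norm s r < (eps / 2 / (W + 1))%:E)%E.
  apply: hd; first by rewrite /ball/= sub0r opprK gtr0_norm.
  by rewrite /= oppr_eq0 gt_eqF.
have [Fd Hd] := has_fourierB Fg Ff.
have [Fr Hr] : has_fourier r /\ _ := spectrum_lin (a := (- k)^-1) (b := -1) (h := r) Fd Fv
  (fun i x => ltac:(by rewrite /r /cpt !mxE mulN1r)).
have Hg : {ae leb3 R, forall xi : mR3 R, forall i,
    fre (u (t - k)) i xi = fre (u t) i xi - k * (fre v i xi + fre r i xi) /\
    fim (u (t - k)) i xi = fim (u t) i xi - k * (fim v i xi + fim r i xi)}.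
  apply: filterS2 Hd Hr => xi Hd Hr i; have [d1 d2] := Hd i; have [r1 r2] := Hr i.
  have kn0 : k != 0 by rewrite gt_eqF.
  by split; [exact: remainder_cancel kn0 d1 r1|exact: remainder_cancel kn0 d2 r2].
have th0 : 0 <= nu * (T - t) by rewrite mulr_ge0 ?subr_ge0// ltW.
have := heat_weight_step w2 w0 wlen wM nu0 th0 k0 Ff Fg Fr Fadv Hv Hg IV.
have -> : nu * (T - t) + nu * k = nu * (T - (t - k)) by ring.
move=> /le_trans; apply; rewrite mulrC ler_wpM2r ?(ltW k0)//.
have wr : wnorm w r <= eps / 2.
  apply: le_trans (wnorm_le_Hs w2 w0 s0 Fr (ltW eW) (ltW hr)) _.
  rewrite -/W mulrA ler_pdivrMr ?ltr_pwDr// mulrC ler_wpM2l ?lerDl//.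
  exact: divr_ge0 (ltW eps0) (ler0n _ _).
have kL' : k * (nu ^+ 2 * M ^+ 4) * wnorm w (u t) <= eps / 2.
  have -> : k * (nu ^+ 2 * M ^+ 4) * wnorm w (u t) = k * L by rewrite /L; ring.
  move: kL; rewrite ltr_pdivlMr ?ltr_pwDr// => /ltW; apply: le_trans.
  by rewrite ler_wpM2l ?(ltW k0)// lerDl.
have pi0 : 0 <= 36 * (2 * pi) ^- 3 :> R by rewrite mulr_ge0// invr_ge0 exprn_ge0// mulr_ge0// pi_ge0.
have Vc : \int[leb3 R]_xi ((len3 xi)^-1 * fourier_abs adv xi) <=
    36 * (2 * pi) ^- 3 * c * fine (chi_norm 1 (u t)).
  apply: le_trans VN _; rewrite -[leRHS]mulrA; apply: (ler_wpM2l pi0); apply: le_trans NF _.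
  have chi0 m : (0 <= chi_norm m (u t))%E.
    by apply: integral_ge0 => xi _; rewrite lee_fin mulr_ge0 ?powR_ge0 ?fourier_abs_ge0.
  rewrite mulrC ler_wpM2r ?fine_ge0//.
  by rewrite -lee_fin fineK// ge0_fin_numE.
apply: le_trans (lerD kL' (lerD Vc wr)) (eq_ler _).
by rewrite addrCA -splitr.
Qed.

End LeftRateInTime.

(** * Passage to large times *)

Section Decay.
Context {R : realType}.
Notation mu := (@lebesgue_measure R).

Lemma chi_norm_ge0 (m : R) (f : field3 R) : (0 <= chi_norm m f)%E.
Proof.
by apply: integral_ge0 => xi _; rewrite lee_fin mulr_ge0 ?powR_ge0 ?fourier_abs_ge0.
Qed.

Definition heat_chi (th : R) (f : field3 R) : \bar R :=
  \int[leb3 R]_xi ((len3 xi)^-1 * expR (- (th * len3 xi ^+ 2)) * fourier_abs f xi)%:E.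

Lemma measurable_heat_chi (th : R) (f : field3 R) : has_fourier f ->
  measurable_fun setT (fun xi : mR3 R =>
    (len3 xi)^-1 * expR (- (th * len3 xi ^+ 2)) * fourier_abs f xi).
Proof.
move=> Ff; apply: measurable_funM; last exact: measurable_fourier_abs.
apply: measurable_funM; first exact: measurable_len3V.
apply: (measurableT_comp (f := expR)); first exact: measurable_expR.
apply: measurableT_comp => //; apply: measurable_funM => //.
by apply: measurable_funX; exact: measurable_len3.
Qed.

Lemma heat_chi_integrand_ge0 (th : R) (f : field3 R) (xi : mR3 R) :
  0 <= (len3 xi)^-1 * expR (- (th * len3 xi ^+ 2)) * fourier_abs f xi.
Proof. by rewrite mulr_ge0 ?fourier_abs_ge0// mulr_ge0 ?expR_ge0// invr_ge0 len3_ge0. Qed.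

Lemma heat_chi_le (th th' : R) (f : field3 R) : has_fourier f -> th <= th' ->
  (heat_chi th' f <= heat_chi th f)%E.
Proof.
move=> Ff tt'; apply: ge0_le_integral => //.
- by move=> xi _; rewrite lee_fin heat_chi_integrand_ge0.
- apply/measurable_EFinP; exact: measurable_heat_chi.
- apply/measurable_EFinP; exact: measurable_heat_chi.
- move=> xi _; rewrite lee_fin ler_wpM2r ?fourier_abs_ge0//.
  rewrite ler_wpM2l ?invr_ge0 ?len3_ge0// ler_expR lerN2 ler_wpM2r//.
  exact: sqr_ge0.
Qed.

Lemma heat_chi_cvg (nu : R) (f : field3 R) : 0 < nu -> has_fourier f ->
  (chi_norm (- 1) f < +oo)%E -> heat_chi (nu * n%:R) f @[n --> \oo] --> 0%E.
Proof.
move=> nu0 Ff hf.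
have Im := chi_integrable Ff hf.
have := @dominated_convergence _ _ _ (leb3 R) setT measurableT
  (fun n xi => ((len3 xi)^-1 * expR (- (nu * n%:R * len3 xi ^+ 2)) * fourier_abs f xi)%:E)
  (cst 0%E) (fun xi => (len3 xi `^ (- 1) * fourier_abs f xi)%:E) _ _ _ Im _.
case=> //.
- by move=> n; apply/measurable_EFinP; exact: measurable_heat_chi.
- apply: aeW => xi _; apply: cvg_EFin; first exact: nearW.
  have [x0|x0] := eqVneq (len3 xi) 0.
    by under eq_fun do rewrite x0 invr0 !mul0r; exact: cvg_cst.
  have l0 : 0 < nu * len3 xi ^+ 2.
    by rewrite mulr_gt0// exprn_gt0// lt_neqAle eq_sym x0 len3_ge0.
  rewrite -[X in _ --> X](mul0r (fourier_abs f xi)); apply: cvgM; last exact: cvg_cst.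
  rewrite -[X in _ --> X](mulr0 (len3 xi)^-1); apply: cvgM; first exact: cvg_cst.
  rewrite (_ : (fun n : nat => _) = fun n : nat => expR (- (nu * len3 xi ^+ 2)) ^+ n).
    by apply: cvg_expr; rewrite ger0_norm ?expR_ge0// expR_lt1 oppr_lt0.
  by apply/funext => n; rewrite -expRM_natl; congr expR; ring.
- apply: aeW => xi n _; rewrite /= lee_fin ger0_norm ?heat_chi_integrand_ge0//.
  rewrite ler_wpM2r ?fourier_abs_ge0// powR_inv1 ?len3_ge0// ler_piMr ?invr_ge0 ?len3_ge0//.
  by rewrite expR_le1 oppr_le0; exact: mulr_ge0 (mulr_ge0 (ltW nu0) (ler0n _ _)) (sqr_ge0 _).
by move=> _ _; rewrite integral0.
Qed.

Lemma primitive_cvg (h : R -> R) : mu.-integrable setT (EFin \o h) ->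
  primitive h n%:R @[n --> \oo] --> \int[mu]_t h t.
Proof.
move=> Ih; have mh := integrable_measurable Ih.
have := @dominated_convergence _ _ _ mu setT measurableT
  (fun n => EFin \o (h \_ `]-oo, n%:R])) (EFin \o h) (EFin \o (fun t => `|h t|)) _ _ _ _ _.
case=> //.
- move=> n; apply/measurable_EFinP; apply/measurable_restrict => //.
  exact: measurable_funTS.
- exact/measurable_EFinP.
- apply: aeW => t _; apply: cvg_EFin; first exact: nearW.
  apply: cvg_near_cst; exists (Num.truncn `|t|).+1 => // n /= tn.
  rewrite patchE mem_set//= in_itv/= (le_trans (ler_norm t))//.
  by apply: le_trans (ltW (truncnS_gt _)) _; rewrite ler_nat.
- exact: integrable_funn.
- apply: aeW => t n _ /=; rewrite lee_fin patchE; case: ifP => // _.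
  by rewrite normr0.
move=> _ _; rewrite (Rintegral_EFin Ih) => /fine_cvg.
apply: cvg_trans; apply: near_eq_cvg; apply: nearW => n.
by rewrite /primitive Rintegral_mkcond.
Qed.

Lemma primitive_le_total (h : R -> R) (x : R) : mu.-integrable setT (EFin \o h) ->
  (forall t, 0 <= h t) -> primitive h x <= \int[mu]_t h t.
Proof.
move=> Ih h0; have mh := integrable_measurable Ih.
rewrite /primitive /Rintegral fine_le//; [|exact: integrable_fin_num|].
  by apply: integrable_fin_num => //; apply: integrableS Ih.
apply: ge0_subset_integral => //; first exact/measurable_EFinP.
by move=> t _; rewrite lee_fin.
Qed.

End Decay.

Section DecayEstimate.
Context {R : realType}.
Notation mu := (@lebesgue_measure R).
Variables (nu s Omega c C : R) (u0 : field3 R) (u : R -> field3 R).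
Hypotheses (nu_gt0 : 0 < nu) (s_gt : 1 <= s).
Hypothesis u_cont : continuous_Hs s u.
Hypothesis u_sol : NSC_solution nu Omega s u0 u.
Hypothesis u_AC : AC_Hs (s - 1) u.
Hypothesis u_chim : forall t : R, 0 < t -> (chi_norm (- 1) (u t) <= c%:E)%E.
Hypothesis u_chi1 : forall t : R, 0 < t ->
  (\int[mu]_(tau in `[0%R, t]) chi_norm 1 (u tau) <= C%:E)%E.

Let u_fourier (t : R) : 0 <= t -> has_fourier (u t).
Proof. by move=> /(u_cont.1 t)[]. Qed.

(** Clipped at 0 so that it is a measurable function on the whole line; for t >= 0 it is the chi^1
    norm of u t. *)
Let Y (t : mR R) : \bar R := chi_norm 1 (u (Num.max 0 (t : R))).

Let max0 (t : R) : 0 <= Num.max 0 t. Proof. by rewrite le_max lexx. Qed.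

Let Y_ge0 t : (0 <= Y t)%E. Proof. exact: chi_norm_ge0. Qed.

Let Y_measurable : measurable_fun setT Y.
Proof.
apply: (@emeasurable_fun_cvg _ (mR R) R setT
  (fun n t => (wnorm (ball_weight n) (u (Num.max 0 t)))%:E) Y).
  move=> n; apply/measurable_EFinP; apply: measurable_cont.
  apply: (wnorm_continuous (ball_weight_L2 n) (ball_weight_ge0 n) _ u_cont).
  exact: le_trans s_gt.
move=> t _; apply: (wnorm_lim (u_fourier (max0 t)) ball_weight_L2 ball_weight_ge0 ball_weight_nd ball_weight_cvg).
Qed.

(** Monotone convergence over the intervals [0, n + 1], on all of which the integral is bounded by
    the same C. *)
Let Y_half : mu.-integrable setT (Y \_ `[0%R, +oo[).
Proof.
apply/integrableP; split.
  by apply/measurable_restrict => //; apply: measurable_funTS; exact: Y_measurable.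
apply: (@le_lt_trans _ _ C%:E); last exact: ltry.
apply: (@le_trans _ _ (\int[mu]_t (Y \_ `[0%R, +oo[) t)%E).
  apply: eq_ereal_le; apply: eq_integral => t _.
  by rewrite gee0_abs// patchE; case: ifP.
apply: (@integral_nondecreasing_le R _ (mR R) mu (fun n => Y \_ `[0%R, n.+1%:R])
  (Y \_ `[0%R, +oo[) C%:E).
- by move=> n; apply/measurable_restrict => //; apply: measurable_funTS; exact: Y_measurable.
- by move=> n t; rewrite patchE; case: ifP.
- move=> t m n mn; rewrite !patchE; case: ifP => [|_]; last by case: ifP.
  rewrite inE/= in_itv/= => /andP[t0 tm]; rewrite mem_set//= in_itv/= t0.
  by rewrite (le_trans tm)// ler_nat.
- move=> t; apply: cvg_near_cst; exists (Num.truncn `|t|) => // n /= tn.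
  rewrite !patchE; congr (if _ then _ else _).
  apply/idP/idP; rewrite !inE/= !in_itv/= ?andbT; first by case/andP.
  move=> -> /=; rewrite (le_trans (ler_norm t))//.
  by apply: le_trans (ltW (truncnS_gt _)) _; rewrite ler_nat.
- move=> n; rewrite -integral_mkcond; have := u_chi1 (ltr0Sn R n).
  apply: le_trans; apply: eq_ereal_le; apply: eq_integral => t.
  by rewrite inE/= in_itv/= => /andP[t0 _]; rewrite /Y max_r.
Qed.

(** The rate from [heat_weight_left_rate], extended by 0 to negative times because [creeping] asks
    for integrability on the whole line. *)
Let h (t : R) : R := 36 * (2 * pi) ^- 3 * c * fine ((Y \_ `[0%R, +oo[) t).

Let c_ge0 : 0 <= c.
Proof. by have := le_trans (chi_norm_ge0 _ _) (u_chim ltr01); rewrite lee_fin. Qed.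

Let h_integrable : mu.-integrable setT (EFin \o h).
Proof. exact: integrable_funZ (integrable_fine Y_half). Qed.

Let h_ge0 t : 0 <= h t.
Proof.
apply: mulr_ge0; last by apply: fine_ge0; rewrite patchE; case: ifP.
by rewrite mulr_ge0// mulr_ge0// invr_ge0 exprn_ge0// mulr_ge0// pi_ge0.
Qed.

Let annulus_weight_wnorm_le n (f : field3 R) : has_fourier f -> ((wnorm (annulus_weight n) f)%:E <= chi_norm (- 1) f)%E.
Proof.
move=> Ff; rewrite -(Rintegral_EFin (wnorm_integrable (annulus_weight_L2 n) Ff)).
apply: ge0_le_integral => //.
- by move=> xi _; rewrite lee_fin mulr_ge0 ?annulus_weight_ge0 ?fourier_abs_ge0.
- exact: measurable_int (wnorm_integrable (annulus_weight_L2 n) Ff).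
- apply/measurable_EFinP; apply: measurable_funM; first exact: measurable_len3_powR.
  exact: measurable_fourier_abs.
- move=> xi _; rewrite lee_fin ler_wpM2r ?fourier_abs_ge0// powR_inv1 ?len3_ge0//.
  exact: annulus_weight_le.
Qed.

(** [creeping] applies for each annulus with a bound independent of n, since the initial term is
    dominated by the untruncated [heat_chi]. Monotone convergence in n then recovers the full chi^-1
    norm at time T. *)
Lemma chi_decay_le (t0 T : R) : 0 < t0 -> t0 <= T ->
  (chi_norm (- 1) (u T) <= heat_chi (nu * (T - t0)) (u t0) +
    (primitive h T - primitive h t0)%:E)%E.
Proof.
move=> t00 t0T; have T0 := lt_le_trans t00 t0T.
have FT := u_fourier (ltW T0); have Ft0 := u_fourier (ltW t00).
have th0 : 0 <= nu * (T - t0) by rewrite mulr_ge0 ?subr_ge0// ltW.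
have s1 : 0 <= s - 1 by rewrite subr_ge0.
have lim := wnorm_lim FT annulus_weight_L2 annulus_weight_ge0 annulus_weight_nd annulus_weight_cvg.
rewrite /chi_norm; apply: cvge_le lim; apply: nearW => n.
have wM := @annulus_weight_neq0_le R n.
pose G (t : R) := wnorm (heat_weight (annulus_weight n) (nu * (T - t))) (u t).
have GAC : upper_AC G t0 T.
  apply: (upper_AC_heat_weight (annulus_weight_L2 n) (annulus_weight_ge0 n) wM s1 (ltW nu_gt0) t00 t0T u_AC).
  move=> t t_gt0; rewrite -lee_fin; apply: le_trans (u_chim t_gt0).
  exact/annulus_weight_wnorm_le/u_fourier/ltW.
have [_ u_div u_eq] := u_sol.
have Yfin := integrable_ae measurableT Y_half.
have rate : {ae mu, forall t, t0 < t <= T -> forall eps : R, 0 < eps ->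
    exists2 delta : R, 0 < delta & forall k, 0 < k < delta ->
      G t - G (t - k) <= (h t + eps) * k}.
  have FF := ae_filter_ringOfSetsType mu.
  apply: (@filterS2 _ _ FF _ _ _ _ u_eq Yfin) => t u_eqt Yt /andP[t0t tT] eps eps0.
  have t_gt0 : 0 < t := lt_trans t00 t0t.
  have [lap [cor [adv [padv [H1 H2 H3 H4 H5]]]]] := u_eqt t_gt0.
  have YE : (Y \_ `[0%R, +oo[) t = chi_norm 1 (u t).
    by rewrite patchE mem_set ?/Y ?max_r ?ltW//= in_itv/= ltW.
  have := Yt I; rewrite YE ge0_fin_numE ?chi_norm_ge0// => chi1.
  rewrite /h YE.
  exact: (heat_weight_left_rate (annulus_weight_L2 n) (annulus_weight_ge0 n) (annulus_weight_le n) wM nu_gt0 s1 t_gt0 tT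
    u_fourier (u_div _ t_gt0) H1 H2 H3 H4 H5 (u_chim t_gt0) chi1 eps0).
have := creeping t0T GAC h_integrable h_ge0 rate.
rewrite lerBlDr addrC => key.
(* At t = T the Gaussian factor is 1. *)
have -> : wnorm (annulus_weight n) (u T) = G T.
  rewrite /G subrr mulr0; congr wnorm; apply/funext => xi.
  by rewrite /heat_weight mul0r oppr0 expR0 mulr1.
apply: (@le_trans _ _ ((G t0)%:E + (primitive h T - primitive h t0)%:E)%E).
  by rewrite -EFinD lee_fin.
apply: leeD2r; have IG := wnorm_integrable (heat_weight_L2 (annulus_weight_L2 n) (annulus_weight_ge0 n) th0) Ft0.
rewrite -(Rintegral_EFin IG); apply: ge0_le_integral => //.
- by move=> xi _; rewrite lee_fin mulr_ge0 ?fourier_abs_ge0// heat_weight_ge0// => ?; exact: annulus_weight_ge0.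
- exact: measurable_int IG.
- by apply/measurable_EFinP; exact: measurable_heat_chi.
- move=> xi _; rewrite lee_fin ler_wpM2r ?fourier_abs_ge0// ler_wpM2r ?expR_ge0//.
  exact: annulus_weight_le.
Qed.

Lemma chi_decay : chi_norm (- 1) (u t) @[t --> +oo] --> 0%E.
Proof.
have small (eps : R) : 0 < eps -> exists A : R, forall t, A <= t ->
    (chi_norm (- 1) (u t) <= eps%:E)%E.
  move=> eps0; have e2 : 0 < eps / 2 by rewrite divr_gt0.
  have /cvgrPdist_le/(_ _ e2)[N _ /(_ N.+1 (leqnSn _)) /= hN] := primitive_cvg h_integrable.
  (* The index N + 1 rather than N makes t0 positive. By [hN] the integral of h after t0 is at most
     eps / 2. *)
  pose t0 : R := N.+1%:R; have t00 : 0 < t0 by rewrite ltr0Sn.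
  have Ft0 := u_fourier (ltW t00).
  have := heat_chi_cvg nu_gt0 Ft0 (le_lt_trans (u_chim t00) (ltry _)).
  move=> /(_ _ (open_ereal_lt' (x := 0%E) (y := (eps / 2)%:E) _))[|n _ /(_ n (leqnn _)) /= hn].
    by rewrite lte_fin.
  (* [heat_chi] decreases in its first argument, so the single n controls all T >= t0 + n. *)
  exists (t0 + n%:R) => T tT; have t0T : t0 <= T by apply: le_trans tT; rewrite lerDl.
  apply: le_trans (chi_decay_le t00 t0T) _; rewrite [eps]splitr [leRHS]EFinD; apply: leeD.
    apply: le_trans (ltW hn); apply: heat_chi_le => //.
    by rewrite ler_wpM2l ?(ltW nu_gt0)// lerBrDl.
  rewrite lee_fin; apply: le_trans hN; apply: le_trans (ler_norm _).
  by rewrite lerD2r; exact: primitive_le_total.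
have fin (t : R) : 1 <= t -> chi_norm (- 1) (u t) \is a fin_num.
  move=> t1; rewrite ge0_fin_numE ?chi_norm_ge0//.
  exact: le_lt_trans (u_chim (lt_le_trans ltr01 t1)) (ltry _).
apply/fine_cvgP; split.
  by exists 1; split => // t /ltW; exact: fin.
apply/cvgrPdist_le => eps eps0; have [A hA] := small _ eps0.
exists (Num.max 1 A); split; first exact: num_real.
move=> t /=; rewrite gt_max => /andP[/ltW t1 /ltW At].
rewrite sub0r normrN ger0_norm ?fine_ge0 ?chi_norm_ge0//.
by rewrite -lee_fin fineK ?fin// hA.
Qed.

End DecayEstimate.

Theorem corollary5 (R : realType) (nu s Omega : R)
    (nu_gt0 : 0 < nu) (s_gt : 3 / 2 < s)
    (u0 : field3 R) (u0_Hs : Hs s u0) (u0_div : div_free u0)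
    (u0_small : (chi_norm (- 1) u0 < ((2 * pi) ^+ 3 * nu)%:E)%E)
    (u : R -> field3 R)
    (u_cont : continuous_Hs s u)
    (u_sol : NSC_solution nu Omega s u0 u)
    (u_AC : AC_Hs (s - 1) u)
    (u_L1 : L1loc_Hs (s + 1) u)
    (u_bound :
      (ereal_sup [set chi_norm (- 1) (u t) +
          (nu%:E - ((2 * pi) ^- 3)%:E * chi_norm (- 1) u0) *
          \int[@lebesgue_measure R]_(tau in `[0%R, t]) chi_norm 1 (u tau)
        | t in [set t : R | (0 < t)%R]] <= chi_norm (- 1) u0)%E) :
  chi_norm (- 1) (u t) @[t --> +oo] --> 0%E.
Proof.
have chi0_fin : chi_norm (- 1) u0 \is a fin_num.
  by rewrite ge0_fin_numE ?chi_norm_ge0//; exact: lt_trans u0_small (ltry _).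
set c := fine (chi_norm (- 1) u0).
have cE : chi_norm (- 1) u0 = c%:E by rewrite fineK.
have pi3 : 0 < (2 * pi) ^+ 3 :> R by rewrite exprn_gt0// mulr_gt0// pi_gt0.
(* Positive by the smallness of u0; dividing the assumed bound by [gap] bounds the time integral of
   the chi^1 norm by c / gap, uniformly in t. *)
set gap : R := nu - (2 * pi) ^- 3 * c.
have gap_gt0 : 0 < gap.
  by rewrite subr_gt0 mulrC ltr_pdivrMr// mulrC -lte_fin -cE.
have chi1_ge0 (t : R) : (0 <= \int[@lebesgue_measure R]_(tau in `[0%R, t]) chi_norm 1 (u tau))%E.
  by apply: integral_ge0 => tau _; exact: chi_norm_ge0.
have bound (t : R) : 0 < t -> (chi_norm (- 1) (u t) + gap%:E *
    \int[@lebesgue_measure R]_(tau in `[0%R, t]) chi_norm 1 (u tau) <= c%:E)%E.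
  move=> t0; rewrite -[leRHS]cE; apply: le_trans u_bound; apply: ereal_sup_ubound.
  by exists t => //; rewrite cE -EFinM -EFinB.
apply: (@chi_decay R nu s Omega c (gap^-1 * c) u0 u) => //.
- by apply: le_trans (ltW s_gt); lra.
- move=> t /bound; apply: le_trans; apply: leeDl.
  by apply: mule_ge0; [rewrite lee_fin ltW|exact: chi1_ge0].
- move=> t /bound h; rewrite EFinM lee_pdivlMl//; apply: le_trans h.
  by apply: leeDr; exact: chi_norm_ge0.
Qed.
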